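(* Let $k>0$ be real, and let $E_k$ be the Dunkl kernel of type $A_2$ with parameter $k$ on $\mathbb{R}^3$. For all $\lambda=(\lambda_1,\lambda_2,\lambda_3)\in\mathbb{R}^3$ with $\lambda_1+\lambda_2+\lambda_3=0$ and $\lambda_3<\lambda_2<\lambda_1$, and all $\mu=(\mu_1,\mu_2,\mu_3)\in\mathbb{R}^3$, $$E_k(\mu,\lambda)=\frac{\Gamma(3k)}{V(\lambda)^{2k}\Gamma(k)^3}\int_{\lambda_2}^{\lambda_1}\int_{\lambda_3}^{\lambda_2}\bigg\{3(\lambda_1-\lambda_2)(\nu_1-\nu_2)\,\mathcal{J}_{k-\frac12}\left(\frac{(\mu_1-\mu_2)(\nu_1-\nu_2)}{2}\right)$$ $$\qquad-6\Big(\nu_1\nu_2+\frac{\lambda_3}{2}(\nu_1+\nu_2)+\lambda_1\lambda_2\Big)\mathcal{J}_{k-\frac12}'\left(\frac{(\mu_1-\mu_2)(\nu_1-\nu_2)}{2}\right)\bigg\}(\lambda_3-\nu_1)(\lambda_3-\nu_2)\,e^{\frac{(\mu_1+\mu_2-2\mu_3)(\nu_1+\nu_2)}{2}}\,W_k(\nu,\lambda)\,d\nu_1d\nu_2,$$ where $\nu_1$ ranges over $[\lambda_2,\lambda_1]$ and $\nu_2$ ranges over $[\lambda_3,\lambda_2]$.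
   Context: Let $k>0$. The Dunkl operators of type $A_2$ with parameter $k$ act on smooth functions on $\mathbb{R}^3$ by $$T_i=\frac{\partial}{\partial x_i}+k\sum_{1\le j\le 3,\ j\ne i}\frac{1-s_{i,j}}{x_i-x_j},\qquad i=1,2,3,$$ where $s_{i,j}$ acts on functions of $(x_1,x_2,x_3)$ by interchanging the variables $x_i$ and $x_j$. For $y\in\mathbb{R}^3$, the Dunkl kernel $E_k(\cdot,y)$ is the unique (real-analytic) solution on $\mathbb{R}^3$ of the eigenvalue problem $T_i(E_k(\cdot,y))(x)=y_iE_k(x,y)$ for $i=1,2,3$, with $E_k(0,y)=1$. Notation: $$V(\lambda)=(\lambda_1-\lambda_2)(\lambda_1-\lambda_3)(\lambda_2-\lambda_3),$$ $$W_k(\nu,\lambda)=\Big((\lambda_1-\nu_1)(\lambda_1-\nu_2)(\lambda_2-\nu_2)(\nu_1-\lambda_2)(\nu_1-\lambda_3)(\nu_2-\lambda_3)\Big)^{k-1}.$$ The (normalized) modified Bessel function is $$\mathcal{J}_{k-\frac12}(z)=\frac{\Gamma(2k)}{2^{2k-1}\Gamma(k)^2}\int_{-1}^1e^{zt}(1-t^2)^{k-1}\,dt,\qquad z\in\mathbb{R},$$ and $\mathcal{J}_{k-\frac12}'$ denotes its derivative. *)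

(* Defs.v *)
From HB Require Import structures.
From mathcomp Require Import all_boot all_order all_algebra.
From mathcomp Require Import all_classical all_reals all_analysis.

Set Implicit Arguments.
Unset Strict Implicit.
Unset Printing Implicit Defensive.
Import Order.TTheory GRing.Theory Num.Theory.
Import numFieldNormedType.Exports.
Local Open Scope classical_set_scope.
Local Open Scope ring_scope.

(* A point of R^3 is a row vector; its coordinates x_1, x_2, x_3 are the
   entries x 0 0, x 0 1, x 0 2, so indices are shifted down by one. *)

Definition partial (R : realType) (i : 'I_3) (f : 'rV[R]_3 -> R) :
  'rV[R]_3 -> R := fun x => 'D_(delta_mx 0 i) f x.

(* C^infinity: all iterated partial derivatives exist and are continuous. *)
Definition smooth (R : realType) (f : 'rV[R]_3 -> R) : Prop :=
  forall s : seq 'I_3,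
    continuous (foldr (@partial R) f s) /\
    forall (i : 'I_3) (x : 'rV[R]_3),
      derivable (foldr (@partial R) f s) x (delta_mx 0 i).

(* (f - s_ij f) / (x_i - x_j).  For smooth f this quotient extends smoothly
   across the hyperplane x_i = x_j, where its value is (d_i - d_j) f; the
   explicit case is needed because 0 / 0 = 0 here. *)
Definition dunkl_quotient (R : realType) (i j : 'I_3) (f : 'rV[R]_3 -> R)
    (x : 'rV[R]_3) : R :=
  if x 0 i == x 0 j then partial i f x - partial j f x
  else (f x - f (xcol i j x)) / (x 0 i - x 0 j).

Definition dunkl_operator (R : realType) (k : R) (i : 'I_3)
    (f : 'rV[R]_3 -> R) (x : 'rV[R]_3) : R :=
  partial i f x + k * \sum_(j < 3 | j != i) dunkl_quotient i j f x.

(* Such an E is unique when k > 0.  Only smoothness in the first variable is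
   required; real-analyticity of the solution is then automatic. *)
Definition is_dunkl_kernel (R : realType) (k : R)
    (E : 'rV[R]_3 -> 'rV[R]_3 -> R) : Prop :=
  forall y : 'rV[R]_3,
    [/\ smooth (E ^~ y),
        forall (i : 'I_3) (x : 'rV[R]_3),
          dunkl_operator k i (E ^~ y) x = y 0 i * E x y
      & E 0 y = 1].

Definition Gamma (R : realType) (s : R) : R :=
  \int[lebesgue_measure]_(t in `]0, +oo[) (t `^ (s - 1) * expR (- t)).

Definition besselJ (R : realType) (k z : R) : R :=
  Gamma (2 * k) / (2 `^ (2 * k - 1) * Gamma k ^+ 2) *
  \int[lebesgue_measure]_(t in `[(-1), 1])
    (expR (z * t) * (1 - t ^+ 2) `^ (k - 1)).

Definition V (R : realType) (l : 'rV[R]_3) : R :=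
  (l 0 0 - l 0 1) * (l 0 0 - l 0 2) * (l 0 1 - l 0 2).

Definition W (R : realType) (k nu1 nu2 : R) (l : 'rV[R]_3) : R :=
  ((l 0 0 - nu1) * (l 0 0 - nu2) * (l 0 1 - nu2) *
   (nu1 - l 0 1) * (nu1 - l 0 2) * (nu2 - l 0 2)) `^ (k - 1).

(* Main.v *)
Require Import Defs.
(* Restricted to the rays through the six points [s . m], [s] a permutation,
   the Dunkl eigenvalue equations become a closed linear system of ordinary
   differential equations [t F_s' = t A_s F_s - k (3 F_s - sum F_s')], where the
   sum runs over the three [s'] obtained from [s] by a transposition.  The
   reflection part of the system is negative semidefinite, so a solution is
   determined by its values at [t = 0].  The right-hand sides of the formula
   for the six points satisfy the same system: this amounts to integrations by
   parts against [W_k], in which the Bessel equation is used.  Their common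
   value at [t = 0] is a Dixon-Anderson integral; splitting
   [x - y = (x - l2) + (l2 - y)] turns it into products of one-variable
   integrals, evaluated by an analogue of Legendre's relation for elliptic
   integrals. *)
From HB Require Import structures.
From mathcomp Require Import all_boot all_order all_algebra.
From mathcomp Require Import all_classical all_reals all_analysis.
From mathcomp Require Import perm measurable_realfun ring lra.
Import Order.TTheory GRing.Theory Num.Theory.
Import numFieldNormedType.Exports.
Local Open Scope classical_set_scope.
Local Open Scope ring_scope.

Set Implicit Arguments.
Unset Strict Implicit.

(** Only the combination [sum x_i T_i] of the eigenvalue equations is used. The denominators
    [x_i - x_j] cancel in it, so the walls [x_i = x_j] cause no trouble, but it links the six points
    of an orbit, and a candidate solution is required at each of them. As
    [E_k(s m, l) = E_k(m, s^-1 l)], the five other candidates come from permuting [l] in the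
    polynomial factors, up to the sign of the permutation, while the domain and [W_k] stay fixed.
    The point [t = 0] is singular for the resulting system, so uniqueness is not a matter of
    Picard's theorem; the sign of [k] takes its place. For [k < 1] the weights are unbounded at the
    ends of the intervals. Hence continuous functions are integrated against a weight that is merely
    integrable, and integration by parts is applied to [phi^k], which vanishes at the ends for every
    [k > 0]. The constant of the theorem is the inverse of
    [B(2k,k) B(k,k) = Gamma(k)^3 / Gamma(3k)]. *)

Local Notation leb := lebesgue_measure.

(** * Integrals against an integrable weight *)

(** A tube lemma: compactness of the segment makes a property that holds near each [(t0, y)] uniform
    in [y]. *)
Lemma near_segment (R : realType) (T : topologicalType) (a b : R) (t0 : T)
    (P : T -> R -> Prop) :
  (forall y : R, y \in `[a, b] -> \forall z \near (t0, y), P z.1 z.2) ->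
  \forall t \near t0, forall y, y \in `[a, b] -> P t y.
Proof.
move=> H.
have /compact_near_coveringP cov := @segment_compact R a b.
apply: (cov T (nbhs t0) P) => x abx.
have /H [[A B] /= [At0 Bx] AB] : x \in `[a, b] by exact: abx.
by exists (B, A) => //= -[y t] /= [By At]; apply: (AB (t, y)).
Qed.

Lemma integrable_continuousM (R : realType) (a b : R) (w f : R -> R) :
  leb.-integrable `[a, b] (EFin \o w) ->
  {within `[a, b], continuous f} ->
  leb.-integrable `[a, b] (fun x => (f x * w x)%:E).
Proof.
move=> iw cf.
have cpt := @segment_compact R a b.
apply: (@integrableMr _ _ _ leb _ _ f (EFin \o w)) => //.
- by apply: subspace_continuous_measurable_fun => //; exact: compact_measurable.
- have /compact_bounded[M [_ mrt]] := continuous_compact cf cpt.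
  by exists M; split; rewrite ?num_real // => ? ? ? ?; exact: mrt.
Qed.

(* Locked, because conversion tests that unfold integrals are very slow. *)
HB.lock Definition wint (R : realType) (a b : R) (w f : R -> R) : R :=
  \int[leb]_(x in `[a, b]) (f x * w x).

Lemma wintE (R : realType) (a b : R) (w f : R -> R) :
  wint a b w f = \int[leb]_(x in `[a, b]) (f x * w x).
Proof. by rewrite wint.unlock. Qed.

Lemma wintD (R : realType) (a b : R) (w f g : R -> R) :
  leb.-integrable `[a, b] (EFin \o w) ->
  {within `[a, b], continuous f} -> {within `[a, b], continuous g} ->
  wint a b w (fun x => f x + g x) = wint a b w f + wint a b w g.
Proof.
move=> iw cf cg; rewrite !wint.unlock -RintegralD//; last 2 first.
- exact: integrable_continuousM.
- exact: integrable_continuousM.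
by apply: eq_Rintegral => x _; rewrite mulrDl.
Qed.

Lemma wintZ (R : realType) (a b c : R) (w f : R -> R) :
  leb.-integrable `[a, b] (EFin \o w) ->
  {within `[a, b], continuous f} ->
  wint a b w (fun x => c * f x) = c * wint a b w f.
Proof.
move=> iw cf; rewrite !wint.unlock -RintegralZl//; last exact: integrable_continuousM.
by apply: eq_Rintegral => x _; rewrite mulrA.
Qed.

Lemma eq_wint (R : realType) (a b : R) (w f g : R -> R) :
  {in `[a, b], f =1 g} -> wint a b w f = wint a b w g.
Proof.
by move=> fg; rewrite !wint.unlock; apply: eq_Rintegral => x /set_mem xab; rewrite fg.
Qed.

Lemma wint_ge0 (R : realType) (a b : R) (w f : R -> R) :
  (forall x : R, x \in `[a, b] -> 0 <= f x) ->
  (forall x : R, x \in `[a, b] -> 0 <= w x) -> 0 <= wint a b w f.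
Proof.
move=> f0 w0; rewrite wint.unlock; apply: Rintegral_ge0 => x xab.
by apply: mulr_ge0; [exact: f0|exact: w0].
Qed.

Lemma le_wint (R : realType) (a b : R) (w f g : R -> R) :
  leb.-integrable `[a, b] (EFin \o w) ->
  {within `[a, b], continuous f} -> {within `[a, b], continuous g} ->
  (forall x : R, x \in `[a, b] -> 0 <= w x) ->
  (forall x : R, x \in `[a, b] -> f x <= g x) ->
  wint a b w f <= wint a b w g.
Proof.
move=> iw cf cg w0 fg; rewrite !wint.unlock; apply: le_Rintegral.
- exact: measurable_itv.
- exact: integrable_continuousM.
- exact: integrable_continuousM.
by move=> x xab; apply: ler_wpM2r; [exact: w0|exact: fg].
Qed.

(** By [near_segment], [f t] is uniformly close to [f t0] on the segment when [t] is near [t0], and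
    the integral of [|w|] converts this into closeness of the integrals. *)
Lemma wint_continuous (R : realType) (T : topologicalType) (a b : R)
    (w : R -> R) (f : T -> R -> R) (t0 : T) :
  leb.-integrable `[a, b] (EFin \o w) ->
  (\forall t \near t0, {within `[a, b], continuous (f t)}) ->
  (forall y : R, y \in `[a, b] -> {for (t0, y), continuous (fun z => f z.1 z.2)}) ->
  {for t0, continuous (fun t => wint a b w (f t))}.
Proof.
move=> iw cf cF; rewrite wint.unlock.
have iaw : leb.-integrable `[a, b] (fun x => `|w x|%:E).
  by have := integrable_abse iw.
apply/(@cvgrPdist_le _ R^o) => e e0.
set K := \int[leb]_(x in `[a, b]) `|w x|.
have K0 : 0 <= K by apply: Rintegral_ge0 => x _.
have e'0 : 0 < e / (K + 1) by rewrite divr_gt0// ltr_wpDl.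
have ct0 : {within `[a, b], continuous (f t0)} by exact: (nbhs_singleton cf).
have : \forall t \near t0, forall y, y \in `[a, b] ->
    `|f t0 y - f t y| <= e / (K + 1).
  apply: near_segment => y yab.
  have e2 : 0 < (e / (K + 1)) / 2 by rewrite divr_gt0.
  have /(@cvgrPdist_le _ R^o) /(_ _ e2) h1 := cF y yab.
  have h2 : \forall z \near (t0, y), `|f t0 y - f t0 z.2| <= e / (K + 1) / 2.
    have [[A B] /= [At0 By] AB] := h1.
    exists (A, B) => //= -[t z] /= [_ Bz].
    by apply: (AB (t0, z)); split => //=; exact: nbhs_singleton.
  near=> z.
  rewrite -(subrKA (f t0 y)) (le_trans (ler_normD _ _))//.
  rewrite [leRHS]splitr lerD//.
    rewrite distrC; near: z; exact: h2.
  by near: z; exact: h1.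
move=> H; near=> t.
have ct : {within `[a, b], continuous (f t)} by near: t; exact: cf.
have Ht : forall y, y \in `[a, b] -> `|f t0 y - f t y| <= e / (K + 1).
  by near: t; exact: H.
rewrite -RintegralB//; [|exact: integrable_continuousM..].
under eq_Rintegral do rewrite -mulrBl.
have cB : {within `[a, b], continuous (fun x => f t0 x - f t x)}.
  by move=> x; apply: continuousB; [exact: ct0|exact: ct].
apply: (le_trans (le_normr_Rintegral _ _)) => //.
  exact: integrable_continuousM.
apply: (@le_trans _ _ (\int[leb]_(x in `[a, b]) ((e / (K + 1)) * `|w x|))).
  apply: le_Rintegral => //.
  - by have := integrable_abse (integrable_continuousM iw cB).
  - by apply: (integrable_continuousM) => //; move=> ?; exact: cvg_cst.
  - by move=> x xab; rewrite normrM ler_wpM2r// Ht.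
by rewrite RintegralZl// -/K mulrAC ler_pdivrMr ?ltr_wpDl// ler_pM2l// lerDl.
Unshelve. all: by end_near. Qed.

(** Differentiation under the integral sign asks for a dominating function. By compactness [df] is
    bounded on a neighbourhood of [t0] times the segment, so a multiple of [|w|] serves. *)
Lemma wint_is_derive (R : realType) (a b : R) (w : R -> R) (f df : R -> R -> R)
    (t0 : R) :
  leb.-integrable `[a, b] (EFin \o w) ->
  (\forall t \near t0, {within `[a, b], continuous (f t)}) ->
  {within `[a, b], continuous (df t0)} ->
  (forall y : R, y \in `[a, b] ->
    {for (t0, y), continuous (fun z => df z.1 z.2)}) ->
  (\forall t \near t0, forall y, y \in `[a, b] -> is_derive (t : R) (1 : R) (f ^~ y) (df t y)) ->
  is_derive t0 1 (fun t => wint a b w (f t)) (wint a b w (df t0)).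
Proof.
move=> iw cf cdf cDF dfd; rewrite wint.unlock.
have iaw : leb.-integrable `[a, b] (fun x => `|w x|%:E).
  by have := integrable_abse iw.
have [M Mdf] : exists M, forall y, y \in `[a, b] -> `|df t0 y| <= M.
  have /compact_bounded[M [_ mrt]] := continuous_compact cdf (@segment_compact R a b).
  by exists (M + 1) => y yab; apply: (mrt (M + 1)); [rewrite ltrDl|exists y].
have : \forall t \near t0, forall y, y \in `[a, b] -> `|df t y| <= M + 2.
  apply: near_segment => y yab.
  have /(@cvgrPdist_le _ R^o) /(_ _ ltr01) h1 := cDF y yab.
  have My := Mdf _ yab.
  near=> z.
  have /= Hz : `|df t0 y - df z.1 z.2| <= 1 by near: z; exact: h1.
  rewrite -[df z.1 z.2](subKr (df t0 y)) (le_trans (ler_normB _ _))//.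
  have -> : M + 2 = (M + 1) + 1 by ring.
  by rewrite lerD// (le_trans My)// lerDl.
move=> ub.
have [e /= e0 He] : \forall t \near t0,
   [/\ {within `[a, b], continuous (f t)},
       forall y, y \in `[a, b] -> `|df t y| <= M + 2 &
       forall y, y \in `[a, b] -> is_derive (t : R) (1 : R) (f ^~ y) (df t y)].
  near=> t; split; near: t; [exact: cf|exact: ub|exact: dfd].
pose u := t0 - e; pose v := t0 + e.
have He' t : t \in `]u, v[ ->
   [/\ {within `[a, b], continuous (f t)},
       forall y, y \in `[a, b] -> `|df t y| <= M + 2 &
       forall y, y \in `[a, b] -> is_derive (t : R) (1 : R) (f ^~ y) (df t y)].
  move=> tuv; apply: He; rewrite /ball_/= ltr_distlC.
  by move: tuv; rewrite in_itv.
have It0 : `]u, v[%classic t0.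
  by rewrite /= in_itv/= /u /v ltrDl e0 andbT ltrBlDr ltrDl.
pose F := fun t y => f t y * w y.
have d1F t y : `]u, v[%classic t -> y \in `[a, b] ->
    partial1of2 F t y = df t y * w y.
  move=> tuv yab; have [_ _ /(_ _ yab) dd] := He' _ tuv.
  rewrite /partial1of2 derive1E /F.
  apply: derive_val.
  have -> : df t y * w y = w y *: df t y by rewrite mulrC.
  have -> : (fun x => f x y * w y) = (w y *: (f ^~ y)).
    by apply/funext => x /=; rewrite mulrC.
  exact: is_deriveZ.
have intf t : `]u, v[%classic t -> leb.-integrable `[a, b] (EFin \o F t).
  by move=> /He'[ct _ _]; exact: integrable_continuousM.
have derF t y : `]u, v[%classic t -> `[a, b]%classic y ->
    derivable (F ^~ y) t 1.
  move=> tuv yab; have [_ _ /(_ _ yab) dd] := He' _ tuv.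
  have -> : (F ^~ y) = (w y *: (f ^~ y)).
    by apply/funext => x /=; rewrite /F mulrC.
  exact: derivableZ.
have G0 y : 0 <= `|M + 2| * `|w y| by rewrite mulr_ge0.
have iG : leb.-integrable `[a, b] (EFin \o (fun y => `|M + 2| * `|w y|)).
  by apply: integrable_continuousM => //; move=> ?; exact: cvg_cst.
have Gub t y : `]u, v[%classic t -> `[a, b]%classic y ->
    `|partial1of2 F t y| <= `|M + 2| * `|w y|.
  move=> tuv yab; rewrite d1F// normrM ler_wpM2r//.
  have [_ /(_ _ yab) h _] := He' _ tuv.
  by rewrite (le_trans h)// ler_norm.
have mab : measurable `[a, b]%classic by exact: measurable_itv.
have D1 := @derivable_under_integral R _ _ leb F _ mab t0 u v It0 intf derF _ G0 iG Gub.
have D2 := @differentiation_under_integral R _ _ leb F _ mab t0 u v It0 intf derF _ G0 iG Gub.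
apply: DeriveDef; first exact: D1.
rewrite -derive1E [LHS]D2.
by apply: eq_Rintegral => y /set_mem yab; rewrite d1F.
Unshelve. all: by end_near. Qed.

(** * Iterated integrals over a rectangle *)

Definition dint (R : realType) (a1 b1 a2 b2 : R) (w1 w2 : R -> R)
  (f : R -> R -> R) : R := wint a1 b1 w1 (fun x => wint a2 b2 w2 (f x)).

Lemma continuous_pair (T U V : topologicalType) (f : T -> U) (g : T -> V) :
  continuous f -> continuous g -> continuous (fun x => (f x, g x)).
Proof. by move=> cf cg x; exact: (cvg_pair (cf x) (cg x)). Qed.

Lemma continuous_compT (T U V : topologicalType) (f : T -> U) (g : U -> V) :
  continuous f -> continuous g -> continuous (fun x => g (f x)).
Proof. by move=> cf cg x; exact: (cvg_comp _ _ (cf x) (cg (f x))). Qed.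

Lemma continuous_section (T U V : topologicalType)
    (f : T -> U -> V) (t : T) :
  continuous (fun z : T * U => f z.1 z.2) -> continuous (f t).
Proof.
move=> cf; apply: (continuous_compT (f := fun y => (t, y)) _ cf).
by apply: continuous_pair => // y; [exact: cvg_cst|exact: cvg_id].
Qed.

Lemma wint_continuousT (R : realType) (T : topologicalType) (a b : R)
    (w : R -> R) (f : T -> R -> R) :
  leb.-integrable `[a, b] (EFin \o w) ->
  continuous (fun z : T * R => f z.1 z.2) ->
  continuous (fun t => wint a b w (f t)).
Proof.
move=> iw cf t; apply: wint_continuous => //.
  by near=> u; apply: continuous_subspaceT; exact: (@continuous_section).
by move=> y _; exact: cf.
Unshelve. all: by end_near. Qed.

Section DoubleIntegral.
Context (R : realType) (a1 b1 a2 b2 : R) (w1 w2 : R -> R).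
Hypothesis iw1 : leb.-integrable `[a1, b1] (EFin \o w1).
Hypothesis iw2 : leb.-integrable `[a2, b2] (EFin \o w2).
Local Notation I := (dint a1 b1 a2 b2 w1 w2).

Let cont2 (f : R -> R -> R) := continuous (fun z : R * R => f z.1 z.2).

Lemma dintD (f g : R -> R -> R) : cont2 f -> cont2 g ->
  I (fun x y => f x y + g x y) = I f + I g.
Proof.
move=> cf cg; rewrite /dint -wintD//; last 2 first.
- by apply: continuous_subspaceT; exact: wint_continuousT.
- by apply: continuous_subspaceT; exact: wint_continuousT.
apply: eq_wint => x _; apply: wintD => //.
- by apply: continuous_subspaceT; exact: (@continuous_section).
- by apply: continuous_subspaceT; exact: (@continuous_section).
Qed.

Lemma dintZ (c : R) (f : R -> R -> R) : cont2 f ->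
  I (fun x y => c * f x y) = c * I f.
Proof.
move=> cf; rewrite /dint -wintZ//; last first.
  by apply: continuous_subspaceT; exact: wint_continuousT.
apply: eq_wint => x _; apply: wintZ => //.
by apply: continuous_subspaceT; exact: (@continuous_section).
Qed.

Lemma dint_is_derive (f df : R -> R -> R -> R) (t0 : R) :
  continuous (fun z : R * R * R => f z.1.1 z.1.2 z.2) ->
  continuous (fun z : R * R * R => df z.1.1 z.1.2 z.2) ->
  (forall x y t, is_derive (t : R) (1 : R) (fun t => f t x y) (df t x y)) ->
  is_derive t0 1 (fun t => I (f t)) (I (df t0)).
Proof.
move=> cf cdf fd.
have cI (g : R -> R -> R -> R) : continuous (fun z : R * R * R => g z.1.1 z.1.2 z.2) ->
    continuous (fun z : R * R => wint a2 b2 w2 (g z.1 z.2)).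
  exact: (@wint_continuousT _ (R * R)%type _ _ _ (fun z => g z.1 z.2)).
apply: (@wint_is_derive R a1 b1 w1 (fun t x => wint a2 b2 w2 (f t x))
  (fun t x => wint a2 b2 w2 (df t x))) => //.
- near=> t; apply: continuous_subspaceT.
  by apply: (@continuous_section _ _ _ (fun t x => wint a2 b2 w2 (f t x))); exact: cI.
- apply: continuous_subspaceT.
  by apply: (@continuous_section _ _ _ (fun t x => wint a2 b2 w2 (df t x))); exact: cI.
- by move=> y _; apply: cI.
near=> t => x _.
have cS (g : R -> R -> R -> R) : continuous (fun z : R * R * R => g z.1.1 z.1.2 z.2) ->
    continuous (fun z : R * R => g z.1 x z.2).
  move=> cg; apply: (continuous_compT (f := fun z => (z.1, x, z.2)) _ cg).
  apply: continuous_pair => [|z]; last exact: cvg_snd.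
  by apply: continuous_pair => z; [exact: cvg_fst|exact: cvg_cst].
apply: (@wint_is_derive R a2 b2 w2 (fun t => f t x) (fun t => df t x)) => //.
- near=> u; apply: continuous_subspaceT.
  by apply: (@continuous_section _ _ _ (fun t => f t x)); exact: cS.
- by apply: continuous_subspaceT; apply: (@continuous_section _ _ _ (fun t => df t x)); exact: cS.
- by move=> y _; exact: cS.
- by near=> u => y _; exact: fd.
Unshelve. all: by end_near. Qed.

End DoubleIntegral.

(** * The fundamental theorem of calculus with integrable singularities at the ends *)

Lemma derive0_segment_eq (R : realType) (a b : R) (h : R -> R) :
  a <= b -> {within `[a, b], continuous h} ->
  (forall x : R, x \in `]a, b[ -> is_derive x (1 : R) h 0) -> h b = h a.
Proof.
move=> ab ch dh.
have [c _] := MVT_segment ab (df := fun=> 0) dh ch.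
by rewrite mul0r => /eqP; rewrite subr_eq0 => /eqP.
Qed.

(** As [f] may be unbounded at the ends, two primitives are compared: [F - h] is continuous on the
    closed segment and has derivative zero inside. *)
Lemma Rintegral_derive (R : realType) (a b : R) (h f : R -> R) :
  a < b -> {within `[a, b], continuous h} ->
  (forall x : R, x \in `]a, b[ -> is_derive x (1 : R) h (f x)) ->
  {in `]a, b[, continuous f} ->
  leb.-integrable `[a, b] (EFin \o f) ->
  \int[leb]_(x in `[a, b]) f x = h b - h a.
Proof.
move=> ab ch dh cf if_.
pose F x := \int[leb]_(t in `[a, x]) f t.
have cF : {within `[a, b], continuous F}.
  exact: (parameterized_integral_continuous (ltW ab) if_).
have Fa : F a = 0 by rewrite /F set_itv1 Rintegral_set1.
have : F b - h b = F a - h a.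
  apply: (@derive0_segment_eq _ a b (fun x => F x - h x)) => //.
  - exact: ltW.
  - by move=> x; apply: continuousB; [exact: cF|exact: ch].
  move=> x xab; have /andP[ax xb] : (a < x) && (x < b) by rewrite in_itv in xab.
  have [dF F'] := continuous_FTC1_closed xb if_ ax (cf x xab).
  have isF : is_derive x (1 : R) F (f x).
    by apply: DeriveDef; [exact: dF|rewrite -derive1E; exact: F'].
  have := dh x xab => isH.
  have -> : 0 = f x - f x by rewrite subrr.
  exact: is_deriveB.
rewrite Fa sub0r -/(F b) => /(canRL (subrK _)) ->; by rewrite addrC.
Qed.

Lemma measurable_itv_oo_cc (R : realType) (a b : R) (f : R -> R) :
  measurable_fun `]a, b[ f -> measurable_fun `[a, b] f.
Proof.
move=> mf.
have [ab|ba] := ltP a b; last first.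
  move: ba; rewrite le_eqVlt => /predU1P[->|ba]; last first.
    by rewrite set_itv_ge ?bnd_simp -?ltNge//; exact: measurable_fun_set0.
  rewrite set_itv1; exact: measurable_fun_set1.
by apply/measurable_fun_itv_obnd_cbndP/measurable_fun_itv_bndo_bndcP.
Qed.

(** The integrals over the segments [[a + d n, b - d n]] are differences of values of the bounded
    function [h]; monotone convergence carries their common bound over to []a, b[]. *)
Lemma integrable_ge0_derive (R : realType) (a b : R) (h f : R -> R) :
  a < b -> {within `[a, b], continuous h} ->
  (forall x : R, x \in `]a, b[ -> is_derive x (1 : R) h (f x)) ->
  {in `]a, b[, continuous f} ->
  (forall x : R, x \in `]a, b[ -> 0 <= f x) ->
  leb.-integrable `[a, b] (EFin \o f).
Proof.
move=> ab ch dh cf f0.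
have mfo : measurable_fun `]a, b[ f.
  by apply: open_continuous_measurable_fun => //; exact/in_continuous_mksetP.
have mf : measurable_fun `[a, b] f by exact: measurable_itv_oo_cc.
apply/integrableP; split; first exact/measurable_EFinP.
rewrite (@integral_itv_bndoo _ _ _ (fun x => `|(f x)%:E|)%E); last first.
  by apply: measurableT_comp => //; exact/measurable_EFinP.
have [M [M0 HM]] : exists M, 0 <= M /\ forall y, y \in `[a, b] -> `|h y| <= M.
  have /compact_bounded[M [_ mrt]] := continuous_compact ch (@segment_compact R a b).
  exists (`|M| + 1); split; first by rewrite addr_ge0.
  by move=> y yab; apply: (mrt (`|M| + 1)); [rewrite ltr_pwDr// ler_norm|exists y].
(* The shift by 3 gives [2 * d n < b - a], so that every [F n] is a nondegenerate segment. *)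
pose d n : R := (b - a) / n.+3%:R.
have d0 n : 0 < d n by rewrite divr_gt0// subr_gt0.
have d2 n : d n + d n < b - a.
  rewrite /d -mulrDl ltr_pdivrMr//.
  have : (b - a) * 3 <= (b - a) * n.+3%:R by rewrite ler_pM2l ?subr_gt0// ler_nat.
  by move: ab; rewrite -subr_gt0; lra.
pose F (n : nat) : set R := `[a + d n, b - d n]%classic.
have Fab n x : F n x -> x \in `]a, b[.
  rewrite /F/= !in_itv/= => /andP[h1 h2]; apply/andP; split.
    by rewrite (lt_le_trans _ h1)// ltrDl.
  by rewrite (le_lt_trans h2)// ltrBlDr ltrDl.
have dnn : nonincreasing_seq d.
  by move=> m n mn; rewrite /d ler_pM2l ?subr_gt0// lef_pV2 ?posrE// ler_nat.
have ndF : nondecreasing_seq F.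
  move=> m n mn; apply/subsetPset/subset_itv; rewrite bnd_simp.
    by rewrite lerD2l dnn.
  by rewrite lerB// dnn.
have FU : \bigcup_i F i = `]a, b[%classic.
  apply/seteqP; split=> [x [n _ /Fab]//|x /=]; rewrite in_itv/= => /andP[ax xb].
  pose e := Num.min (x - a) (b - x).
  have e0 : 0 < e by rewrite lt_min !subr_gt0 ax xb.
  have [n Hn] : exists n, d n <= e.
    exists (Num.truncn ((b - a) / e)).
    rewrite /d ler_pdivrMr// mulrC -ler_pdivrMr//.
    rewrite (le_trans (ltW (truncnS_gt _)))// ler_nat.
    by do 2 apply: leqW.
  exists n => //; rewrite /F/= in_itv/=.
  have : d n <= x - a by rewrite (le_trans Hn)// ge_min lexx.
  have : d n <= b - x by rewrite (le_trans Hn)// ge_min lexx orbT.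
  by move=> h1 h2; apply/andP; split; lra.
have If n : (\int[leb]_(x in F n) `|(f x)%:E| <= (M + M)%:E)%E.
  have anbn : a + d n < b - d n by have := d2 n; lra.
  have sub1 : `[a + d n, b - d n] `<=` `[a, b].
    by apply: subset_itv; rewrite bnd_simp; have := d0 n; lra.
  have cfn : {within `[a + d n, b - d n], continuous f}.
    apply: (@continuous_subspaceW _ _ _ `]a, b[).
      by move=> x; exact: Fab.
    rewrite continuous_open_subspace//.
    by move=> x /set_mem xab; exact: cf.
  have -> : (\int[leb]_(x in F n) `|(f x)%:E| = \int[leb]_(x in F n) (f x)%:E)%E.
    apply: eq_integral => x /set_mem xF /=; rewrite ger0_norm// f0//.
    exact: Fab xF.
  have ifn : leb.-integrable (F n) (EFin \o f).
    by apply: continuous_compact_integrable => //; exact: segment_compact.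
  have -> : (\int[leb]_(x in F n) (f x)%:E)%E = (\int[leb]_(x in F n) f x)%:E.
    by rewrite /Rintegral fineK//; apply: integrable_fin_num => //; exact: measurable_itv.
  rewrite lee_fin.
  have H1 : {within `[a + d n, b - d n], continuous h}.
    exact: (continuous_subspaceW sub1).
  have H2 (x : R) : x \in `]a + d n, b - d n[ -> is_derive x (1 : R) h (f x).
    by move=> xF; apply: dh; apply: (Fab n); exact: (subset_itv_oo_cc xF).
  have H3 : {in `]a + d n, b - d n[, continuous f}.
    by move=> x xF; apply: cf; apply: (Fab n); exact: (subset_itv_oo_cc xF).
  have E := @Rintegral_derive R (a + d n) (b - d n) h f anbn H1 H2 H3 ifn.
  rewrite /F E.
  rewrite (le_trans (ler_norm _))// (le_trans (ler_normB _ _))//.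
  apply: lerD; apply: HM; rewrite in_itv/=; have := d0 n; have := d2 n; lra.
have mF n : measurable (F n) by exact: measurable_itv.
have mfF n : measurable_fun (F n) (fun x => `|(f x)%:E|%E).
  apply: measurableT_comp => //; apply/measurable_EFinP.
  by apply: measurable_funS mfo => // x; exact: Fab.
have F0 n x : F n x -> (0 <= `|(f x)%:E|)%E by [].
have C : ((\int[leb]_(x in F n) `|(f x)%:E|) @[n --> \oo] -->
    \int[leb]_(x in \bigcup_n F n) `|(f x)%:E|)%E.
  by apply: ge0_nondecreasing_set_cvg_integral => // n x; exact: F0.
rewrite -FU; apply: (@le_lt_trans _ _ (M + M)%:E); last by rewrite ltry.
by apply: (cvge_to_le C); apply: nearW => n; exact: If.
Qed.

(** * Derivation, continuity and power weights *)

Section DerivativeRules.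
Context (R : realType).
Implicit Types (f g : R -> R) (x a b : R).

Lemma is_derive_eqr f x a b :
  is_derive x (1 : R) f a -> a = b -> is_derive x (1 : R) f b.
Proof. by move=> ? <-. Qed.

Lemma is_derive_funD f g x a b :
  is_derive x (1 : R) f a -> is_derive x (1 : R) g b ->
  is_derive x (1 : R) (fun y => f y + g y) (a + b).
Proof. exact: is_deriveD. Qed.

Lemma is_derive_funN f x a :
  is_derive x (1 : R) f a -> is_derive x (1 : R) (fun y => - f y) (- a).
Proof. exact: is_deriveN. Qed.

Lemma is_derive_funM f g x a b :
  is_derive x (1 : R) f a -> is_derive x (1 : R) g b ->
  is_derive x (1 : R) (fun y => f y * g y) (a * g x + f x * b).
Proof.
move=> fa gb; have -> : a * g x + f x * b = f x *: b + g x *: a.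
  by rewrite /GRing.scale/= addrC [a * _]mulrC.
exact: is_deriveM.
Qed.

Lemma is_derive_funcst c x : is_derive x (1 : R) (fun=> c : R) (0 : R).
Proof. exact: is_derive_cst. Qed.

Lemma is_derive_funid x : is_derive x (1 : R) (fun y : R => y) (1 : R).
Proof. exact: is_derive_id. Qed.

Lemma is_derive_funcomp f g x a b :
  is_derive (g x) (1 : R) f a -> is_derive x (1 : R) g b ->
  is_derive x (1 : R) (fun y => f (g y)) (a * b).
Proof. exact: is_derive1_comp. Qed.

Lemma is_derive_expR_comp g x b :
  is_derive x (1 : R) g b ->
  is_derive x (1 : R) (fun y => expR (g y)) (expR (g x) * b).
Proof. by move=> gb; apply: is_derive_funcomp; exact: is_derive_expR. Qed.

Lemma is_derive_powR_comp g s x b : 0 < g x ->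
  is_derive x (1 : R) g b ->
  is_derive x (1 : R) (fun y => g y `^ s) (s * g x `^ (s - 1) * b).
Proof.
move=> g0 gb; apply: (is_derive_funcomp (f := fun y => y `^ s)) => //.
exact: is_derive1_powR.
Qed.

End DerivativeRules.

(* [notypeclasses] keeps the [is_derive] instances of the library from being
   inferred, so that the derivative is computed by the rules above. *)
Ltac deriv :=
  first [eassumption | lazymatch goal with
  | |- is_derive _ _ (fun x => @?f x + @?g x) _ =>
      notypeclasses refine (@is_derive_funD _ f g _ _ _ _ _); deriv
  | |- is_derive _ _ (fun x => - @?f x) _ =>
      notypeclasses refine (@is_derive_funN _ f _ _ _); deriv
  | |- is_derive _ _ (fun x => @?f x * @?g x) _ =>
      notypeclasses refine (@is_derive_funM _ f g _ _ _ _ _); deriv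
  | |- is_derive _ _ (fun x => expR (@?g x)) _ =>
      notypeclasses refine (@is_derive_expR_comp _ g _ _ _); deriv
  | |- is_derive _ _ (fun x => (@?g x) `^ ?s) _ =>
      notypeclasses refine (@is_derive_powR_comp _ g s _ _ _ _); deriv
  | |- is_derive _ _ (fun x => x) _ => exact: is_derive_funid
  | |- is_derive _ _ (fun x => ?c) _ =>
      first [exact: is_derive_funcst | idtac]
  | |- _ => idtac
  end].

Section ContinuityRules.
Context (R : realType) (T : topologicalType).
Implicit Types (f g : T -> R).

Lemma continuous_funD f g : continuous f -> continuous g ->
  continuous (fun x => f x + g x).
Proof. by move=> cf cg x; exact: (cvgD (cf x) (cg x)). Qed.

Lemma continuous_funN f : continuous f -> continuous (fun x => - f x).
Proof. by move=> cf x; exact: (cvgN (cf x)). Qed.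

Lemma continuous_funM f g : continuous f -> continuous g ->
  continuous (fun x => f x * g x).
Proof. by move=> cf cg x; exact: (cvgM (cf x) (cg x)). Qed.

Lemma continuous_funcst (c : R) : continuous (fun _ : T => c).
Proof. by move=> x; exact: cvg_cst. Qed.

Lemma continuous_expR_comp f : continuous f -> continuous (fun x => expR (f x)).
Proof.
by move=> cf; apply: (continuous_compT cf); exact: continuous_expR.
Qed.

End ContinuityRules.

Lemma continuous_fst (T U : topologicalType) : continuous (fun z : T * U => z.1).
Proof. by move=> z; exact: cvg_fst. Qed.

Lemma continuous_snd (T U : topologicalType) : continuous (fun z : T * U => z.2).
Proof. by move=> z; exact: cvg_snd. Qed.

Lemma continuous_fst_comp (S T U : topologicalType) (f : S -> T * U) :
  continuous f -> continuous (fun x => (f x).1).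
Proof. by move=> cf; apply: (continuous_compT cf); exact: continuous_fst. Qed.

Lemma continuous_snd_comp (S T U : topologicalType) (f : S -> T * U) :
  continuous f -> continuous (fun x => (f x).2).
Proof. by move=> cf; apply: (continuous_compT cf); exact: continuous_snd. Qed.

Ltac cont :=
  lazymatch goal with
  | |- continuous (fun x => @?f x + @?g x) =>
      apply: (@continuous_funD _ _ f g); cont
  | |- continuous (fun x => - @?f x) => apply: (@continuous_funN _ _ f); cont
  | |- continuous (fun x => @?f x * @?g x) =>
      apply: (@continuous_funM _ _ f g); cont
  | |- continuous (fun x => expR (@?g x)) =>
      apply: (@continuous_expR_comp _ _ g); cont
  | |- continuous (fun x => x) =>
      by move=> ?; exact: cvg_id
  | |- continuous (fun x => (@?f x).1) => apply: (@continuous_fst_comp _ _ _ f); cont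
  | |- continuous (fun x => (@?f x).2) => apply: (@continuous_snd_comp _ _ _ f); cont
  | |- continuous (fun x => ?h (@?f x)) =>
      first [exact: continuous_funcst | done |
             apply: (@continuous_compT _ _ _ f h); [cont | try done]]
  | |- continuous (fun x => ?c) =>
      first [exact: continuous_funcst | done | idtac]
  | |- _ => try done
  end.

Section WithinContinuityRules.
Context (R : realType) (A : set R).
Implicit Types (f g : R -> R).

Lemma within_funD f g : {within A, continuous f} -> {within A, continuous g} ->
  {within A, continuous (fun x => f x + g x)}.
Proof. exact: continuous_funD. Qed.

Lemma within_funN f : {within A, continuous f} ->
  {within A, continuous (fun x => - f x)}.
Proof. exact: continuous_funN. Qed.

Lemma within_funM f g : {within A, continuous f} -> {within A, continuous g} ->
  {within A, continuous (fun x => f x * g x)}.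
Proof. exact: continuous_funM. Qed.

Lemma within_funcst (c : R) : {within A, continuous (fun _ : R => c)}.
Proof. exact: continuous_funcst. Qed.

Lemma within_funid : {within A, continuous (fun x : R => x)}.
Proof. by apply: continuous_subspaceT => x; exact: cvg_id. Qed.

Lemma within_expR_comp f : {within A, continuous f} ->
  {within A, continuous (fun x => expR (f x))}.
Proof. exact: continuous_expR_comp. Qed.

End WithinContinuityRules.

Ltac wcont :=
  lazymatch goal with
  | |- continuous (from_subspace ?A (fun x => @?f x + @?g x)) =>
      apply: (@within_funD _ A f g); wcont
  | |- continuous (from_subspace ?A (fun x => - @?f x)) =>
      apply: (@within_funN _ A f); wcont
  | |- continuous (from_subspace ?A (fun x => @?f x * @?g x)) =>
      apply: (@within_funM _ A f g); wcont
  | |- continuous (from_subspace ?A (fun x => expR (@?f x))) =>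
      apply: (@within_expR_comp _ A f); wcont
  | |- continuous (from_subspace ?A (fun x => x)) => exact: within_funid
  | |- continuous (from_subspace ?A (fun x => ?c)) =>
      first [exact: within_funcst | done | idtac]
  | |- _ => try done
  end.

(** * Power functions, power weights and integration by parts *)

Section PowerFunctions.
Context (R : realType).

Lemma powR_continuous_gt0 (s x : R) : 0 < x -> {for x, continuous (fun y : R => y `^ s)}.
Proof.
move=> x0; apply: differentiable_continuous.
by apply/derivable1_diffP; apply: derivable_powR; rewrite in_itv/= x0.
Qed.

(** At negative bases [powR] has a default value, which does not tend to 0 at the origin. The
    truncation is continuous on the whole line and agrees with the power where the base is
    non-negative. *)
Lemma continuous_maxr0_powR (k : R) : 0 < k ->
  continuous (fun x : R => Num.max x 0 `^ k).
Proof.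
move=> k0 x; have [x0|x0|->] := ltgtP x 0.
- have h : (fun y : R => 0 : R) y @[y --> x] --> Num.max x 0 `^ k.
    rewrite (max_idPr (ltW x0)) powR0 ?gt_eqF//; exact: cvg_cst.
  apply: cvg_trans h; apply: near_eq_cvg; near=> y.
  rewrite (max_idPr _) ?powR0 ?gt_eqF//; apply/ltW.
  by near: y; exact: lt_nbhsl.
- have h : (fun y : R => y `^ k) y @[y --> x] --> Num.max x 0 `^ k.
    by rewrite (max_idPl (ltW x0)); exact: powR_continuous_gt0.
  apply: cvg_trans h; apply: near_eq_cvg; near=> y.
  rewrite (max_idPl _)//; apply/ltW; near: y; exact: lt_nbhsr.
- rewrite /continuous_at maxxx powR0 ?gt_eqF//.
  apply/(@cvgrPdist_le _ R^o) => e e0; near=> y.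
  rewrite sub0r normrN ger0_norm ?powR_ge0//.
  have -> : e = (e `^ k^-1) `^ k by rewrite -powRrM mulVf ?gt_eqF// powRr1// ltW.
  apply: ge0_ler_powR; rewrite ?nnegrE ?powR_ge0 ?(ltW k0)//.
    by rewrite le_max lexx orbT.
  rewrite ge_max powR_ge0 andbT; apply/ltW.
  by near: y; apply: lt_nbhsl; rewrite powR_gt0.
Unshelve. all: by end_near. Qed.

Lemma within_continuous_powR (a b k : R) (f : R -> R) : 0 < k ->
  {within `[a, b], continuous f} -> (forall x : R, x \in `[a, b] -> 0 <= f x) ->
  {within `[a, b], continuous (fun x : R => f x `^ k)}.
Proof.
move=> k0 cf f0.
apply: (@subspace_eq_continuous _ _ _ (fun x : R => Num.max (f x) 0 `^ k)).
  by move=> x /set_mem xab; rewrite (max_idPl _)// f0.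
move=> x; apply: (cvg_comp f (fun y : R => Num.max y 0 `^ k) (cf x)).
exact: continuous_maxr0_powR.
Qed.

Lemma within_continuous_powR_gt0 (a b s : R) (f : R -> R) :
  {within `[a, b], continuous f} -> (forall x : R, x \in `[a, b] -> 0 < f x) ->
  {within `[a, b], continuous (fun x : R => f x `^ s)}.
Proof.
move=> cf f0; apply/subspace_continuousP => x xab.
apply: (cvg_comp f (fun y : R => y `^ s)); last first.
  by apply: powR_continuous_gt0; exact: f0.
by move/subspace_continuousP: cf; exact.
Qed.

(** A power is monotone, in a direction that depends on the sign of the exponent. The sum of the two
    end values is a bound that holds in both cases. *)
Lemma powR_le_segment (s u v y : R) : 0 < u -> u <= y <= v ->
  y `^ s <= u `^ s + v `^ s.
Proof.
move=> u0 /andP[uy yv]; have y0 : 0 < y by exact: lt_le_trans uy.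
have v0 : 0 < v by exact: lt_le_trans yv.
have [s0|s0] := leP 0 s.
  rewrite ler_wpDl ?powR_ge0//.
  by apply: ge0_ler_powR => //; rewrite nnegrE ltW.
rewrite ler_wpDr ?powR_ge0//.
rewrite -[s]opprK !(powRN _ (- s)) lef_pV2 ?posrE ?powR_gt0//.
by apply: ge0_ler_powR => //; rewrite ?nnegrE ?oppr_ge0 ltW.
Qed.

Lemma integrable_powRl (a b p : R) : a < b -> 0 < p ->
  leb.-integrable `[a, b] (EFin \o (fun x : R => (x - a) `^ (p - 1))).
Proof.
move=> ab p0.
have cs : continuous (fun x : R => x - a).
  by cont.
apply: (@integrable_ge0_derive R a b (fun x : R => p^-1 * (x - a) `^ p)
  (fun x : R => (x - a) `^ (p - 1)) ab).
- apply: within_funM; first exact: within_funcst.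
  apply: within_continuous_powR => //; first exact: continuous_subspaceT.
  by move=> y; rewrite in_itv/= => /andP[]; rewrite subr_ge0.
- move=> x; rewrite in_itv/= => /andP[ax _].
  notypeclasses refine (is_derive_eqr _ _); first by deriv; rewrite subr_gt0.
  by rewrite /=; field; rewrite gt_eqF.
- move=> x; rewrite in_itv/= => /andP[ax _].
  apply: (cvg_comp (fun x : R => x - a) (fun y : R => y `^ (p - 1)) (cs x)).
  by apply: powR_continuous_gt0; rewrite subr_gt0.
by move=> x _; exact: powR_ge0.
Qed.

Lemma integrable_powRr (a b p : R) : a < b -> 0 < p ->
  leb.-integrable `[a, b] (EFin \o (fun x : R => (b - x) `^ (p - 1))).
Proof.
move=> ab p0.
have cs : continuous (fun x : R => b - x).
  by cont.
apply: (@integrable_ge0_derive R a b (fun x : R => - p^-1 * (b - x) `^ p)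
  (fun x : R => (b - x) `^ (p - 1)) ab).
- apply: within_funM; first exact: within_funcst.
  apply: within_continuous_powR => //; first exact: continuous_subspaceT.
  by move=> y; rewrite in_itv/= => /andP[_]; rewrite subr_ge0.
- move=> x; rewrite in_itv/= => /andP[_ xb].
  notypeclasses refine (is_derive_eqr _ _); first by deriv; rewrite subr_gt0.
  by rewrite /=; field; rewrite gt_eqF.
- move=> x; rewrite in_itv/= => /andP[_ xb].
  apply: (cvg_comp (fun x : R => b - x) (fun y : R => y `^ (p - 1)) (cs x)).
  by apply: powR_continuous_gt0; rewrite subr_gt0.
by move=> x _; exact: powR_ge0.
Qed.

(** On each half of the segment one of the factors stays away from its singularity and is bounded by
    a value of [M]. So the product lies below a sum of two one-sided power weights. *)
Lemma integrable_beta_weight (a b p q : R) : a < b -> 0 < p -> 0 < q ->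
  leb.-integrable `[a, b]
    (EFin \o (fun x : R => (x - a) `^ (p - 1) * (b - x) `^ (q - 1))).
Proof.
move=> ab p0 q0; pose c := (b - a) / 2.
have c0 : 0 < c by rewrite divr_gt0 // subr_gt0.
pose M s := c `^ s + (b - a) `^ s.
have M0 s : 0 <= M s by rewrite addr_ge0 ?powR_ge0.
have ip := integrable_powRl ab p0.
have iq := integrable_powRr ab q0.
have ip' : leb.-integrable `[a, b]
    (EFin \o (fun x : R => M (q - 1) * (x - a) `^ (p - 1))).
  by apply: (integrable_continuousM (f := fun _ : R => M (q - 1)) ip) => ?; exact: cvg_cst.
have iq' : leb.-integrable `[a, b]
    (EFin \o (fun x : R => M (p - 1) * (b - x) `^ (q - 1))).
  by apply: (integrable_continuousM (f := fun _ : R => M (p - 1)) iq) => ?; exact: cvg_cst.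
have := @integrableD _ _ _ leb _ (measurable_itv `[a, b]) _ _ ip' iq'.
apply: le_integrable => //.
  have /integrableP[m1 _] := ip; have /integrableP[m2 _] := iq.
  apply/measurable_EFinP; apply: measurable_funM; exact/measurable_EFinP.
move=> x; rewrite /= in_itv/= => /andP[ax xb].
rewrite lee_fin ger0_norm ?mulr_ge0 ?powR_ge0//.
apply: le_trans (ler_norm _).
have [xc|cx] := leP x (a + c).
  rewrite ler_wpDr ?mulr_ge0 ?powR_ge0// mulrC ler_wpM2r ?powR_ge0//.
  by apply: powR_le_segment => //; move: xc; rewrite /c; lra.
rewrite ler_wpDl ?mulr_ge0 ?powR_ge0// ler_wpM2r ?powR_ge0//.
by apply: powR_le_segment => //; move: cx; rewrite /c; lra.
Qed.

(** The integrand with its weight is the derivative of [phi^k * g], and [phi^k] vanishes at both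
    ends because [k > 0]. The recurrence for the moments, the Bessel equation and the equations for
    the double integrals all come from this identity. *)
Lemma wint_ibp (a b k : R) (phi dphi g dg : R -> R) :
  a < b -> 0 < k -> phi a = 0 -> phi b = 0 ->
  (forall x : R, x \in `]a, b[ -> 0 < phi x) ->
  {within `[a, b], continuous phi} -> {within `[a, b], continuous dphi} ->
  {within `[a, b], continuous g} -> {within `[a, b], continuous dg} ->
  (forall x : R, x \in `]a, b[ -> is_derive x (1 : R) phi (dphi x)) ->
  (forall x : R, x \in `]a, b[ -> is_derive x (1 : R) g (dg x)) ->
  leb.-integrable `[a, b] (EFin \o (fun x : R => phi x `^ (k - 1))) ->
  wint a b (fun x : R => phi x `^ (k - 1))
    (fun x : R => k * dphi x * g x + phi x * dg x) = 0.
Proof.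
move=> ab k0 phia phib phi0 cphi cdphi cg cdg dphiP dgP iphi.
have phi0' x : x \in `[a, b] -> 0 <= phi x.
  rewrite in_itv/= => /andP[]; rewrite le_eqVlt => /predU1P[<-|ax]; first by rewrite phia.
  rewrite le_eqVlt => /predU1P[->|xb]; first by rewrite phib.
  by apply/ltW/phi0; rewrite in_itv/= ax.
have cpk : {within `[a, b], continuous (fun x : R => phi x `^ k)}.
  exact: within_continuous_powR.
have H1 : {within `[a, b], continuous (fun x : R => phi x `^ k * g x)}.
  exact: continuous_funM.
pose f (x : R) := (k * dphi x * g x + phi x * dg x) * phi x `^ (k - 1).
have H2 (x : R) : x \in `]a, b[ ->
    is_derive x (1 : R) (fun x : R => phi x `^ k * g x) (f x).
  move=> xab; have px := phi0 _ xab.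
  have ? := dgP x xab; have ? := dphiP x xab.
  notypeclasses refine (is_derive_eqr _ _).
    notypeclasses refine (@is_derive_funM _ (fun x => phi x `^ k) g _ _ _ _ _).
      by notypeclasses refine (@is_derive_powR_comp _ phi k _ _ _ _); last eassumption.
    by eassumption.
  by rewrite /f -(mulr_powRB1 (ltW px) k0); ring.
have H3 : {in `]a, b[, continuous f}.
  have oo (h : R -> R) : {within `[a, b], continuous h} -> {in `]a, b[, continuous h}.
    by move=> /(continuous_within_itvP _ ab)[].
  have c1 : {within `[a, b], continuous (fun x : R => k * dphi x * g x + phi x * dg x)}.
    by wcont.
  move=> x xab; have c2 : {for x, continuous (fun x : R => phi x `^ (k - 1))}.
    apply: (cvg_comp phi (fun y : R => y `^ (k - 1)) (oo _ cphi x xab)).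
    by apply: powR_continuous_gt0; exact: phi0.
  exact: (cvgM (oo _ c1 x xab) c2).
have H4 : leb.-integrable `[a, b] (EFin \o f).
  apply: (integrable_continuousM (f := fun x : R => k * dphi x * g x + phi x * dg x) iphi).
  by wcont.
rewrite wint.unlock; transitivity (phi b `^ k * g b - phi a `^ k * g a).
  exact: (Rintegral_derive ab H1 H2 H3 H4).
by rewrite phia phib powR0 ?gt_eqF// !mul0r subrr.
Qed.

End PowerFunctions.

(** * Affine substitution, Gamma and Beta *)

Section ScaledPushforward.
Context d1 d2 (T1 : measurableType d1) (T2 : measurableType d2) (R : realType).
Variables (phi : T1 -> T2) (mphi : measurable_fun setT phi).
Variables (mu : {measure set T1 -> \bar R}) (nu : {measure set T2 -> \bar R}).
Variable c : {nonneg R}.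

Lemma ge0_integral_scaled_pushforward (D : set T2) (f : T2 -> \bar R) :
  (forall A, measurable A -> nu A = c%:num%:E * mu (phi @^-1` A))%E ->
  measurable D -> measurable_fun D f -> (forall x, D x -> 0 <= f x)%E ->
  (\int[nu]_(x in D) f x = c%:num%:E * \int[mu]_(x in phi @^-1` D) f (phi x))%E.
Proof.
move=> nuE mD mf f0.
pose pm := measure_function_pushforward__canonical__measure_function_Measure mu mphi.
transitivity (\int[mscale c pm]_(x in D) f x)%E.
  by apply: eq_measure_integral => A mA _; exact: nuE.
rewrite ge0_integral_mscale//; congr (_ * _)%E.
apply: ge0_integral_pushforward => //.
by move=> y /set_mem; exact: f0.
Qed.

End ScaledPushforward.

Section AffineSubstitution.
Context (R : realType).

Lemma preimage_affine_itv (c d : R) (bl br : bool) (x y : R) : 0 < c ->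
  (fun t : R => c * t + d) @^-1` [set` Interval (BSide bl (c * x + d)) (BSide br (c * y + d))] =
  [set` Interval (BSide bl x) (BSide br y)].
Proof.
move=> c0; apply/seteqP; split=> t /=; rewrite !in_itv/=;
  by case: bl br => [] [] /=; rewrite ?(lerD2r, ltrD2r, ler_pM2l c0, ltr_pM2l c0).
Qed.

Lemma preimage_affine_itvN (c d : R) (bl br : bool) (x y : R) : c < 0 ->
  (fun t : R => c * t + d) @^-1` [set` Interval (BSide bl (c * y + d)) (BSide br (c * x + d))] =
  [set` Interval (BSide (~~ br) x) (BSide (~~ bl) y)].
Proof.
move=> c0; apply/seteqP; split=> t /=; rewrite !in_itv/= => /andP[h1 h2];
  apply/andP; split; move: h1 h2;
  by case: bl br => [] [] /=; rewrite ?(lerD2r, ltrD2r, ler_nM2l c0, ltr_nM2l c0).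
Qed.

Lemma measurable_affine (c d : R) :
  measurable_fun setT ((fun t : R => c * t + d) : measurableTypeR R -> measurableTypeR R).
Proof.
by apply: measurable_funD => //; apply: measurable_funM.
Qed.

(** The image of Lebesgue measure under the affine map, multiplied by [|c|], gives every interval
    its length; uniqueness of Lebesgue measure does the rest. *)
Lemma ge0_integral_affine (c d : R) (D : set R) (f : R -> \bar R) : c != 0 ->
  measurable D -> measurable_fun D f -> (forall x, D x -> 0 <= f x)%E ->
  (\int[leb]_(x in D) f x =
   `|c|%:E * \int[leb]_(x in (fun t : R => c * t + d)%R @^-1` D) f (c * x + d)%R)%E.
Proof.
move=> c0 mD mf f0; pose cn : {nonneg R} := NngNum (normr_ge0 c).
apply: (@ge0_integral_scaled_pushforward _ _ _ (measurableTypeR R) _ _ _ _ _ cn) => //.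
  exact: measurable_affine.
move=> A mA; pose pm := measure_function_pushforward__canonical__measure_function_Measure leb
  (@measurable_affine c d).
have -> : (cn%:num%:E * leb ((fun t : R => c * t + d)%R @^-1` A) = mscale cn pm A)%E by [].
apply: (@lebesgue_measure_unique R (mscale cn pm)) => //.
move=> X [[x y] _ <-] /=.
rewrite /pm /mscale/= /pushforward.
pose x' := (x - d) / c; pose y' := (y - d) / c.
have xE : x = c * x' + d by rewrite /x' mulrCA mulfV// mulr1 subrK.
have yE : y = c * y' + d by rewrite /y' mulrCA mulfV// mulr1 subrK.
rewrite xE yE; move: c0; rewrite neq_lt => /orP[c0|c0].
  rewrite (@preimage_affine_itvN c d false false)// !lebesgue_measure_itv/=.
  rewrite !lte_fin ltrD2r ltr_nM2l//; case: ifPn => _; last by rewrite mule0.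
  by rewrite ltr0_norm// -!EFinD -EFinM; congr EFin; ring.
rewrite (@preimage_affine_itv c d false false)// !lebesgue_measure_itv/=.
rewrite !lte_fin ltrD2r ltr_pM2l//; case: ifPn => _; last by rewrite mule0.
by rewrite gtr0_norm// -!EFinD -EFinM; congr EFin; ring.
Qed.

(** This covers an infinite [I] too, since [fine] sends [+oo] to 0. Hence the substitutions below
    hold for all non-negative measurable functions. *)
Let fineM_ge0 (c : R) (I : \bar R) : 0 < c -> (0 <= I)%E -> fine (c%:E * I) = c * fine I.
Proof.
move=> c0; case: I => [r _|_|h].
- by [].
- by rewrite mulr_infty gtr0_sg// mul1e /= mulr0.
- by rewrite leNgt ltNy0 in h.
Qed.

Lemma Rintegral_affine (c d a b : R) (f : R -> R) : 0 < c ->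
  measurable_fun `[c * a + d, c * b + d] f ->
  (forall x : R, x \in `[c * a + d, c * b + d] -> 0 <= f x) ->
  \int[leb]_(x in `[c * a + d, c * b + d]) f x =
  c * \int[leb]_(x in `[a, b]) f (c * x + d).
Proof.
move=> c0 mf f0; rewrite /Rintegral.
rewrite (@ge0_integral_affine c d) ?gt_eqF//; last exact/measurable_EFinP.
rewrite (@preimage_affine_itv c d true false)// gtr0_norm//.
rewrite fineM_ge0//; apply: integral_ge0 => x xab; rewrite lee_fin f0// in_itv/=.
by move: xab; rewrite /= in_itv/= !lerD2r !ler_pM2l.
Qed.

Lemma Rintegral_affineN (c d a b : R) (f : R -> R) : c < 0 ->
  measurable_fun `[c * b + d, c * a + d] f ->
  (forall x : R, x \in `[c * b + d, c * a + d] -> 0 <= f x) ->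
  \int[leb]_(x in `[c * b + d, c * a + d]) f x =
  - c * \int[leb]_(x in `[a, b]) f (c * x + d).
Proof.
move=> c0 mf f0; rewrite /Rintegral.
rewrite (@ge0_integral_affine c d) ?lt_eqF//; last exact/measurable_EFinP.
rewrite (@preimage_affine_itvN c d true false)// ltr0_norm//.
rewrite fineM_ge0 ?oppr_gt0//; apply: integral_ge0 => x xab; rewrite lee_fin f0// in_itv/=.
by move: xab; rewrite /= in_itv/= !lerD2r !ler_nM2l// andbC.
Qed.

End AffineSubstitution.

HB.lock Definition Beta (R : realType) (a b : R) : R :=
  \int[leb]_(u in `[0, 1]) (u `^ (a - 1) * (1 - u) `^ (b - 1)).

Section GammaBeta.
Context (R : realType).
Implicit Types (a b r s t : R).

Lemma ge0_integral_scale (D : set R) (c : R) (f : R -> R) :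
  0 <= c -> measurable D -> measurable_fun D f -> (forall x, D x -> 0 <= f x) ->
  (\int[leb]_(x in D) (c * f x)%:E = c%:E * \int[leb]_(x in D) (f x)%:E)%E.
Proof.
move=> c0 mD mf f0; under eq_integral do rewrite EFinM.
by apply: ge0_integralZl => //; apply/measurable_EFinP.
Qed.

(** Extension by zero to the whole line makes a product of Gamma integrals the integral of a
    convolution, without moving limits. *)
Definition gamma_density a t : R := \1_(`]0, +oo[%classic : set R) t * (t `^ (a - 1) * expR (- t)).

Lemma gamma_density_ge0 a t : 0 <= gamma_density a t.
Proof.
by rewrite /gamma_density mulr_ge0 ?mulr_ge0 ?powR_ge0 ?expR_ge0// indicE.
Qed.

Lemma gamma_density_gt0E a t : 0 < t ->
  gamma_density a t = t `^ (a - 1) * expR (- t).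
Proof.
by move=> t0; rewrite /gamma_density indicE mem_set ?mul1r//= in_itv/= t0.
Qed.

Lemma gamma_density_le0E a t : t <= 0 -> gamma_density a t = 0.
Proof.
move=> t0; rewrite /gamma_density indicE memNset ?mul0r//=.
by rewrite in_itv/= ltNge t0.
Qed.

Lemma measurable_gamma_density a : measurable_fun setT (gamma_density a).
Proof.
apply: measurable_funM; first exact: measurable_indic.
apply: measurable_funM; first exact: measurable_powR.
by apply: measurableT_comp => //; exact: measurable_funN.
Qed.

Lemma integral_gamma_density a :
  (\int[leb]_t (gamma_density a t)%:E =
   \int[leb]_(t in `]0%R, +oo[) (t `^ (a - 1) * expR (- t))%:E)%E.
Proof.
rewrite [RHS]integral_mkcond; apply: eq_integral => t _ /=.
rewrite patchE; have [t0|t0] := ltP 0 t.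
  by rewrite mem_set ?gamma_density_gt0E//= in_itv/= t0.
by rewrite memNset ?gamma_density_le0E//= in_itv/= ltNge t0.
Qed.

Lemma GammaE a : Gamma a = fine (\int[leb]_t (gamma_density a t)%:E)%E.
Proof. by rewrite integral_gamma_density. Qed.

(** For [r > 0] both factors are nonzero only for [0 < s < r]. There the exponentials combine to
    [expR (- r)], and [s = r u] extracts the power of [r]: exponent [a + b - 2] from the integrand
    and 1 from the Jacobian. *)
Lemma gamma_density_convolution a b r :
  (\int[leb]_s (gamma_density a s * gamma_density b (r - s))%:E =
   (gamma_density (a + b) r)%:E *
     \int[leb]_(u in `]0%R, 1%R[) (u `^ (a - 1) * (1 - u) `^ (b - 1))%:E)%E.
Proof.
have [r0|r0] := leP r 0.
  rewrite gamma_density_le0E// mul0e integral0_eq// => s _.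
  have [s0|s0] := leP s 0; first by rewrite gamma_density_le0E// mul0r.
  rewrite [X in _ * X]gamma_density_le0E ?mulr0//.
  by rewrite subr_le0 (le_trans r0)// ltW.
pose F s : R := s `^ (a - 1) * (r - s) `^ (b - 1).
have mF c d : measurable_fun setT (fun u : R => u `^ (a - 1) * (c - u) `^ d).
  apply: measurable_funM; first exact: measurable_powR.
  apply: (measurableT_comp (measurable_powR d)).
  by apply: measurable_funB.
transitivity (\int[leb]_(s in `]0%R, r[) (expR (- r) * F s)%:E)%E.
  rewrite [RHS]integral_mkcond; apply: eq_integral => s _ /=.
  rewrite patchE; have [s0|s0] := leP s 0.
    rewrite gamma_density_le0E// mul0r memNset//= in_itv/=.
    by rewrite ltNge s0.
  have [rs|sr] := leP r s.
    rewrite [X in _ * X]gamma_density_le0E ?subr_le0// mulr0 memNset//= in_itv/=.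
    by rewrite [s < r]ltNge rs andbF.
  rewrite mem_set/= ?in_itv/= ?s0//; congr EFin.
  rewrite !gamma_density_gt0E ?subr_gt0// /F.
  have -> : - r = - s + - (r - s) by ring.
  by rewrite expRD; ring.
have F0 s : 0 <= F s by rewrite mulr_ge0 ?powR_ge0.
have mF' D : measurable D -> measurable_fun D F.
  by move=> mD; apply: measurable_funS (mF r (b - 1)).
have -> := ge0_integral_scale (expR_ge0 (- r)) (measurable_itv `]0, r[)
  (mF' _ (measurable_itv _)) (fun s _ => F0 s).
rewrite (@ge0_integral_affine R r 0 `]0, r[) ?(gt_eqF r0)//; last 2 first.
- by apply/measurable_EFinP; apply: measurable_funS (mF r (b - 1)).
- by move=> s _; rewrite lee_fin mulr_ge0 ?powR_ge0.
have := @preimage_affine_itv R r 0 false true 0 1 r0.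
rewrite mulr0 mulr1 !addr0 => ->; rewrite gtr0_norm//.
transitivity (((expR (- r) * r)%:E * \int[leb]_(u in `]0%R, 1%R[)
  (r `^ (a + b - 2) * (u `^ (a - 1) * (1 - u) `^ (b - 1)))%:E)%E).
  rewrite muleA -EFinM; congr (_ * _)%E; apply: eq_integral => u /set_mem /=.
  rewrite in_itv/= => /andP[u0 u1]; congr EFin.
  rewrite /F addr0; have -> : r - r * u = r * (1 - u) by ring.
  rewrite !powRM ?(ltW r0) ?(ltW u0) ?subr_ge0 ?(ltW u1)//.
  have -> : a + b - 2 = (a - 1) + (b - 1) by ring.
  by rewrite (@powRD _ r (a - 1)) ?(gt_eqF r0) ?implybT//; ring.
have F1 u : 0 <= u `^ (a - 1) * (1 - u) `^ (b - 1) by rewrite mulr_ge0 ?powR_ge0.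
have mF1 D : measurable D -> measurable_fun D (fun u : R => u `^ (a - 1) * (1 - u) `^ (b - 1)).
  by move=> mD; apply: measurable_funS (mF 1 (b - 1)).
have -> := ge0_integral_scale (powR_ge0 r (a + b - 2)) (measurable_itv `]0, 1[)
  (mF1 _ (measurable_itv _)) (fun u _ => F1 u).
rewrite muleA -EFinM gamma_density_gt0E//; congr (_%:E * _)%E.
have -> : a + b - 1 = (a + b - 2) + 1 by ring.
by rewrite (@powRD _ r (a + b - 2)) ?(gt_eqF r0) ?implybT// powRr1 ?ltW//; ring.
Qed.

(** Translation invariance and Tonelli's theorem turn the product into the integral of the
    convolution. The identity lives in the extended reals, so it comes before any finiteness
    statement. *)
Lemma gamma_density_mul a b :
  (\int[leb]_t (gamma_density a t)%:E * \int[leb]_t (gamma_density b t)%:E =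
   \int[leb]_t (gamma_density (a + b) t)%:E *
     \int[leb]_(u in `]0%R, 1%R[) (u `^ (a - 1) * (1 - u) `^ (b - 1))%:E)%E.
Proof.
have mg c : measurable_fun setT (fun t => (gamma_density c t)%:E).
  by apply/measurable_EFinP; exact: measurable_gamma_density.
have g0 c t : (0 <= (gamma_density c t)%:E)%E by rewrite lee_fin gamma_density_ge0.
transitivity (\int[leb]_s \int[leb]_r
    (gamma_density a s * gamma_density b (r - s))%:E)%E.
  have I0 : (0 <= \int[leb]_t (gamma_density b t)%:E)%E by exact: integral_ge0.
  have <- := ge0_integralZr leb measurableT (mg a) (fun t _ => g0 a t) I0.
  apply: eq_integral => s _.
  have mgs : measurable_fun setT (fun r => gamma_density b (r - s)).
    apply: (measurableT_comp (@measurable_gamma_density b)).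
    exact: measurable_funB.
  have -> := ge0_integral_scale (gamma_density_ge0 a s) measurableT mgs
    (fun r _ => gamma_density_ge0 b (r - s)).
  have -> := @ge0_integral_affine R 1 s setT (fun r => (gamma_density b (r - s))%:E)
    (oner_neq0 R) measurableT (measurableT_comp (@EFin_measurable R setT) mgs)
    (fun r _ => g0 b (r - s)).
  rewrite normr1 mul1e preimage_setT; congr (_ * _)%E; apply: eq_integral => t _.
  by rewrite mul1r addrK.
pose f (z : measurableTypeR R * measurableTypeR R) :=
  (gamma_density a z.1 * gamma_density b (z.2 - z.1))%:E.
have mf : measurable_fun setT f.
  apply/measurable_EFinP; apply: measurable_funM.
    by apply: (measurableT_comp (@measurable_gamma_density a)).
  apply: (measurableT_comp (@measurable_gamma_density b)).
  exact: measurable_funB.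
have f0 z : (0 <= f z)%E by rewrite /f lee_fin mulr_ge0 ?gamma_density_ge0.
transitivity (\int[leb]_r \int[leb]_s
    (gamma_density a s * gamma_density b (r - s))%:E)%E.
  exact: (@fubini_tonelli _ _ _ _ R leb leb f mf f0).
have I0 : (0 <= \int[leb]_(u in `]0%R, 1%R[) (u `^ (a - 1) * (1 - u) `^ (b - 1))%:E)%E.
  by apply: integral_ge0 => u _; rewrite lee_fin mulr_ge0 ?powR_ge0.
have <- := ge0_integralZr leb measurableT (mg (a + b)) (fun t _ => g0 (a + b) t) I0.
by apply: eq_integral => r _; rewrite /f/= gamma_density_convolution.
Qed.

(** This is [ln x <= x] at [x = t / n], where [n] is chosen so that [|s| / n <= 1 / 2]. *)
Lemma powR_le_expR_half s : exists M : R, 0 < M /\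
  forall t, 1 <= t -> t `^ s <= M * expR (t / 2).
Proof.
pose n := 2 * (`|s| + 1); have n0 : 0 < n by rewrite mulr_gt0// ltr_wpDl.
exists (expR (`|s| * ln n)); split; first exact: expR_gt0.
move=> t t1; have t0 : 0 < t by rewrite (lt_le_trans _ t1).
rewrite /powR gt_eqF// -expRD ler_expR.
have lt0 : 0 <= ln t by rewrite ln_ge0.
have : ln (t / n) <= t / n by rewrite ltW// ln_sublinear// divr_gt0.
rewrite ln_div ?posrE// => h.
apply: (@le_trans _ _ (`|s| * ln t)); first by rewrite ler_wpM2r// ler_norm.
apply: (@le_trans _ _ (`|s| * (ln n + t / n))).
  by rewrite ler_wpM2l// -lerBlDl.
rewrite mulrDr lerD2l mulrA ler_pdivrMr//.
have -> : t / 2 * n = (`|s| + 1) * t by rewrite /n; field.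
by rewrite ler_wpM2r ?(ltW t0)// lerDl.
Qed.

Lemma integral_gamma_density_lty a : 0 < a ->
  (\int[leb]_t (gamma_density a t)%:E < +oo)%E.
Proof.
move=> a0; have [M [M0 HM]] := powR_le_expR_half (a - 1).
pose f t := t `^ (a - 1) * expR (- t).
have mf (i : interval R) : measurable_fun [set` i] (fun t : R => (t `^ (a - 1) * expR (- t))%:E).
  apply/measurable_EFinP; apply: measurable_funS (measurableT) _ _ => //.
  apply: measurable_funM; first exact: measurable_powR.
  by apply: measurableT_comp => //; exact: measurable_funN.
have f0 t : (0 <= (f t)%:E)%E by rewrite lee_fin mulr_ge0 ?powR_ge0 ?expR_ge0.
rewrite integral_gamma_density.
have -> : (`]0%R, +oo[%classic : set R) = `]0%R, 1%R[ `|` `[1%R, +oo[.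
  by rewrite -itv_bndbnd_setU// bnd_simp.
rewrite ge0_integral_setU => //; last 3 first.
- by rewrite -itv_bndbnd_setU ?bnd_simp//; exact: mf.
- by move=> t _; exact: f0.
- apply/disj_set2P/seteqP; split => // t [] /=; rewrite !in_itv/= => /andP[_ t1].
  by rewrite andbT leNgt t1.
apply: lte_add_pinfty.
  have h := integrable_powRl (@ltr01 R) a0.
  have e : (fun x : R => (x - 0) `^ (a - 1)) = @powR R ^~ (a - 1).
    by apply/funext => x; rewrite subr0.
  rewrite e in h.
  have : leb.-integrable `]0, 1[ (EFin \o (@powR R ^~ (a - 1))).
    by apply: integrableS h => //; exact: subset_itv_oo_cc.
  move=> /integrableP[_]; apply: le_lt_trans.
  apply: ge0_le_integral; [exact: measurable_itv|by move=> t _; exact: f0|exact: mf| |].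
    apply/measurable_EFinP; apply: measurable_funS measurableT _ _ => //.
    by apply: measurableT_comp => //; exact: measurable_powR.
  move=> t; rewrite /= in_itv/= => /andP[t0 _].
  rewrite lee_fin ger0_norm ?powR_ge0// ger_pMr ?powR_gt0//.
  by rewrite -expR0 ler_expR oppr_le0 ltW.
pose g (t : R) := M * expR (- (t / 2)).
have cg : continuous g by rewrite /g; cont.
have mg : measurable_fun (`[1%R, +oo[%classic : set R) (fun t : R => (g t)%:E).
  apply/measurable_EFinP; apply: measurable_funS measurableT _ _ => //.
  exact: continuous_measurable_fun.
apply: (@le_lt_trans _ _ (\int[leb]_(t in `[1%R, +oo[) (g t)%:E)%E).
  apply: ge0_le_integral; [exact: measurable_itv|by move=> t _; exact: f0|exact: mf|exact: mg|].
  move=> t; rewrite /= in_itv/= andbT => t1.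
  rewrite lee_fin /f /g.
  have -> : - t = - (t / 2) + - (t / 2) by field.
  rewrite expRD mulrA ler_wpM2r ?expR_ge0//.
  rewrite expRN ler_pdivrMr ?expR_gt0//; exact: HM.
have dG (x : R) : is_derive x (1 : R) (fun t : R => - (2 * M) * expR (- (t / 2))) (g x).
  notypeclasses refine (is_derive_eqr _ _); first by deriv.
  by rewrite /= /g; field.
pose G (t : R) : R := - (2 * M) * expR (- (t / 2)).
have cG : continuous G by rewrite /G; cont.
have h1 (x : R) : 1 <= x -> 0 <= g x by rewrite mulr_ge0 ?expR_ge0// ltW.
have h2 : {within `[1, +oo[, continuous g} by exact: continuous_subspaceT.
have h3 : G x @[x --> +oo] --> 0.
  rewrite -[X in _ --> X](mulr0 (- (2 * M))); apply: cvgMr.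
  apply: (cvg_comp (fun t : R => t / 2) (fun t => expR (- t)) _ (@cvgr_expR R)).
  by apply: gt0_cvgMly.
have h4 (x : R) : 1 < x -> derivable G x 1 by case: (dG x).
have h5 : G x @[x --> 1^'+] --> G 1 by apply: cvg_at_right_filter; exact: cG.
have h6 : {in `]1, +oo[, derive1 G =1 g}.
  by move=> x _; rewrite derive1E; case: (dG x).
by have -> := ge0_continuous_FTC2y h1 h2 h3 h4 h5 h6; rewrite -EFinB ltry.
Qed.

Lemma integral_gamma_density_fin a : 0 < a ->
  (\int[leb]_t (gamma_density a t)%:E \is a fin_num)%E.
Proof.
move=> a0; rewrite ge0_fin_numE ?integral_gamma_density_lty//.
by apply: integral_ge0 => t _; rewrite lee_fin gamma_density_ge0.
Qed.

Lemma Gamma_gt0 a : 0 < a -> 0 < Gamma a.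
Proof.
move=> a0; rewrite GammaE.
have mg : measurable_fun setT (fun t => (gamma_density a t)%:E).
  by apply/measurable_EFinP; exact: measurable_gamma_density.
have g0 t : (0 <= (gamma_density a t)%:E)%E by rewrite lee_fin gamma_density_ge0.
apply: fine_gt0; rewrite integral_gamma_density_lty// andbT.
(* A lower bound of the density on [[1, 2]]: the power is bounded through [powR_le_segment] with
   exponent [1 - a], the exponential by its value at 2. *)
pose c := (1 + 2 `^ (1 - a))^-1 * expR (- 2).
have d0 : 0 < 1 + 2 `^ (1 - a) by rewrite ltr_pwDl// powR_ge0.
have c0 : 0 < c by rewrite mulr_gt0 ?expR_gt0// invr_gt0.
apply: (@lt_le_trans _ _ (\int[leb]_(t in `[1%R, 2%R]) (c%:E))%E).
  rewrite integral_cst//= lebesgue_measure_itv/= lte_fin ltr1n.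
  by rewrite -EFinB -EFinM lte_fin mulr_gt0//; lra.
apply: (@le_trans _ _ (\int[leb]_(t in `[1%R, 2%R]) (gamma_density a t)%:E)%E).
  apply: ge0_le_integral; [exact: measurable_itv|by move=> t _; rewrite lee_fin ltW|
    exact: measurable_cst|exact: measurable_funS mg|].
  move=> t; rewrite /= in_itv/= => /andP[t1 t2].
  have t0 : 0 < t by rewrite (lt_le_trans _ t1).
  rewrite lee_fin gamma_density_gt0E// /c ler_pM ?expR_ge0 ?invr_ge0 ?(ltW d0)//.
    have -> : a - 1 = - (1 - a) by ring.
    rewrite powRN lef_pV2 ?posrE ?powR_gt0//.
    have := @powR_le_segment R (1 - a) 1 2 t ltr01.
    by rewrite powR1 t1 t2; apply.
  by rewrite ler_expR lerN2.
exact: ge0_subset_integral.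
Qed.

Lemma BetaE a b : Beta a b =
  fine (\int[leb]_(u in `]0%R, 1%R[) (u `^ (a - 1) * (1 - u) `^ (b - 1))%:E)%E.
Proof.
rewrite Beta.unlock /Rintegral integral_itv_bndoo//.
apply/measurable_EFinP; apply: measurable_funS measurableT _ _ => //.
apply: measurable_funM; first exact: measurable_powR.
apply: (measurableT_comp (measurable_powR (b - 1))).
exact: measurable_funB.
Qed.

Lemma Gamma_mul a b : 0 < a -> 0 < b ->
  Gamma a * Gamma b = Gamma (a + b) * Beta a b.
Proof.
move=> a0 b0.
have h := integrable_beta_weight (@ltr01 R) a0 b0.
have e : (fun x : R => (x - 0) `^ (a - 1) * (1 - x) `^ (b - 1)) =
         (fun x : R => x `^ (a - 1) * (1 - x) `^ (b - 1)).
  by apply/funext => x; rewrite subr0.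
rewrite e in h.
have h' : leb.-integrable `]0, 1[
    (EFin \o (fun x : R => x `^ (a - 1) * (1 - x) `^ (b - 1))).
  by apply: integrableS h => //; exact: subset_itv_oo_cc.
have fB : (\int[leb]_(u in `]0%R, 1%R[) (u `^ (a - 1) * (1 - u) `^ (b - 1))%:E
    \is a fin_num)%E.
  by apply: (integrable_fin_num _ h') => //; exact: measurable_itv.
have fa := integral_gamma_density_fin a0.
have fb := integral_gamma_density_fin b0.
have fab := integral_gamma_density_fin (addr_gt0 a0 b0).
rewrite !GammaE BetaE -(fineM fa fb) -(fineM fab fB).
by congr fine; exact: gamma_density_mul.
Qed.

End GammaBeta.

(** * Legendre's relation *)

Section LegendreRelation.
Context (R : realType) (k : R).
Hypothesis k0 : 0 < k.

Let w (u : R) := (u * (1 - u)) `^ (k - 1).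
Let X (x u : R) := x + (1 - x) * u.

Lemma integrable_omega : leb.-integrable `[0, 1] (EFin \o w).
Proof.
have := integrable_beta_weight (@ltr01 R) k0 k0.
apply: eq_integrable => //.
move=> u /set_mem; rewrite /= in_itv/= => /andP[u0 u1].
by rewrite subr0 /w powRM// subr_ge0.
Qed.
Let iw := integrable_omega.

(** Euler's integral: for [0 < x < 1] this is [Beta k k] times the hypergeometric function
    [2F1(-s, k; 2k; 1 - x)]. *)
Definition moment (s x : R) : R := wint 0 1 w (fun u => X x u `^ s).

Let X_gt0 (x u : R) : 0 < x < 1 -> u \in `[0, 1] -> 0 < X x u.
Proof.
rewrite in_itv/= /X => /andP[x0 x1] /andP[u0 u1].
by rewrite ltr_pwDl// mulr_ge0// subr_ge0 ltW.
Qed.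

Let cX x : {within `[0, 1], continuous (X x)}.
Proof. by rewrite /X; wcont. Qed.

Let cXs (s x : R) : 0 < x < 1 -> {within `[0, 1], continuous (fun u : R => X x u `^ s)}.
Proof.
move=> x01; apply: within_continuous_powR_gt0 => // u; exact: X_gt0.
Qed.

Let XS (s x u : R) : 0 < X x u -> X x u `^ (s + 1) = X x u * X x u `^ s.
Proof.
move=> X0; rewrite powRD ?(gt_eqF X0) ?implybT//.
by rewrite powRr1 ?ltW// mulrC.
Qed.

(** A contiguity relation, obtained by integration by parts with [phi = u (1 - u)]. After
    multiplication by [1 - x] the polynomials in [u] become polynomials in [X], because
    [(1 - x) u = X - x] and [(1 - x) (1 - u) = 1 - X]. *)
Lemma moment_rec (s x : R) : 0 < x < 1 ->
  (2 * k + s) * moment (s + 1) x =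
  (k + s) * (1 + x) * moment s x - s * x * moment (s - 1) x.
Proof.
move=> x01.
pose phi (u : R) := u * (1 - u).
have H : wint 0 1 w (fun u : R => k * (1 - u * 2) * X x u `^ s +
    phi u * (s * X x u `^ (s - 1) * (1 - x))) = 0.
  apply: (@wint_ibp R 0 1 k phi (fun u => 1 - u * 2) (fun u : R => X x u `^ s)
    (fun u => s * X x u `^ (s - 1) * (1 - x))) => //.
  - by rewrite /phi mul0r.
  - by rewrite /phi subrr mulr0.
  - by move=> u; rewrite in_itv/= => /andP[u0 u1]; rewrite mulr_gt0// subr_gt0.
  - by rewrite /phi; wcont.
  - by wcont.
  - exact: cXs.
  - have h := @cXs (s - 1) _ x01.
    by wcont.
  - move=> u _; rewrite /phi; notypeclasses refine (is_derive_eqr _ _); first by deriv.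
    by rewrite /=; ring.
  - move=> u /subset_itv_oo_cc /(X_gt0 x01) X0.
    rewrite /X; notypeclasses refine (is_derive_eqr _ _); first by deriv; exact: X0.
    by rewrite /= /X; ring.
have h0 := @cXs (s - 1) _ x01; have h1 := @cXs s _ x01; have h2 := @cXs (s + 1) _ x01.
have : (1 - x) * wint 0 1 w (fun u : R => k * (1 - u * 2) * X x u `^ s +
    phi u * (s * X x u `^ (s - 1) * (1 - x))) = 0 by rewrite H mulr0.
rewrite -wintZ//; last by rewrite /phi; wcont.
rewrite (@eq_wint _ _ _ _ _ (fun u : R => (- (2 * k + s) * X x u `^ (s + 1) +
    ((k + s) * (1 + x)) * X x u `^ s) + (- (s * x)) * X x u `^ (s - 1))); last first.
  move=> u /(X_gt0 x01) X0.
  have := @XS (s - 1) _ _ X0; rewrite subrK => E; rewrite XS// !E /phi.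
  by move: (X x u `^ (s - 1)) => Y; rewrite /X; ring.
rewrite wintD//; [|by wcont..].
rewrite wintD//; [|by wcont..].
rewrite !wintZ// -!/(moment _ _).
by move: (moment _ _) (moment _ _) (moment _ _) => m1 m2 m3 E; lra.
Qed.

(** The derivative of [X] in the parameter is [1 - u = (1 - X) / (1 - x)], which leads back to
    moments. *)
Lemma is_derive_moment (s x : R) : 0 < x < 1 ->
  is_derive x (1 : R) (moment s) (s * (moment (s - 1) x - moment s x) / (1 - x)).
Proof.
move=> x01; have x1 : 1 - x != 0 by rewrite subr_eq0 gt_eqF//; case/andP: x01.
have -> : s * (moment (s - 1) x - moment s x) / (1 - x) =
    wint 0 1 w (fun u : R => s * X x u `^ (s - 1) * (1 - u)).
  have h0 := @cXs (s - 1) _ x01; have h1 := @cXs s _ x01.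
  apply: (mulIf x1); rewrite mulfVK//.
  rewrite [RHS]mulrC -wintZ//; last by wcont.
  rewrite (@eq_wint _ _ _ _ _ (fun u : R => s * X x u `^ (s - 1) + (- s) * X x u `^ s)).
    rewrite wintD//; [|by wcont..].
    rewrite !wintZ// -!/(moment _ _).
    by move: (moment _ _) (moment _ _) => m1 m2; ring.
  move=> u /(X_gt0 x01) X0.
  have := @XS (s - 1) _ _ X0; rewrite subrK => ->.
  by move: (X x u `^ (s - 1)) => Y; rewrite /X; ring.
have near01 : \forall t \near x, 0 < t < 1.
  have /andP[x0 x1'] := x01; near=> t; apply/andP; split; near: t.
    exact: lt_nbhsr.
  exact: lt_nbhsl.
have cXX : continuous (fun z : R * R => X z.1 z.2) by rewrite /X; cont.
have cj r y : y \in `[0, 1] -> {for (x, y), continuous (fun z : R * R => X z.1 z.2 `^ r)}.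
  move=> y01; apply: (cvg_comp (fun z : R * R => X z.1 z.2) (fun y : R => y `^ r) (cXX _)).
  by apply: powR_continuous_gt0; exact: X_gt0.
apply: (@wint_is_derive R 0 1 w (fun x u => X x u `^ s)
  (fun x u => s * X x u `^ (s - 1) * (1 - u))) => //.
- by near=> t; apply: cXs; near: t; exact: near01.
- have h0 := @cXs (s - 1) _ x01; by wcont.
- move=> y y01.
  have c1 : continuous (fun z : R * R => 1 - z.2) by cont.
  exact: (cvgM (cvgM (cvg_cst s) (@cj (s - 1) _ y01)) (c1 _)).
- near=> t; move=> y y01.
  have X0 : 0 < X t y by apply: X_gt0 => //; near: t; exact: near01.
  notypeclasses refine (is_derive_eqr _ _); first by rewrite /X; deriv; exact: X0.
  by rewrite /= /X; ring.
Unshelve. all: by end_near. Qed.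

(* For [k = 1 / 2] this is, up to normalization, the left-hand side of
   Legendre's relation between the complete elliptic integrals. *)
Definition legendre (x : R) : R :=
  moment k x * moment (k - 1) (1 - x) + moment (k - 1) x * moment k (1 - x)
  - moment (k - 1) x * moment (k - 1) (1 - x).

Lemma is_derive_legendre (x : R) : 0 < x < 1 -> is_derive x (1 : R) legendre 0.
Proof.
move=> x01; have y01 : 0 < 1 - x < 1 by move: x01 => /andP[? ?]; lra.
have x1 : 1 - x != 0 by rewrite subr_eq0 gt_eqF//; case/andP: x01.
have x0 : x != 0 by rewrite gt_eqF//; case/andP: x01.
have dk := @is_derive_moment k _ x01; have dk1 := @is_derive_moment (k - 1) _ x01.
have comp s : is_derive x (1 : R) (fun t => moment s (1 - t))
    (s * (moment (s - 1) (1 - x) - moment s (1 - x)) / (1 - (1 - x)) * (0 - 1)).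
  notypeclasses refine (@is_derive_funcomp _ (moment s) (fun t => 1 - t) _ _ _ _ _).
    exact: is_derive_moment.
  by deriv.
have main (A0 A1 B0 B1 : R -> R) (d0 d1 e0 e1 : R) :
    is_derive x (1 : R) A0 d0 -> is_derive x (1 : R) A1 d1 ->
    is_derive x (1 : R) B0 e0 -> is_derive x (1 : R) B1 e1 ->
    d1 * B0 x + A1 x * e0 + (d0 * B1 x + A0 x * e1) - (d0 * B0 x + A0 x * e0) = 0 ->
    is_derive x (1 : R) (fun t => A1 t * B0 t + A0 t * B1 t - A0 t * B0 t) 0.
  by move=> *; notypeclasses refine (is_derive_eqr _ _); first by deriv.
apply: (main _ _ _ _ _ _ _ _ dk1 dk (comp (k - 1)) (comp k)).
have r1 := @moment_rec (k - 1) _ x01; have r2 := @moment_rec (k - 1) _ y01.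
rewrite subrK in r1 r2.
move: (moment (k - 1) x) (moment k x) (moment (k - 1 - 1) x) r1 => a0 a1 a2 r1.
move: (moment (k - 1) (1 - x)) (moment k (1 - x)) (moment (k - 1 - 1) (1 - x)) r2 => b0 b1 b2 r2.
(* The moment of order [k - 2] enters the derivative only with the factor [k - 1]. Solving for this
   product, and not for the moment, includes [k = 1]. *)
have E1 : (k - 1) * a2 = ((k + (k - 1)) * (1 + x) * a0 - (2 * k + (k - 1)) * a1) / x.
  by rewrite r1; field.
have E2 : (k - 1) * b2 = ((k + (k - 1)) * (1 + (1 - x)) * b0 - (2 * k + (k - 1)) * b1) / (1 - x).
  by rewrite r2; field.
rewrite !(mulrBr (k - 1)) E1 E2.
have -> : 1 - (1 - x) = x by ring.
by field; rewrite x0 x1.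
Qed.

Let legendre_le_eq (x y : R) : 0 < x -> x <= y -> y < 1 -> legendre y = legendre x.
Proof.
move=> x0 xy y1; have h (z : R) : z \in `[x, y] -> is_derive z (1 : R) legendre 0.
  rewrite in_itv/= => /andP[xz zy]; apply: is_derive_legendre.
  by rewrite (lt_le_trans x0 xz) (le_lt_trans zy y1).
have c : {within `[x, y], continuous legendre}.
  by apply: derivable_within_continuous => z /h[].
have h' (z : R) : z \in `]x, y[ -> is_derive z (1 : R) legendre 0.
  by move=> zxy; apply: h; exact: subset_itv_oo_cc zxy.
have := @derive0_segment_eq R x y legendre xy c h'.
exact.
Qed.

Lemma legendre_eq (x y : R) : 0 < x < 1 -> 0 < y < 1 -> legendre x = legendre y.
Proof.
move=> /andP[x0 x1] /andP[y0 y1]; have [xy|yx] := leP x y.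
  by rewrite (legendre_le_eq x0 xy y1).
by rewrite (legendre_le_eq y0 (ltW yx) x1).
Qed.

Lemma wint_omega_powR (p : R) : 0 < p ->
  wint 0 1 w (fun u => u `^ p) = Beta (p + k) k.
Proof.
move=> p0; rewrite wint.unlock Beta.unlock; apply: (congr1 fine).
have mB (c d : R) : measurable_fun (`]0, 1[%classic : set R) (fun u : R => u `^ c * (1 - u) `^ d).
  apply: measurable_funS measurableT _ _ => //.
  apply: measurable_funM; first exact: measurable_powR.
  by apply: (measurableT_comp (measurable_powR d)); exact: measurable_funB.
have mW : measurable_fun (`]0, 1[%classic : set R) (fun u : R => u `^ p * w u).
  apply: measurable_funS measurableT _ _ => //.
  apply: measurable_funM; first exact: measurable_powR.
  apply: (measurableT_comp (measurable_powR (k - 1))).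
  by apply: measurable_funM => //; exact: measurable_funB.
apply: (eq_integral_itv_bounded _ _ mW (mB _ _)) => u.
rewrite in_itv/= => /andP[u0 u1].
rewrite /w powRM ?subr_ge0 ?ltW// mulrA; congr (_ * _).
by rewrite -powRD ?(gt_eqF u0) ?implybT//; congr (_ `^ _); ring.
Qed.

Lemma BetaEw : Beta k k = wint 0 1 w (fun=> 1).
Proof.
rewrite wint.unlock Beta.unlock; apply: eq_Rintegral => u /set_mem /=; rewrite in_itv/= => /andP[u0 u1].
by rewrite mul1r /w powRM// subr_ge0.
Qed.

Lemma moment0_powR (p : R) : 0 < p -> moment p 0 = Beta (p + k) k.
Proof.
move=> p0; transitivity (wint 0 1 w (fun u => u `^ p)); last exact: wint_omega_powR.
apply: eq_wint => u _; by rewrite /X add0r subr0 mul1r.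
Qed.

Lemma moment1 (p : R) : moment p 1 = Beta k k.
Proof.
rewrite BetaEw; apply: eq_wint => u _.
by rewrite /X subrr mul0r addr0 powR1.
Qed.

Let cvg_moment0 (p : R) : 0 < p -> moment p x @[x --> 0^'+] --> moment p 0.
Proof.
move=> p0.
have cm : continuous (fun x => wint 0 1 w (fun u => Num.max (X x u) 0 `^ p)).
  apply: wint_continuousT => //.
  apply: (continuous_compT (f := fun z : R * R => X z.1 z.2)
    (g := fun y => Num.max y 0 `^ p)); first by rewrite /X; cont.
  exact: continuous_maxr0_powR.
have E x : 0 <= x <= 1 ->
    wint 0 1 w (fun u => Num.max (X x u) 0 `^ p) = moment p x.
  move=> /andP[x0 x1]; apply: eq_wint => u; rewrite in_itv/= => /andP[u0 u1].
  by rewrite (max_idPl _)// /X addr_ge0// mulr_ge0// subr_ge0.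
rewrite -(E 0) ?lexx ?ler01//.
have := cvg_at_right_filter (cm 0).
apply: cvg_trans; apply: near_eq_cvg; near=> x; rewrite E//.
by apply/andP; split; near: x; [exact: nbhs_right_ge|exact: nbhs_right_le].
Unshelve. all: by end_near. Qed.

Let cvg_moment1 (p : R) : moment p (1 - x) @[x --> 0^'+] --> moment p 1.
Proof.
have c1 : {for (1 : R), continuous (moment p)}.
  apply: wint_continuous => //.
    near=> t; apply: within_continuous_powR_gt0 => // u.
    rewrite in_itv/= => /andP[u0 u1]; rewrite /X.
    have : 0 < t < 2.
      by apply/andP; split; near: t; [apply: lt_nbhsr|apply: lt_nbhsl]; rewrite ?ltr1n.
    by move=> /andP[t0 t2]; nra.
  move=> y y01.
  apply: (cvg_comp (fun z : R * R => X z.1 z.2) (fun y : R => y `^ p)).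
    have cXX : continuous (fun z : R * R => X z.1 z.2) by rewrite /X; cont.
    exact: cXX.
  by apply: powR_continuous_gt0; rewrite /X/= subrr mul0r addr0.
have cs : continuous (fun x : R => 1 - x) by cont.
have := cvg_at_right_filter (cs 0); rewrite subr0 => h.
exact: (cvg_comp (fun x : R => 1 - x) (moment p) h c1).
Unshelve. all: by end_near. Qed.

(** For [k <= 1 / 2] the moment of order [k - 1] tends to infinity at 0. The bounds [x <= X <= 1]
    show that [x] times this moment still tends to 0. *)
Let moment_bounds (x : R) : 0 < x < 1 ->
  0 <= x * moment (k - 1) x <= (x `^ k + x) * Beta k k.
Proof.
move=> x01; have /andP[x0 x1] := x01.
have h0 := @cXs (k - 1) _ x01.
apply/andP; split.
  apply: mulr_ge0 (ltW x0) _; apply: wint_ge0 => u _; exact: powR_ge0.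
have c1 : {within `[0, 1], continuous (fun _ : R => 1 : R)} by wcont.
rewrite BetaEw -(wintZ _ iw c1) -(wintZ _ iw h0).
apply: le_wint => //; [by wcont|by wcont|by move=> *; exact: powR_ge0|].
move=> u u01; rewrite mulr1.
have X0 := X_gt0 x01 u01.
have : X x u `^ (k - 1) <= x `^ (k - 1) + 1 `^ (k - 1).
  apply: powR_le_segment => //; move: u01; rewrite /= in_itv/= => /andP[u0 u1].
  by rewrite /X; apply/andP; split; nra.
rewrite powR1 => /(ler_wpM2l (ltW x0)) /le_trans; apply.
by rewrite mulrDr mulr1 mulr_powRB1// ltW.
Qed.

(** At the parameter [1 - x] one has [1 - X = x (1 - u)]. The difference is therefore of order [x],
    which compensates the growth of [moment (k - 1) x] at 0. *)
Let moment_diff (x : R) : 0 < x < 1 ->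
  exists c, [/\ moment (k - 1) (1 - x) - moment k (1 - x) = x * c,
    0 <= c & c <= moment (k - 1) (1 - x)].
Proof.
move=> x01; have y01 : 0 < 1 - x < 1 by move: x01 => /andP[? ?]; lra.
have /andP[x0 x1] := x01.
have h0 := @cXs (k - 1) _ y01; have h1 := @cXs k _ y01.
exists (wint 0 1 w (fun u : R => X (1 - x) u `^ (k - 1) * (1 - u))); split.
- rewrite -wintZ//; last by wcont.
  rewrite (@eq_wint _ _ _ _ _ (fun u : R => X (1 - x) u `^ (k - 1) + (- 1) * X (1 - x) u `^ k)).
    rewrite wintD//; last by wcont.
    by rewrite wintZ// -!/(moment _ _) mulN1r.
  move=> u /(X_gt0 y01) X0.
  have := @XS (k - 1) _ _ X0; rewrite subrK => ->.
  by move: (X (1 - x) u `^ (k - 1)) => Y; rewrite /X; ring.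
- apply: wint_ge0 => u; last by move=> _; exact: powR_ge0.
  by rewrite in_itv/= => /andP[u0 u1]; rewrite mulr_ge0 ?powR_ge0// subr_ge0.
apply: le_wint => //; [by wcont|by move=> *; exact: powR_ge0|].
move=> u u01.
rewrite ler_piMr ?powR_ge0//; move: u01; rewrite /= in_itv/= => /andP[u0 u1].
by rewrite lerBlDr lerDl.
Qed.

(** Grouping the last two terms of [legendre] gives a product that tends to 0 by the two preceding
    facts, so the limit is that of the first term. *)
Let cvg_legendre : legendre x @[x --> 0^'+] --> Beta (2 * k) k * Beta k k.
Proof.
have B2 : Beta (2 * k) k = moment k 0 by rewrite moment0_powR//; congr Beta; ring.
have h0 : (x `^ k + x) * Beta k k * moment (k - 1) (1 - x) @[x --> 0^'+] --> 0.
  rewrite [X in _ --> X](_ : 0 = (0 + 0) * Beta k k * moment (k - 1) 1); last first.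
    by rewrite addr0 !mul0r.
  apply: cvgM (@cvg_moment1 (k - 1)); apply: cvgMl; apply: cvgD.
    exact: powR_cvg0.
  by apply: cvg_at_right_filter; exact: cvg_id.
have h1 : moment (k - 1) x * (moment (k - 1) (1 - x) - moment k (1 - x))
    @[x --> 0^'+] --> 0.
  apply: (squeeze_cvgr _ (cvg_cst 0) h0); near=> x.
  have x01 : 0 < x < 1.
    by apply/andP; split; near: x; [exact: nbhs_right_gt|exact: nbhs_right_lt].
  have [c [-> c0 c1]] := moment_diff x01.
  have /andP[m0 m1] := moment_bounds x01.
  by rewrite mulrCA mulrA mulr_ge0//= ler_pM.
have h2 : legendre x - moment k x * moment (k - 1) (1 - x) @[x --> 0^'+] --> 0.
  have -> : (fun x => legendre x - moment k x * moment (k - 1) (1 - x)) =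
      (fun x => - (moment (k - 1) x * (moment (k - 1) (1 - x) - moment k (1 - x)))).
    by apply/funext => x; rewrite /legendre; ring.
  have H := cvgN h1; rewrite oppr0 in H; exact: H.
have h3 : moment k x * moment (k - 1) (1 - x) @[x --> 0^'+] -->
    moment k 0 * moment (k - 1) 1.
  exact: cvgM (cvg_moment0 k0) (@cvg_moment1 (k - 1)).
have h4 : legendre x - moment k x * moment (k - 1) (1 - x)
    + moment k x * moment (k - 1) (1 - x) @[x --> 0^'+] -->
    0 + moment k 0 * moment (k - 1) 1 by exact: cvgD h2 h3.
rewrite add0r moment1 -B2 in h4.
have e : (fun x => legendre x - moment k x * moment (k - 1) (1 - x)
    + moment k x * moment (k - 1) (1 - x)) = legendre.
  by apply/funext => x; rewrite subrK.
by rewrite e in h4.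
Unshelve. all: by end_near. Qed.

Lemma legendreE (x : R) : 0 < x < 1 -> legendre x = Beta (2 * k) k * Beta k k.
Proof.
move=> x01; have h : legendre y @[y --> 0^'+] --> legendre x.
  apply: cvg_near_cst; near=> y; apply: legendre_eq => //.
  by apply/andP; split; near: y; [exact: nbhs_right_gt|exact: nbhs_right_lt].
exact: (cvg_unique _ h cvg_legendre).
Unshelve. all: by end_near. Qed.

End LegendreRelation.

(** * The Bessel function and the double integrals *)

Section Bessel.
Context (R : realType) (k : R).
Hypothesis k0 : 0 < k.

Let w (t : R) := (1 - t ^+ 2) `^ (k - 1).

Lemma integrable_bessel_weight : leb.-integrable `[-1, 1] (EFin \o w).
Proof.
have m1 : (-1 : R) < 1 by lra.
have := integrable_beta_weight m1 k0 k0.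
apply: eq_integrable => //.
move=> t /set_mem; rewrite /= in_itv/= => /andP[t0 t1]; congr EFin.
rewrite -powRM ?subr_ge0// /w; congr (_ `^ _); ring.
Qed.
Let iw := integrable_bessel_weight.

Let c := Gamma (2 * k) / (2 `^ (2 * k - 1) * Gamma k ^+ 2).

Let b (j : nat) (z : R) := wint (-1) 1 w (fun t => t ^+ j * expR (z * t)).

Let continuous_funX (T : topologicalType) (f : T -> R) (j : nat) : continuous f ->
  continuous (fun x => f x ^+ j).
Proof.
move=> cf; elim: j => [|j IH].
  by under eq_fun do rewrite expr0; exact: continuous_funcst.
by under eq_fun do rewrite exprS; exact: continuous_funM.
Qed.

Let cF (j : nat) : continuous (fun z : R * R => z.2 ^+ j * expR (z.1 * z.2)).
Proof.
apply: continuous_funM; last by cont.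
by apply: (@continuous_funX _ (fun z : R * R => z.2)); cont.
Qed.

Let cs (j : nat) (z : R) : continuous (fun t : R => t ^+ j * expR (z * t)).
Proof.
apply: continuous_funM; last by cont.
by apply: (@continuous_funX _ (fun t : R => t)); cont.
Qed.

Let is_derive_b j z : is_derive z (1 : R) (b j) (b j.+1 z).
Proof.
apply: (@wint_is_derive R (-1) 1 w (fun z t : R => t ^+ j * expR (z * t))
  (fun z t : R => t ^+ j.+1 * expR (z * t))) => //.
- by near=> t; apply: continuous_subspaceT; exact: cs.
- by apply: continuous_subspaceT; exact: cs.
- by move=> y _; exact: cF.
near=> t => y _; notypeclasses refine (is_derive_eqr _ _); first by deriv.
by rewrite /= exprSr; ring.
Unshelve. all: by end_near. Qed.

Let cb j : continuous (b j).
Proof. exact: (wint_continuousT (f := fun z t : R => t ^+ j * expR (z * t)) iw (@cF j)). Qed.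

Let besselE : besselJ k = fun z => c * b 0 z.
Proof.
apply/funext => z; rewrite /besselJ -/c /b wint.unlock; congr (_ * _).
by apply: eq_Rintegral => t _; rewrite expr0 mul1r.
Qed.

Let is_derive_cb j z : is_derive z (1 : R) (fun z => c * b j z) (c * b j.+1 z).
Proof.
have h := is_derive_b j z.
notypeclasses refine (is_derive_eqr _ _); first by deriv.
by rewrite /= mul0r add0r.
Qed.

Let dbesselE : derive1 (besselJ k) = fun z => c * b 1 z.
Proof.
by rewrite besselE; apply/funext => z; rewrite derive1E; case: (is_derive_cb 0 z).
Qed.

Let d2besselE : derive1 (derive1 (besselJ k)) = fun z => c * b 2 z.
Proof.
by rewrite dbesselE; apply/funext => z; rewrite derive1E; case: (is_derive_cb 1 z).
Qed.

Lemma is_derive_besselJ z : is_derive z (1 : R) (besselJ k) (derive1 (besselJ k) z).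
Proof. by rewrite dbesselE besselE. Qed.

Lemma is_derive_dbesselJ z :
  is_derive z (1 : R) (derive1 (besselJ k)) (derive1 (derive1 (besselJ k)) z).
Proof. by rewrite d2besselE dbesselE. Qed.

Lemma continuous_besselJ : continuous (besselJ k).
Proof. by rewrite besselE; apply: continuous_funM; [exact: continuous_funcst|exact: cb]. Qed.

Lemma continuous_dbesselJ : continuous (derive1 (besselJ k)).
Proof. by rewrite dbesselE; apply: continuous_funM; [exact: continuous_funcst|exact: cb]. Qed.

Lemma continuous_d2besselJ : continuous (derive1 (derive1 (besselJ k))).
Proof. by rewrite d2besselE; apply: continuous_funM; [exact: continuous_funcst|exact: cb]. Qed.

(** Apply [wint_ibp] to [1 - t^2] and [expR (z * t)]: each factor [t] in the result is one
    derivative in [z]. *)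
Lemma besselJ_ode z :
  z * derive1 (derive1 (besselJ k)) z = z * besselJ k z - 2 * k * derive1 (besselJ k) z.
Proof.
rewrite d2besselE dbesselE besselE.
suff H : z * b 0 z + (- z) * b 2 z + (- (2 * k)) * b 1 z = 0.
  move: (b 0 z) (b 1 z) (b 2 z) H => b0 b1 b2 H.
  have -> : z * (c * b2) = z * (c * b0) - 2 * k * (c * b1)
    - c * (z * b0 + (- z) * b2 + (- (2 * k)) * b1) by ring.
  by rewrite H mulr0 subr0.
have h j : {within `[-1, 1], continuous (fun t : R => t ^+ j * expR (z * t))}.
  by apply: continuous_subspaceT; exact: cs.
have h0 := h 0; have h1 := h 1; have h2 := h 2.
rewrite -!wintZ//.
rewrite -wintD//; [|by apply: within_funM => //; exact: within_funcst..].
rewrite -wintD//; last 2 first.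
- by apply: within_funD; apply: within_funM => //; exact: within_funcst.
- by apply: within_funM => //; exact: within_funcst.
pose phi (t : R) := 1 - t ^+ 2.
transitivity (wint (-1) 1 w (fun t => k * - (2 * t) * expR (z * t)
    + phi t * (z * expR (z * t)))).
  by apply: eq_wint => t _; rewrite /phi; ring.
apply: (@wint_ibp R (-1) 1 k phi (fun t => - (2 * t)) (fun t => expR (z * t))
  (fun t => z * expR (z * t))) => //.
- by rewrite /phi sqrrN expr1n subrr.
- by rewrite /phi expr1n subrr.
- by move=> t; rewrite in_itv/= /phi => /andP[t0 t1]; nra.
- have -> : phi = (fun t => 1 - t * t) by apply/funext => t; rewrite /phi expr2.
  by wcont.
- by wcont.
- by wcont.
- by wcont.
- move=> t _; have -> : phi = (fun t => 1 - t * t) by apply/funext => u; rewrite /phi expr2.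
  notypeclasses refine (is_derive_eqr _ _); first by deriv.
  by rewrite /=; ring.
move=> t _; notypeclasses refine (is_derive_eqr _ _); first by deriv.
by rewrite /=; ring.
Qed.

Lemma dbesselJ0 : derive1 (besselJ k) 0 = 0.
Proof.
have := besselJ_ode 0; rewrite !mul0r sub0r => /esym/eqP.
by rewrite oppr_eq0 !mulf_eq0 pnatr_eq0 (gt_eqF k0)/= => /eqP.
Qed.

(** With [t = 2 u - 1] one has [1 - t^2 = 4 u (1 - u)]. The resulting factor
    [2 * 4^(k - 1) = 2^(2 k - 1)] cancels the power of 2 in the normalization, and [Gamma_mul] the
    rest. *)
Lemma besselJ0 : besselJ k 0 = 1.
Proof.
have G2 : 0 < 2 * k by rewrite mulr_gt0.
have GB : Gamma k * Gamma k = Gamma (2 * k) * Beta k k.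
  have -> : 2 * k = k + k by ring.
  exact: Gamma_mul.
have W : wint (-1) 1 w (fun=> 1) = 2 `^ (2 * k - 1) * Beta k k.
  have p2 : 0 < (2 : R) by [].
  have mw : measurable_fun setT (fun t : R => 1 * w t).
    apply: measurable_funM => //; apply: (measurableT_comp (measurable_powR (k - 1))).
    by apply: measurable_funB => //; exact: measurable_funX.
  have H := @Rintegral_affine R 2 (-1) 0 1 (fun t => 1 * w t) p2
    (measurable_funS measurableT (@subsetT _ _) mw).
  have e1 : 2 * 0 + (-1) = -1 :> R by ring.
  have e2 : 2 * 1 + (-1) = 1 :> R by ring.
  rewrite e1 e2 in H.
  rewrite wint.unlock H; last by move=> *; rewrite mul1r powR_ge0.
  rewrite BetaEw// -(wintZ _ (integrable_omega k0)); last by wcont.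
  have -> : 2 `^ (2 * k - 1) = 2 * 4 `^ (k - 1) :> R.
    have -> : 4 = 2 * 2 :> R by rewrite -natrM.
    rewrite powRM// -powRD ?pnatr_eq0 ?implybT//.
    have -> : 2 * k - 1 = 1 + (k - 1 + (k - 1)) by ring.
    by rewrite [in LHS]powRD ?pnatr_eq0 ?implybT// powRr1.
  rewrite wintZ; [|exact: integrable_omega|by wcont].
  rewrite -mulrA; congr (2 * _).
  rewrite wint.unlock -RintegralZl//; last first.
    by apply: integrable_continuousM; [exact: integrable_omega|wcont].
  apply: eq_Rintegral => u /set_mem /=; rewrite in_itv/= => /andP[u0 u1].
  rewrite !mul1r /w -powRM ?mulr_ge0 ?subr_ge0//; congr (_ `^ _); ring.
rewrite besselE /b.
rewrite (@eq_wint _ _ _ _ _ (fun=> 1)); last first.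
  by move=> t _; rewrite expr0 mul0r expR0 mul1r.
rewrite W /c.
have g1 := Gamma_gt0 k0; have g2 := Gamma_gt0 G2.
have p2 : 0 < 2 `^ (2 * k - 1) :> R by apply: powR_gt0.
move: (Gamma k) (Gamma (2 * k)) (Beta k k) (2 `^ (2 * k - 1)) GB g1 g2 p2 => x y B p GB x0 y0 p0.
have -> : y / (p * x ^+ 2) * (p * B) = (y * B) / (x * x).
  by field; rewrite !gt_eqF.
by rewrite -GB divff// mulf_neq0// gt_eqF.
Qed.
End Bessel.

(** * Differential equations for the double integrals *)

Section BesselIntegrals.
Context (R : realType) (k l1 l2 l3 : R) (J dJ d2J : R -> R).
Hypothesis k0 : 0 < k.
Hypothesis l12 : l2 < l1.
Hypothesis l23 : l3 < l2.
Hypothesis l0 : l1 + l2 + l3 = 0.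
Hypothesis cJ : continuous J.
Hypothesis cdJ : continuous dJ.
Hypothesis cd2J : continuous d2J.
Hypothesis JD : forall z : R, is_derive z (1 : R) J (dJ z).
Hypothesis dJD : forall z : R, is_derive z (1 : R) dJ (d2J z).
Hypothesis Jode : forall z : R, z * d2J z = z * J z - 2 * k * dJ z.

(** On the domain of integration [W_k] is the product of [(- chi x)^(k - 1)] and [(chi y)^(k - 1)],
    and [chi] vanishes at the ends of both intervals. This permits integration by parts in each
    variable separately. *)
Definition chi (x : R) := (x - l1) * (x - l2) * (x - l3).
Definition dchi (x : R) :=
  (x - l2) * (x - l3) + (x - l1) * (x - l3) + (x - l1) * (x - l2).
Definition weight1 (x : R) := (- chi x) `^ (k - 1).
Definition weight2 (x : R) := chi x `^ (k - 1).

Lemma integrable_weight1 : leb.-integrable `[l2, l1] (EFin \o weight1).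
Proof.
have h := integrable_beta_weight l12 k0 k0.
have cr : {within `[l2, l1], continuous (fun x : R => (x - l3) `^ (k - 1))}.
  apply: within_continuous_powR_gt0; first by wcont.
  by move=> x; rewrite in_itv/= => /andP[x2 x1]; rewrite subr_gt0 (lt_le_trans l23).
have := integrable_continuousM h cr.
apply: eq_integrable => // x /set_mem; rewrite /= in_itv/= => /andP[x2 x1].
congr EFin; rewrite -!powRM ?mulr_ge0 ?subr_ge0//; last first.
  by rewrite ltW// (lt_le_trans l23).
by rewrite /weight1 /chi; congr (_ `^ _); ring.
Qed.

Lemma integrable_weight2 : leb.-integrable `[l3, l2] (EFin \o weight2).
Proof.
have h := integrable_beta_weight l23 k0 k0.
have cr : {within `[l3, l2], continuous (fun x : R => (l1 - x) `^ (k - 1))}.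
  apply: within_continuous_powR_gt0; first by wcont.
  by move=> x; rewrite in_itv/= => /andP[x3 x2]; rewrite subr_gt0 (le_lt_trans x2).
have := integrable_continuousM h cr.
apply: eq_integrable => // x /set_mem; rewrite /= in_itv/= => /andP[x3 x2].
congr EFin; rewrite -!powRM ?mulr_ge0 ?subr_ge0//; last first.
  by rewrite ltW// (le_lt_trans x2).
by rewrite /weight2 /chi; congr (_ `^ _); ring.
Qed.
Let iw1 := integrable_weight1.
Let iw2 := integrable_weight2.

Let I := dint l2 l1 l3 l2 weight1 weight2.

Let is_derive_chi (x : R) : is_derive x (1 : R) chi (dchi x).
Proof.
rewrite /chi; notypeclasses refine (is_derive_eqr _ _); first by deriv.
by rewrite /= /dchi; ring.
Qed.

Let cchi : continuous chi. Proof. by rewrite /chi; cont. Qed.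
Let cdchi : continuous dchi. Proof. by rewrite /dchi; cont. Qed.

Let ibp1 (g dg : R -> R) : continuous g -> continuous dg ->
  (forall x : R, is_derive x (1 : R) g (dg x)) ->
  wint l2 l1 weight1 (fun x => k * dchi x * g x + chi x * dg x) = 0.
Proof.
move=> cg cdg gD.
have H : wint l2 l1 weight1 (fun x => k * - dchi x * g x + - chi x * dg x) = 0.
  apply: (@wint_ibp R l2 l1 k (fun x => - chi x) (fun x => - dchi x) g dg) => //.
  - by rewrite /chi subrr mulr0 mul0r oppr0.
  - by rewrite /chi subrr !mul0r oppr0.
  - move=> x; rewrite in_itv/= => /andP[x2 x1]; rewrite /chi.
    have -> : - ((x - l1) * (x - l2) * (x - l3)) = (l1 - x) * (x - l2) * (x - l3) by ring.
    by rewrite !mulr_gt0// subr_gt0// (lt_trans l23).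
  - by apply: continuous_subspaceT; cont.
  - by apply: continuous_subspaceT; cont.
  - exact: continuous_subspaceT.
  - exact: continuous_subspaceT.
  - by move=> x _; apply: is_derive_funN; exact: is_derive_chi.
rewrite -[RHS](mulr0 (- 1)) -H -wintZ//; last first.
  by apply: continuous_subspaceT; cont.
by apply: eq_wint => x _; ring.
Qed.

Let ibp2 (g dg : R -> R) : continuous g -> continuous dg ->
  (forall x : R, is_derive x (1 : R) g (dg x)) ->
  wint l3 l2 weight2 (fun x => k * dchi x * g x + chi x * dg x) = 0.
Proof.
move=> cg cdg gD.
apply: (@wint_ibp R l3 l2 k chi dchi g dg) => //.
- by rewrite /chi subrr mulr0.
- by rewrite /chi subrr mulr0 mul0r.
- move=> x; rewrite in_itv/= => /andP[x3 x2]; rewrite /chi.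
  have -> : (x - l1) * (x - l2) * (x - l3) = (l1 - x) * (l2 - x) * (x - l3) by ring.
  by rewrite !mulr_gt0// subr_gt0// (lt_trans x2).
- exact: continuous_subspaceT.
- exact: continuous_subspaceT.
- exact: continuous_subspaceT.
- exact: continuous_subspaceT.
Qed.

Let cont2 (f : R -> R -> R) := continuous (fun z : R * R => f z.1 z.2).

(** The outer variable also occurs in the inner integral, which is first differentiated under the
    integral sign. *)
Let dibp1 (g dg : R -> R -> R) : cont2 g -> cont2 dg ->
  (forall x y : R, is_derive x (1 : R) (g ^~ y) (dg x y)) ->
  I (fun x y => k * dchi x * g x y + chi x * dg x y) = 0.
Proof.
move=> cg cdg gD.
pose G x := wint l3 l2 weight2 (g x); pose dG x := wint l3 l2 weight2 (dg x).
have cG : continuous G by exact: wint_continuousT.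
have cdG : continuous dG by exact: wint_continuousT.
have GD (x : R) : is_derive x (1 : R) G (dG x).
  apply: (@wint_is_derive R l3 l2 weight2 g dg) => //.
  - near=> t; apply: continuous_subspaceT; exact: continuous_section.
  - apply: continuous_subspaceT; exact: continuous_section.
  - by move=> y _; exact: cdg.
  - by near=> t => y _; exact: gD.
rewrite -(ibp1 cG cdG GD); apply: eq_wint => x _.
have cx1 : {within `[l3, l2], continuous (g x)}.
  by apply: continuous_subspaceT; exact: continuous_section.
have cx2 : {within `[l3, l2], continuous (dg x)}.
  by apply: continuous_subspaceT; exact: continuous_section.
rewrite /G /dG -!wintZ// -wintD//.
  by apply: within_funM => //; exact: within_funcst.
by apply: within_funM => //; exact: within_funcst.
Unshelve. all: by end_near. Qed.

Let dibp2 (g dg : R -> R -> R) : cont2 g -> cont2 dg ->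
  (forall x y : R, is_derive y (1 : R) (g x) (dg x y)) ->
  I (fun x y => k * dchi y * g x y + chi y * dg x y) = 0.
Proof.
move=> cg cdg gD; rewrite /I /dint.
transitivity (wint l2 l1 weight1 (fun x => 0 * 0)); last first.
  by rewrite wintZ ?mul0r//; exact: within_funcst.
apply: eq_wint => x _; rewrite mulr0; apply: ibp2 => //; exact: continuous_section.
Qed.

Let cont2M (f g : R -> R -> R) : cont2 f -> cont2 g ->
  cont2 (fun x y => f x y * g x y).
Proof. by move=> cf cg; apply: continuous_funM. Qed.

Let cont2c (a : R) : cont2 (fun _ _ => a).
Proof. exact: continuous_funcst. Qed.

Let dint_comb5 (a1 a2 a3 a4 a5 : R) (f1 f2 f3 f4 f5 : R -> R -> R) :
  cont2 f1 -> cont2 f2 -> cont2 f3 -> cont2 f4 -> cont2 f5 ->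
  I (fun x y => a1 * f1 x y + a2 * f2 x y + a3 * f3 x y + a4 * f4 x y + a5 * f5 x y)
  = a1 * I f1 + a2 * I f2 + a3 * I f3 + a4 * I f4 + a5 * I f5.
Proof.
move=> c1 c2 c3 c4 c5.
have sc a f : cont2 f -> cont2 (fun x y => a * f x y).
  by move=> cf; apply: cont2M.
have sd f g : cont2 f -> cont2 g -> cont2 (fun x y => f x y + g x y).
  by move=> cf cg; apply: continuous_funD.
have d1 := sc a1 _ c1; have d2 := sc a2 _ c2; have d3 := sc a3 _ c3.
have d4 := sc a4 _ c4; have d5 := sc a5 _ c5.
have e2 := sd _ _ d1 d2; have e3 := sd _ _ e2 d3; have e4 := sd _ _ e3 d4.
rewrite /I (dintD iw1 iw2 e4 d5) (dintD iw1 iw2 e3 d4) (dintD iw1 iw2 e2 d3).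
by rewrite (dintD iw1 iw2 d1 d2) !dintZ.
Qed.

Let dint_eq0 (f g h : R -> R -> R) : cont2 g -> cont2 h -> I g = 0 -> I h = 0 ->
  (forall x y, f x y = g x y + h x y) -> I f = 0.
Proof.
move=> cg ch g0 h0 fE; have -> : f = fun x y => g x y + h x y.
  by apply/funext => x; apply/funext => y; exact: fE.
by rewrite /I dintD// -/I g0 h0 addr0.
Qed.

Variables p q : R.
Let A (t x y : R) := t * (p * (x - y) / 2).
Let E (t x y : R) := expR (t * (q * (x + y))).

(** Here [c] is one root of [chi] and [ab] the product of the other two. The first factor arises
    when [J (A t x y)] is differentiated in an integration by parts: [(x^2 + c x + ab) + (y^2 + c y
    + ab) = (x - y)^2 + 2 (x y + c (x + y) / 2 + ab)], where [(x - y)^2] belongs to the derivative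
    of [Pint] and the remainder to [Qint]. *)
Definition bcoef (c ab x y : R) := (x * y + c / 2 * (x + y) + ab) * ((c - x) * (c - y)).

(** On the ray through [m], with [p = m1 - m2] and [q = (m1 + m2 - 2 m3) / 2], the double integral
    of the theorem is [3 (l1 - l2)] times [Pint] minus 6 times [Qint], both for the root [l3].
    [Dint] is the third integral that the equation for [Pint] involves; at [t = 0] it is the
    Dixon-Anderson integral. *)
Definition Dint (t : R) : R :=
  I (fun x y => (x - y) * (J (A t x y) * E t x y)).
Definition Pint (c t : R) : R :=
  I (fun x y => (x - y) * ((c - x) * (c - y)) * (J (A t x y) * E t x y)).
Definition Qint (c ab t : R) : R :=
  I (fun x y => bcoef c ab x y * (dJ (A t x y) * E t x y)).
Definition dPint (c t : R) : R :=
  I (fun x y => (x - y) * ((c - x) * (c - y)) *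
    (dJ (A t x y) * (p * (x - y) / 2) * E t x y + J (A t x y) * (E t x y * (q * (x + y))))).
Definition dQint (c ab t : R) : R :=
  I (fun x y => bcoef c ab x y *
    (d2J (A t x y) * (p * (x - y) / 2) * E t x y + dJ (A t x y) * (E t x y * (q * (x + y))))).

Let is_derive_kernel (h dh : R -> R) (x y t : R) :
  (forall z : R, is_derive z (1 : R) h (dh z)) ->
  is_derive t (1 : R) (fun t => h (A t x y) * E t x y)
   (dh (A t x y) * (p * (x - y) / 2) * E t x y + h (A t x y) * (E t x y * (q * (x + y)))).
Proof.
move=> hD; have hA : is_derive t (1 : R) (fun t => h (A t x y)) (dh (A t x y) * (p * (x - y) / 2)).
  notypeclasses refine (@is_derive_funcomp _ h (fun t => A t x y) _ _ _ _ _).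
    exact: hD.
  rewrite /A; notypeclasses refine (is_derive_eqr _ _); first by deriv.
  by rewrite /=; ring.
rewrite /E; notypeclasses refine (is_derive_eqr _ _); first by deriv.
by rewrite /=; ring.
Qed.

Lemma is_derive_Pint (c t : R) : is_derive t (1 : R) (Pint c) (dPint c t).
Proof.
apply: (dint_is_derive iw1 iw2 (f := fun t x y => (x - y) * ((c - x) * (c - y)) *
    (J (A t x y) * E t x y))
  (df := fun t x y => (x - y) * ((c - x) * (c - y)) *
    (dJ (A t x y) * (p * (x - y) / 2) * E t x y + J (A t x y) * (E t x y * (q * (x + y)))))).
- by rewrite /A /E; cont.
- by rewrite /A /E; cont.
move=> x y u; have h := is_derive_kernel x y u JD.
notypeclasses refine (is_derive_eqr _ _); first by deriv.
by rewrite /=; ring.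
Qed.

Lemma is_derive_Qint (c ab t : R) : is_derive t (1 : R) (Qint c ab) (dQint c ab t).
Proof.
apply: (dint_is_derive iw1 iw2 (f := fun t x y => bcoef c ab x y *
    (dJ (A t x y) * E t x y))
  (df := fun t x y => bcoef c ab x y *
    (d2J (A t x y) * (p * (x - y) / 2) * E t x y + dJ (A t x y) * (E t x y * (q * (x + y)))))).
- by rewrite /A /E /bcoef; cont.
- by rewrite /A /E /bcoef; cont.
move=> x y u; have h := is_derive_kernel x y u dJD.
notypeclasses refine (is_derive_eqr _ _); first by deriv.
by rewrite /=; ring.
Qed.

Section OdeForOneRoot.
Variables c ab : R.
(** As the roots have sum zero, the two roots other than [c] have sum [- c] and product [ab].
    Computing with [c] and [ab] alone treats the three roots at once. *)
Hypothesis chiE : forall x : R, chi x = (x - c) * (x ^+ 2 + c * x + ab).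
Hypothesis dchiE : forall x : R, dchi x = x ^+ 2 + c * x + ab + (x - c) * (2 * x + c).

Let is_derive_kernelx (h dh : R -> R) (t x y : R) :
  (forall z : R, is_derive z (1 : R) h (dh z)) ->
  is_derive x (1 : R) (fun x => h (A t x y) * E t x y)
   (dh (A t x y) * (t * p / 2) * E t x y + h (A t x y) * (E t x y * (t * q))).
Proof.
move=> hD; have hA : is_derive x (1 : R) (fun x => h (A t x y)) (dh (A t x y) * (t * p / 2)).
  notypeclasses refine (@is_derive_funcomp _ h (fun x => A t x y) _ _ _ _ _).
    exact: hD.
  rewrite /A; notypeclasses refine (is_derive_eqr _ _); first by deriv.
  by rewrite /=; ring.
rewrite /E; notypeclasses refine (is_derive_eqr _ _); first by deriv.
by rewrite /=; ring.
Qed.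

Let is_derive_kernely (h dh : R -> R) (t x y : R) :
  (forall z : R, is_derive z (1 : R) h (dh z)) ->
  is_derive y (1 : R) (fun y => h (A t x y) * E t x y)
   (- (dh (A t x y) * (t * p / 2) * E t x y) + h (A t x y) * (E t x y * (t * q))).
Proof.
move=> hD; have hA : is_derive y (1 : R) (fun y => h (A t x y)) (- (dh (A t x y) * (t * p / 2))).
  notypeclasses refine (is_derive_eqr _ _).
    notypeclasses refine (@is_derive_funcomp _ h (fun y => A t x y) _ _ _ _ _).
      exact: hD.
    by rewrite /A; deriv.
  by rewrite /=; ring.
rewrite /E; notypeclasses refine (is_derive_eqr _ _); first by deriv.
by rewrite /=; ring.
Qed.

(* In this proof and in that of [Qint_ode], the integrand is the divergence of
   the field [(chi x * g1, chi y * g2)] with respect to the weight. *)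
Lemma Pint_ode (t : R) :
  t * dPint c t + t * q * c * Pint c t + t * p * Qint c ab t + 3 * k * Pint c t
   + - (k * dchi c) * Dint t = 0.
Proof.
rewrite /dPint /Pint /Qint /Dint -dint_comb5; last 5 first.
- by rewrite /A /E /cont2; cont.
- by rewrite /A /E /cont2; cont.
- by rewrite /A /E /cont2 /bcoef; cont.
- by rewrite /A /E /cont2; cont.
- by rewrite /A /E /cont2; cont.
pose K h dh x y : R := dh (A t x y) * (t * p / 2) * E t x y + h (A t x y) * (E t x y * (t * q)).
pose K' h dh x y : R := - (dh (A t x y) * (t * p / 2) * E t x y) + h (A t x y) * (E t x y * (t * q)).
pose g1 x y : R := (y - c) * (J (A t x y) * E t x y).
pose dg1 x y : R := (y - c) * K J dJ x y.
pose g2 x y : R := (c - x) * (J (A t x y) * E t x y).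
pose dg2 x y : R := (c - x) * K' J dJ x y.
have cg1 : cont2 g1 by rewrite /cont2 /g1 /A /E; cont.
have cdg1 : cont2 dg1 by rewrite /cont2 /dg1 /K /A /E; cont.
have cg2 : cont2 g2 by rewrite /cont2 /g2 /A /E; cont.
have cdg2 : cont2 dg2 by rewrite /cont2 /dg2 /K' /A /E; cont.
apply: (dint_eq0 _ _ (dibp1 cg1 cdg1 _) (dibp2 cg2 cdg2 _)).
- by rewrite /cont2; cont; rewrite ?/chi ?/dchi; cont.
- by rewrite /cont2; cont; rewrite ?/chi ?/dchi; cont.
- move=> x y; have h := is_derive_kernelx t x y JD.
  notypeclasses refine (is_derive_eqr _ _); first by rewrite /g1; deriv.
  by rewrite /= /dg1 /K; ring.
- move=> x y; have h := is_derive_kernely t x y JD.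
  notypeclasses refine (is_derive_eqr _ _); first by rewrite /g2; deriv.
  by rewrite /= /dg2 /K'; ring.
move=> x y; rewrite /g1 /dg1 /g2 /dg2 /K /K' /bcoef !chiE !dchiE.
move: (J (A t x y)) (dJ (A t x y)) (E t x y) => j0 j1 e.
by field.
Qed.

Lemma Qint_sum (t : R) :
  Qint l1 (l2 * l3) t + Qint l2 (l3 * l1) t + Qint l3 (l1 * l2) t =
  I (fun x y => (bcoef l1 (l2 * l3) x y + bcoef l2 (l3 * l1) x y + bcoef l3 (l1 * l2) x y)
     * (dJ (A t x y) * E t x y)).
Proof.
have cb c' ab' : cont2 (fun x y => bcoef c' ab' x y * (dJ (A t x y) * E t x y)).
  by rewrite /A /E /cont2 /bcoef; cont.
rewrite /Qint /I -dintD//; [|exact: cb..].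
rewrite -dintD//; [|by apply: continuous_funD; exact: cb|exact: cb].
congr (dint _ _ _ _ _ _ _); apply/funext => x; apply/funext => y.
by rewrite !mulrDl.
Qed.

(** The left-hand side is symmetric in the roots, hence a polynomial in the elementary symmetric
    functions [ab - c^2] and [c * ab], whichever root [c] is. *)
Hypothesis sumE : forall x y : R,
  bcoef l1 (l2 * l3) x y + bcoef l2 (l3 * l1) x y + bcoef l3 (l1 * l2) x y =
  2 * (ab - c ^+ 2) ^+ 2 - 3 / 2 * (x + y) * (c * ab)
  - 2 * (ab - c ^+ 2) * (2 * (x * y) + (ab - c ^+ 2) - (x + y) ^+ 2 / 2)
  + 3 * (x * y) * (x * y + (ab - c ^+ 2)).

Lemma Qint_ode (t : R) :
  t * dQint c ab t + t * q * c * Qint c ab t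
  + t * p * (c ^+ 2 - 4 * ab) / 4 * Pint c t + 3 * k * Qint c ab t
  + k * (Qint l1 (l2 * l3) t + Qint l2 (l3 * l1) t + Qint l3 (l1 * l2) t) = 0.
Proof.
rewrite Qint_sum /dQint /Qint /Pint -dint_comb5; last 5 first.
- by rewrite /A /E /cont2 /bcoef; cont.
- by rewrite /A /E /cont2 /bcoef; cont.
- by rewrite /A /E /cont2; cont.
- by rewrite /A /E /cont2 /bcoef; cont.
- by rewrite /A /E /cont2 /bcoef; cont.
pose K h dh x y : R := dh (A t x y) * (t * p / 2) * E t x y + h (A t x y) * (E t x y * (t * q)).
pose K' h dh x y : R := - (dh (A t x y) * (t * p / 2) * E t x y) + h (A t x y) * (E t x y * (t * q)).
(* The factor [y + c / 2] completes the square in [y^2 + c y + ab]. With [X = x + c / 2],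
   [Y = y + c / 2] and [d = ab - c^2 / 4], the divergence has [d2J] with the coefficient
   [(X - Y) (X Y - d)], up to the common factor [t p / 2 * (x - c) (y - c) * E]. *)
pose g1 x y : R := (y - c) * (y + c / 2) * (dJ (A t x y) * E t x y).
pose dg1 x y : R := (y - c) * (y + c / 2) * K dJ d2J x y.
pose g2 x y : R := (x - c) * (x + c / 2) * (dJ (A t x y) * E t x y).
pose dg2 x y : R := (x - c) * (x + c / 2) * K' dJ d2J x y.
have cg1 : cont2 g1 by rewrite /cont2 /g1 /A /E; cont.
have cdg1 : cont2 dg1 by rewrite /cont2 /dg1 /K /A /E; cont.
have cg2 : cont2 g2 by rewrite /cont2 /g2 /A /E; cont.
have cdg2 : cont2 dg2 by rewrite /cont2 /dg2 /K' /A /E; cont.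
apply: (dint_eq0 _ _ (dibp1 cg1 cdg1 _) (dibp2 cg2 cdg2 _)).
- by rewrite /cont2; cont; rewrite ?/chi ?/dchi; cont.
- by rewrite /cont2; cont; rewrite ?/chi ?/dchi; cont.
- move=> x y; have h := is_derive_kernelx t x y dJD.
  notypeclasses refine (is_derive_eqr _ _); first by rewrite /g1; deriv.
  by rewrite /= /dg1 /K; ring.
- move=> x y; have h := is_derive_kernely t x y dJD.
  notypeclasses refine (is_derive_eqr _ _); first by rewrite /g2; deriv.
  by rewrite /= /dg2 /K'; ring.
move=> x y; rewrite sumE /g1 /dg1 /g2 /dg2 /K /K' /bcoef !chiE !dchiE.
(* With the same common factor, [t * dQint] has [d2J] with the coefficient [(X - Y) (X Y + d)]. The
   Bessel equation removes the surplus [2 d (x - y)], whence the multiplier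
   [2 d = 2 ab - c^2 / 2]. *)
have := Jode (A t x y).
move: (J (A t x y)) (dJ (A t x y)) (d2J (A t x y)) (E t x y) => j0 j1 j2 e.
rewrite /A => ode; apply/eqP; rewrite -subr_eq0; apply/eqP.
transitivity (e * ((c - x) * (c - y)) * (2 * ab - c ^+ 2 / 2) *
  (t * (p * (x - y) / 2) * j2 - (t * (p * (x - y) / 2) * j0 - 2 * k * j1))).
  by field.
by rewrite ode subrr mulr0.
Qed.

End OdeForOneRoot.
End BesselIntegrals.

(** * The Dixon-Anderson integral *)

Section DixonAnderson.
Context (R : realType) (k l1 l2 l3 : R).
Hypothesis k0 : 0 < k.
Hypothesis l12 : l2 < l1.
Hypothesis l23 : l3 < l2.

Let al := l1 - l2.
Let be := l2 - l3.
Let ga := l1 - l3.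
(** Scaling [[l2, l1]] to [[0, 1]] turns [x - l3] into [ga * X xi u]. Scaling [[l3, l2]] downwards
    from [l2] turns [l1 - y] into [ga * X (1 - xi) u]. The two parameters are the complementary pair
    that occurs in [legendre]. *)
Let xi := be / ga.
Let omega (u : R) := (u * (1 - u)) `^ (k - 1).
Let X (x u : R) := x + (1 - x) * u.

Let al0 : 0 < al. Proof. by rewrite subr_gt0. Qed.
Let be0 : 0 < be. Proof. by rewrite subr_gt0. Qed.
Let ga0 : 0 < ga. Proof. by rewrite subr_gt0 (lt_trans l23). Qed.
Let xi01 : 0 < xi < 1.
Proof.
rewrite /xi divr_gt0//= ltr_pdivrMr// mul1r /be /ga.
by rewrite ltrD2r.
Qed.
Let eta01 : 0 < 1 - xi < 1.
Proof. by move: xi01 => /andP[? ?]; lra. Qed.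
Let gaX u : al * u + be = ga * X xi u.
Proof. by rewrite /X /xi /al /be /ga; field; exact: lt0r_neq0. Qed.
Let gaX' u : al + be * u = ga * X (1 - xi) u.
Proof. by rewrite /X /xi /al /be /ga; field; exact: lt0r_neq0. Qed.

Let X_ge0 x u : 0 < x < 1 -> 0 <= u -> 0 <= X x u.
Proof.
by move=> /andP[x0 x1] u0; rewrite /X addr_ge0 ?(ltW x0)// mulr_ge0// subr_ge0 ltW.
Qed.

Let cX x s : 0 < x < 1 -> {within `[0, 1], continuous (fun u : R => X x u `^ s)}.
Proof.
move=> /andP[x0 x1]; apply: within_continuous_powR_gt0; first by rewrite /X; wcont.
move=> u; rewrite in_itv/= => /andP[u0 u1].
by rewrite /X ltr_pwDl// mulr_ge0// subr_ge0 ltW.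
Qed.

Let powRM3 (a b c s : R) : 0 <= a -> 0 <= b -> 0 <= c ->
  (a * b * c) `^ s = a `^ s * b `^ s * c `^ s.
Proof. by move=> a0 b0 c0; rewrite (powRM _ (mulr_ge0 a0 b0) c0) (powRM _ a0 b0). Qed.

Let wint_weight1 (f : R -> R) : {within `[l2, l1], continuous f} ->
  {within `[0, 1], continuous (fun u => f (al * u + l2))} ->
  (forall x : R, x \in `[l2, l1] -> 0 <= f x) ->
  wint l2 l1 (weight1 k l1 l2 l3) f = al * (al ^+ 2 * ga) `^ (k - 1) *
    wint 0 1 omega (fun u => f (al * u + l2) * X xi u `^ (k - 1)).
Proof.
move=> cf cf' f0.
have e0 : al * 0 + l2 = l2 by ring.
have e1 : al * 1 + l2 = l1 by rewrite /al; ring.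
have /integrableP[/measurable_EFinP mfw _] :=
  integrable_continuousM (integrable_weight1 k0 l12 l23) cf.
have := @Rintegral_affine R al l2 0 1 (fun x => f x * weight1 k l1 l2 l3 x) al0.
rewrite e0 e1 => /(_ mfw) H; rewrite [LHS]wintE H; last first.
  by move=> x x12; rewrite mulr_ge0 ?f0// powR_ge0.
rewrite -mulrA; congr (al * _).
rewrite -wintZ; last 2 first.
- exact: integrable_omega.
- by apply: within_funM => //; exact: cX.
rewrite wintE; apply: eq_Rintegral => u /set_mem /=; rewrite in_itv/= => /andP[u0 u1].
have -> : weight1 k l1 l2 l3 (al * u + l2) = (al ^+ 2 * ga * X xi u * (u * (1 - u))) `^ (k - 1).
  rewrite /weight1 /chi; congr (_ `^ _).
  by rewrite -[al ^+ 2 * ga * _]mulrA -gaX /al /be; ring.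
have a2 : 0 <= al ^+ 2 * ga by rewrite mulr_ge0 ?exprn_ge0 ?ltW.
have XX : 0 <= X xi u by exact: X_ge0.
have u1' : 0 <= 1 - u by rewrite subr_ge0.
by rewrite (powRM3 _ a2 XX (mulr_ge0 u0 u1')) /omega; ring.
Qed.

Let wint_weight2 (f : R -> R) : {within `[l3, l2], continuous f} ->
  {within `[0, 1], continuous (fun u => f (- be * u + l2))} ->
  (forall x : R, x \in `[l3, l2] -> 0 <= f x) ->
  wint l3 l2 (weight2 k l1 l2 l3) f = be * (be ^+ 2 * ga) `^ (k - 1) *
    wint 0 1 omega (fun u => f (- be * u + l2) * X (1 - xi) u `^ (k - 1)).
Proof.
move=> cf cf' f0.
have e0 : - be * 0 + l2 = l2 by ring.
have e1 : - be * 1 + l2 = l3 by rewrite /be; ring.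
have nbe : - be < 0 by rewrite oppr_lt0.
have /integrableP[/measurable_EFinP mfw _] :=
  integrable_continuousM (integrable_weight2 k0 l12 l23) cf.
have := @Rintegral_affineN R (- be) l2 0 1 (fun x => f x * weight2 k l1 l2 l3 x) nbe.
rewrite e0 e1 => /(_ mfw) H; rewrite [LHS]wintE H; last first.
  by move=> x x12; rewrite mulr_ge0 ?f0// powR_ge0.
rewrite opprK -mulrA; congr (be * _).
rewrite -wintZ; last 2 first.
- exact: integrable_omega.
- by apply: within_funM => //; exact: cX.
rewrite wintE; apply: eq_Rintegral => u /set_mem /=; rewrite in_itv/= => /andP[u0 u1].
have -> : weight2 k l1 l2 l3 (- be * u + l2) =
    (be ^+ 2 * ga * X (1 - xi) u * (u * (1 - u))) `^ (k - 1).
  rewrite /weight2 /chi; congr (_ `^ _).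
  by rewrite -[be ^+ 2 * ga * _]mulrA -gaX' /al /be; ring.
have a2 : 0 <= be ^+ 2 * ga by rewrite mulr_ge0 ?exprn_ge0 ?ltW.
have XX : 0 <= X (1 - xi) u by exact: X_ge0.
have u1' : 0 <= 1 - u by rewrite subr_ge0.
by rewrite (powRM3 _ a2 XX (mulr_ge0 u0 u1')) /omega; ring.
Qed.

Let moment_lin (x s : R) : 0 < x < 1 ->
  wint 0 1 omega (fun u => (X x u - x) * X x u `^ s) =
  moment k (s + 1) x - x * moment k s x.
Proof.
move=> x01; have io := integrable_omega k0.
have h0 := @cX _ s x01; have h1 := @cX _ (s + 1) x01.
transitivity (wint 0 1 omega (fun u => X x u `^ (s + 1) + (- x) * X x u `^ s)).
  apply: eq_wint => u; rewrite in_itv/= => /andP[u0 u1].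
  have X0 : 0 < X x u.
    by move: x01 => /andP[x0 x1]; rewrite /X ltr_pwDl// mulr_ge0// subr_ge0 ltW.
  by rewrite powRD ?(gt_eqF X0) ?implybT// powRr1 ?ltW//; ring.
rewrite wintD//; last by wcont.
by rewrite wintZ// mulNr.
Qed.

Lemma wint_dixon_anderson :
  wint l2 l1 (weight1 k l1 l2 l3) (fun x =>
    wint l3 l2 (weight2 k l1 l2 l3) (fun y => x - y)) =
  (al * ga * be) `^ (2 * k - 1) * (Beta (2 * k) k * Beta k k).
Proof.
have i1 := integrable_weight1 k0 l12 l23; have i2 := integrable_weight2 k0 l12 l23.
have io := integrable_omega k0.
pose N0 := wint l3 l2 (weight2 k l1 l2 l3) (fun=> 1).
pose N1 := wint l3 l2 (weight2 k l1 l2 l3) (fun y => l2 - y).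
pose M0 := wint l2 l1 (weight1 k l1 l2 l3) (fun=> 1).
pose M1 := wint l2 l1 (weight1 k l1 l2 l3) (fun x => x - l2).
have c1 (a b : R) : {within `[a, b], continuous (fun _ : R => 1 : R)} by wcont.
have c2 (a b : R) : {within `[a, b], continuous (fun x : R => x - l2)} by wcont.
have c3 (a b : R) : {within `[a, b], continuous (fun x : R => l2 - x)} by wcont.
transitivity (M1 * N0 + M0 * N1).
  transitivity (wint l2 l1 (weight1 k l1 l2 l3) (fun x => N0 * (x - l2) + N1 * 1)).
    apply: eq_wint => x _.
    transitivity (wint l3 l2 (weight2 k l1 l2 l3) (fun y => (x - l2) * 1 + (l2 - y))).
      by apply: eq_wint => y _; ring.
    rewrite wintD//; last by wcont.
    by rewrite wintZ// -/N0 -/N1; ring.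
  rewrite wintD//; [|by wcont|by wcont].
  by rewrite !wintZ// -/M0 -/M1; ring.
have m0 : M0 = al * (al ^+ 2 * ga) `^ (k - 1) * moment k (k - 1) xi.
  rewrite /M0 wint_weight1//; congr (_ * _).
  by apply: eq_wint => u _; rewrite mul1r.
have n0 : N0 = be * (be ^+ 2 * ga) `^ (k - 1) * moment k (k - 1) (1 - xi).
  rewrite /N0 wint_weight2//; congr (_ * _).
  by apply: eq_wint => u _; rewrite mul1r.
have m1 : M1 = al * (al ^+ 2 * ga) `^ (k - 1) * (ga *
    (moment k k xi - xi * moment k (k - 1) xi)).
  rewrite /M1 wint_weight1//; [|by wcont|]; last first.
    by move=> x; rewrite in_itv/= subr_ge0 => /andP[].
  congr (_ * _); have := moment_lin (k - 1) xi01; rewrite subrK => <-.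
  have h0 := @cX _ (k - 1) xi01.
  rewrite -wintZ//; last by rewrite /X in h0 *; wcont.
  apply: eq_wint => u _; rewrite mulrA; congr (_ * _).
  by rewrite mulrBr -gaX /xi mulrCA mulfV ?gt_eqF//; ring.
have n1 : N1 = be * (be ^+ 2 * ga) `^ (k - 1) * (ga *
    (moment k k (1 - xi) - (1 - xi) * moment k (k - 1) (1 - xi))).
  rewrite /N1 wint_weight2//; [|by wcont|]; last first.
    by move=> x; rewrite in_itv/= subr_ge0 => /andP[].
  congr (_ * _); have := moment_lin (k - 1) eta01; rewrite subrK => <-.
  have h0 := @cX _ (k - 1) eta01.
  rewrite -wintZ//; last by rewrite /X in h0 *; wcont.
  apply: eq_wint => u _; rewrite mulrA; congr (_ * _).
  have -> : ga * (X (1 - xi) u - (1 - xi)) = (al + be * u) - ga + ga * xi.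
    by rewrite gaX'; ring.
  by rewrite /xi mulrCA mulfV ?gt_eqF// /al /be /ga; ring.
(* The terms with coefficients [xi] and [1 - xi] add up to one product of moments of order [k - 1],
   the last term of [legendre]. *)
have L := legendreE k0 xi01; rewrite /legendre in L.
rewrite m0 n0 m1 n1 -L.
have ab0 : 0 < al * ga * be by rewrite !mulr_gt0.
have -> : (al * ga * be) `^ (2 * k - 1) =
    al * ga * be * ((al ^+ 2 * ga) `^ (k - 1) * (be ^+ 2 * ga) `^ (k - 1)).
  have a2 : 0 <= al ^+ 2 * ga by rewrite mulr_ge0 ?exprn_ge0 ?ltW.
  have b2 : 0 <= be ^+ 2 * ga by rewrite mulr_ge0 ?exprn_ge0 ?ltW.
  rewrite -(powRM _ a2 b2).
  have -> : al ^+ 2 * ga * (be ^+ 2 * ga) = (al * ga * be) * (al * ga * be) by ring.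
  rewrite (powRM _ (ltW ab0) (ltW ab0)).
  have -> : 2 * k - 1 = 1 + ((k - 1) + (k - 1)) by ring.
  have nz (r s : R) : (r + s == 0) ==> (al * ga * be != 0) by rewrite (gt_eqF ab0) implybT.
  by rewrite (powRD (nz 1 (k - 1 + (k - 1)))) (powRD (nz (k - 1) (k - 1))) (powRr1 (ltW ab0)).
by ring.
Qed.

End DixonAnderson.

(** * The Dunkl equations along rays *)

Section RadialSystem.
Context (R : realType).

Lemma is_derive_funsum (n : nat) (g dg : 'I_n -> R -> R) (t : R) :
  (forall i, is_derive t (1 : R) (g i) (dg i t)) ->
  is_derive t (1 : R) (fun t => \sum_(i < n) g i t) (\sum_(i < n) dg i t).
Proof.
move=> gD; have -> : (fun t => \sum_(i < n) g i t) = \sum_(i < n) g i.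
  by apply/funext => u; rewrite fct_sumE.
exact: is_derive_sum.
Qed.

(** The difference is the sum of [(a_i - b_j)^2] over the nine pairs of an even and an odd
    permutation; the members of each pair differ by a transposition. *)
Lemma sum_sqr_diff_ge0 (a b : 'I_3 -> R) :
  2 * (\sum_i a i) * (\sum_i b i) <= 3 * \sum_i (a i ^+ 2 + b i ^+ 2).
Proof.
rewrite -subr_ge0 !big_ord_recl !big_ord0.
move: (a _) (a _) (a _) (b _) (b _) (b _) => a2 a1 a0 b2 b1 b0.
have -> : 3 * (a0 ^+ 2 + b0 ^+ 2 + (a1 ^+ 2 + b1 ^+ 2 + (a2 ^+ 2 + b2 ^+ 2 + 0)))
    - 2 * (a0 + (a1 + (a2 + 0))) * (b0 + (b1 + (b2 + 0))) =
  (a0 - b0) ^+ 2 + (a0 - b1) ^+ 2 + (a0 - b2) ^+ 2 +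
  (a1 - b0) ^+ 2 + (a1 - b1) ^+ 2 + (a1 - b2) ^+ 2 +
  (a2 - b0) ^+ 2 + (a2 - b1) ^+ 2 + (a2 - b2) ^+ 2 by ring.
by rewrite !addr_ge0// sqr_ge0.
Qed.

(* The reflection part of the system is negative semidefinite, so the squared
   norm [N] of a solution satisfies [N' <= 2 M N], hence vanishes with [N 0]. *)
Lemma radial_system_eq0 (k : R) (A : bool -> 'I_3 -> R)
    (f df : bool -> 'I_3 -> R -> R) : 0 <= k ->
  (forall s i (t : R), is_derive t (1 : R) (f s i) (df s i t)) ->
  (forall s i (t : R), 0 < t -> t * df s i t =
     t * A s i * f s i t - k * (3 * f s i t - \sum_j f (~~ s) j t)) ->
  (forall s i, f s i 0 = 0) -> forall s i, f s i 1 = 0.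
Proof.
move=> k0 fD ode f0.
pose N (t : R) := \sum_i (f true i t ^+ 2 + f false i t ^+ 2).
pose dN (t : R) := \sum_i (2 * f true i t * df true i t + 2 * f false i t * df false i t).
pose M := \sum_i (`|A true i| + `|A false i|).
have ND (t : R) : is_derive t (1 : R) N (dN t).
  apply: (is_derive_funsum (g := fun i t => f true i t ^+ 2 + f false i t ^+ 2)
    (dg := fun i t => 2 * f true i t * df true i t + 2 * f false i t * df false i t)).
  move=> i; have h1 := fD true i t; have h2 := fD false i t.
  under eq_fun do rewrite !expr2.
  notypeclasses refine (is_derive_eqr _ _); first by deriv.
  by rewrite /=; ring.
have AM s i : `|A s i| <= M.
  rewrite /M (bigD1 i)//= -addrA; case: s.
    by rewrite lerDl addr_ge0// sumr_ge0// => j _; rewrite addr_ge0.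
  by rewrite addrCA lerDl addr_ge0// sumr_ge0// => j _; rewrite addr_ge0.
have N0 t : 0 <= N t by rewrite sumr_ge0// => i _; rewrite addr_ge0// sqr_ge0.
have dNle (t : R) : 0 < t -> dN t <= 2 * M * N t.
  (* The system determines only [t * df s i t], so the inequality is proved after multiplication by
     [t]. *)
  move=> t0; rewrite -(ler_pM2l t0).
  have -> : t * dN t = 2 * t * \sum_i (A true i * f true i t ^+ 2 + A false i * f false i t ^+ 2)
     - 2 * k * (3 * N t - 2 * (\sum_i f true i t) * (\sum_i f false i t)).
    rewrite /dN mulr_sumr.
    transitivity (\sum_i (2 * f true i t * (t * df true i t) + 2 * f false i t * (t * df false i t))).
      by apply: eq_bigr => i _; ring.
    transitivity (\sum_i (2 * t * (A true i * f true i t ^+ 2 + A false i * f false i t ^+ 2)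
      - 2 * k * 3 * (f true i t ^+ 2 + f false i t ^+ 2)
      + 2 * k * (\sum_j f false j t) * f true i t + 2 * k * (\sum_j f true j t) * f false i t)).
      by apply: eq_bigr => i _; rewrite !ode//=; ring.
    by rewrite 3!big_split/= sumrN -!mulr_sumr /N; ring.
  have h := sum_sqr_diff_ge0 (fun i => f true i t) (fun i => f false i t).
  have h1 : 0 <= 2 * k * (3 * N t - 2 * (\sum_i f true i t) * (\sum_i f false i t)).
    by rewrite mulr_ge0 ?mulr_ge0// subr_ge0.
  have h2 : \sum_i (A true i * f true i t ^+ 2 + A false i * f false i t ^+ 2) <= M * N t.
    rewrite /N mulr_sumr; apply: ler_sum => i _; rewrite mulrDr lerD//.
      by rewrite ler_wpM2r ?sqr_ge0// (le_trans (ler_norm _)) ?AM.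
    by rewrite ler_wpM2r ?sqr_ge0// (le_trans (ler_norm _)) ?AM.
  have h3 : 2 * t * \sum_i (A true i * f true i t ^+ 2 + A false i * f false i t ^+ 2)
      <= 2 * t * (M * N t) by rewrite ler_wpM2l// mulr_ge0// ltW.
  have -> : t * (2 * M * N t) = 2 * t * (M * N t) by ring.
  by rewrite lerBlDr (le_trans h3)// lerDl.
(* Gronwall's argument: [H] is nonincreasing on [[0, 1]] and vanishes at 0, while [N] is
   non-negative. *)
pose H (t : R) := expR (- (2 * M) * t) * N t.
pose dH (t : R) := expR (- (2 * M) * t) * (dN t - 2 * M * N t).
have HD (t : R) : is_derive t (1 : R) H (dH t).
  have h := ND t; rewrite /H; notypeclasses refine (is_derive_eqr _ _); first by deriv.
  by rewrite /= /dH; ring.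
have H1 : H 1 <= H 0.
  have D1 (t : R) : t \in `]0, 1[ -> derivable H t 1 by case: (HD t).
  have D2 (t : R) : t \in `]0, 1[ -> derive1 H t <= 0.
    rewrite in_itv/= => /andP[t0 _]; have [_] := HD t; rewrite -derive1E => ->.
    by rewrite /dH mulr_ge0_le0 ?expR_ge0// subr_le0 dNle.
  have D3 : {within `[0, 1], continuous H}.
    by apply: derivable_within_continuous => t _; case: (HD t).
  exact: (ler0_derive1_nincr D1 D2 D3 (lexx 0) ler01 (lexx 1)).
have H00 : H 0 = 0 by rewrite /H /N big1 ?mulr0// => i _; rewrite !f0 expr0n addr0.
have N1 : N 1 = 0.
  apply/eqP; rewrite eq_le N0 andbT.
  have : H 1 <= 0 by rewrite -H00.
  by rewrite /H pmulr_rle0// expR_gt0.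
move=> s i; apply/eqP; rewrite -sqrf_eq0; apply/eqP.
have := psumr_eq0P (fun j _ => addr_ge0 (sqr_ge0 (f true j 1)) (sqr_ge0 (f false j 1))) N1.
move=> /(_ i isT)/eqP; rewrite paddr_eq0 ?sqr_ge0// => /andP[/eqP h1 /eqP h2].
by case: s.
Qed.

End RadialSystem.

(** * Derivatives along rays *)

Section ChainRule.
Context (R : realType).
Implicit Types (f : 'rV[R]_3 -> R) (x y z : 'rV[R]_3).

Lemma is_derive_partial f (i : 'I_3) z (s : R) :
  derivable f (z + s *: delta_mx 0 i) (delta_mx 0 i) ->
  is_derive s (1 : R) (fun s => f (z + s *: delta_mx 0 i))
    (partial i f (z + s *: delta_mx 0 i)).
Proof.
move=> df.
have E : (fun h : R => h^-1 *: (((fun s => f (z + s *: delta_mx 0 i)) \o shift s) (h *: (1 : R))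
      - f (z + s *: delta_mx 0 i))) =
    (fun h : R => h^-1 *: ((f \o shift (z + s *: delta_mx 0 i)) (h *: delta_mx 0 i)
      - f (z + s *: delta_mx 0 i))).
  apply/funext => h /=; congr (_ *: (f _ - _)).
  by rewrite [h *: 1]mulr1 scalerDl addrCA.
by apply: DeriveDef; [rewrite /derivable E|rewrite /partial /derive E].
Qed.

Lemma partial_MVT f (i : 'I_3) z (a : R) :
  (forall x, derivable f x (delta_mx 0 i)) ->
  exists2 th : R, `|th| <= `|a| &
    f (z + a *: delta_mx 0 i) - f z = a * partial i f (z + th *: delta_mx 0 i).
Proof.
move=> df.
have gD (s : R) : is_derive s (1 : R) (fun s => f (z + s *: delta_mx 0 i))
    (partial i f (z + s *: delta_mx 0 i)) by exact: is_derive_partial.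
have cg (u v : R) : {within `[u, v], continuous (fun s => f (z + s *: delta_mx 0 i))}.
  by apply: derivable_within_continuous => s _; case: (gD s).
have z0 : z = z + (0 : R) *: delta_mx 0 i by rewrite scale0r addr0.
have [a0|a0] := leP 0 a.
  have [th] := MVT_segment a0 (fun s _ => gD s) (@cg 0 a).
  rewrite in_itv/= => /andP[t0 ta] E; exists th; first by rewrite !ger0_norm.
  by rewrite {2}z0 E subr0 mulrC.
have [th] := MVT_segment (ltW a0) (fun s _ => gD s) (@cg a 0).
rewrite in_itv/= => /andP[ta t0] E; exists th.
  by rewrite !ler0_norm ?lerN2// ltW.
by rewrite {2}z0 -opprB E sub0r mulrN opprK mulrC.
Qed.

End ChainRule.

Section Rays.
Context (R : realType).
Implicit Types (f : 'rV[R]_3 -> R) (x y z : 'rV[R]_3).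

Lemma ord3_cases (P : 'I_3 -> Prop) : P 0 -> P 1 -> P 2 -> forall i, P i.
Proof.
move=> P0 P1 P2 [[|[|[|//]]] h].
- by rewrite (_ : Ordinal h = 0) //; apply: val_inj.
- by rewrite (_ : Ordinal h = 1) //; apply: val_inj.
- by rewrite (_ : Ordinal h = 2) //; apply: val_inj.
Qed.

Lemma sum_ord3 (V : nmodType) (F : 'I_3 -> V) : \sum_i F i = F 0 + F 1 + F 2.
Proof.
rewrite !big_ord_recl big_ord0 addr0 addrA.
by congr (_ + F _ + F _); apply: val_inj.
Qed.

(** [smooth] speaks of partial derivatives only, so the chain rule is obtained from their
    continuity: the increment is split into three steps parallel to the axes, with the mean value
    theorem on each. *)
Lemma is_derive_ray f x (t : R) :
  (forall i z, derivable f z (delta_mx 0 i)) ->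
  (forall i, continuous (partial i f)) ->
  is_derive t (1 : R) (fun t => f (t *: x)) (\sum_i x 0 i * partial i f (t *: x)).
Proof.
move=> df cf; set y := t *: x; set L := \sum_i _.
suff H : (fun h : R => h^-1 *: (((fun t => f (t *: x)) \o shift t) (h *: (1 : R)) - f y))
    @ 0^' --> L.
  by apply: DeriveDef; [apply/cvg_ex; exists L|exact: cvg_lim].
apply/(@cvgrPdist_le _ R^o) => e e0.
pose S := \sum_i `|x 0 i|; have S0 : 0 <= S by apply: sumr_ge0.
have xS i : `|x 0 i| <= S.
  by rewrite /S (bigD1 i)//= lerDl sumr_ge0.
have S1 : 0 < S + 1 by rewrite ltr_wpDl.
pose e' := e / (S + 1); have e'0 : 0 < e' by rewrite divr_gt0.
have [r r0 Hr] : exists2 r : R, 0 < r & forall i z, ball y r z ->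
    `|partial i f y - partial i f z| <= e'.
  have h i : \forall z \near y, `|partial i f y - partial i f z| <= e'.
    by have /(@cvgrPdist_le _ R^o) /(_ _ e'0) := cf i y.
  have hh : nbhs y [set z | `|partial 0 f y - partial 0 f z| <= e' /\
      (`|partial 1 f y - partial 1 f z| <= e' /\ `|partial 2 f y - partial 2 f z| <= e')].
    exact: (filterI (h 0) (filterI (h 1) (h 2))).
  have [r r0 Hr] := (nbhs_ballP _ _).1 hh.
  exists r => // i z /Hr [h0 [h1 h2]]; move: i; exact: ord3_cases.
near=> h.
have h_neq0 : h != 0 by near: h; exact: nbhs_dnbhs_neq.
have hr : `|h| * (S + 1) < r.
  rewrite -ltr_pdivlMr//; near: h; apply: dnbhs0_lt; exact: divr_gt0.
pose z1 := y + (h * x 0 0) *: delta_mx 0 0.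
pose z2 := z1 + (h * x 0 1) *: delta_mx 0 1.
have yE : (t + h) *: x = z2 + (h * x 0 2) *: delta_mx 0 2.
  by apply/rowP; apply: ord3_cases; rewrite /z2 /z1 /y !mxE !eqxx/=; ring.
have [th0 b0 E0] := partial_MVT y (h * x 0 0) (df 0).
have [th1 b1 E1] := partial_MVT z1 (h * x 0 1) (df 1).
have [th2 b2 E2] := partial_MVT z2 (h * x 0 2) (df 2).
have small (c : R) i : `|c| <= `|h * x 0 i| -> `|c| < r.
  move=> hc; apply: le_lt_trans hr; rewrite (le_trans hc)// normrM ler_wpM2l//.
  by rewrite (le_trans (xS i))// lerDl.
have bx i : `|h * x 0 i| < r by exact: (small _ i (lexx _)).
have s0 := small _ 0 b0; have s1 := small _ 1 b1; have s2 := small _ 2 b2.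
have D (a c : R) : `|c| < r -> `|a - (a + c)| < r by rewrite opprD addNKr normrN.
have D0 (a : R) : `|a - a| < r by rewrite subrr normr0.
have w0 : `|partial 0 f y - partial 0 f (y + th0 *: delta_mx 0 0)| <= e'.
  apply: Hr; split=> // i j; rewrite ord1; move: j.
  by apply: ord3_cases; rewrite /ball/= !mxE !eqxx/= ?(mulr1, mulr0, addr0); [exact: D|exact: D0..].
have w1 : `|partial 1 f y - partial 1 f (z1 + th1 *: delta_mx 0 1)| <= e'.
  apply: Hr; split=> // i j; rewrite ord1; move: j.
  by apply: ord3_cases; rewrite /ball/= /z1 !mxE !eqxx/= ?(mulr1, mulr0, addr0); [exact: D|exact: D|exact: D0].
have w2 : `|partial 2 f y - partial 2 f (z2 + th2 *: delta_mx 0 2)| <= e'.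
  apply: Hr; split=> // i j; rewrite ord1; move: j.
  by apply: ord3_cases; rewrite /ball/= /z2 /z1 !mxE !eqxx/= ?(mulr1, mulr0, addr0); [exact: D..].
have -> : (f \o (fun t => t *: x) \o shift t) (h *: 1) = f ((t + h) *: x).
  by rewrite /= [h *: 1]mulr1 addrC.
have -> : f ((t + h) *: x) - f y = h * (x 0 0 * partial 0 f (y + th0 *: delta_mx 0 0)
   + x 0 1 * partial 1 f (z1 + th1 *: delta_mx 0 1)
   + x 0 2 * partial 2 f (z2 + th2 *: delta_mx 0 2)).
  have -> : f ((t + h) *: x) - f y = (f (y + (h * x 0 0) *: delta_mx 0 0) - f y)
    + (f (z1 + (h * x 0 1) *: delta_mx 0 1) - f z1)
    + (f (z2 + (h * x 0 2) *: delta_mx 0 2) - f z2) by rewrite yE -/z1 -/z2; ring.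
  by rewrite E0 E1 E2; ring.
rewrite [_ *: _]mulrA mulVf// mul1r /L sum_ord3.
move: (partial 0 f (_ + _)) (partial 1 f (_ + _)) (partial 2 f (_ + _)) w0 w1 w2 => u0 u1 u2.
move: (partial 0 f y) (partial 1 f y) (partial 2 f y) => v0 v1 v2 w0 w1 w2.
have -> : x 0 0 * v0 + x 0 1 * v1 + x 0 2 * v2 - (x 0 0 * u0 + x 0 1 * u1 + x 0 2 * u2) =
  x 0 0 * (v0 - u0) + x 0 1 * (v1 - u1) + x 0 2 * (v2 - u2) by ring.
apply: (@le_trans _ _ (S * e')); last first.
  by rewrite /e' mulrA ler_pdivrMr// mulrC ler_wpM2l ?lerDl// ltW.
rewrite /S sum_ord3 !mulrDl; apply: (le_trans (ler_normD _ _)); apply: lerD.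
  apply: (le_trans (ler_normD _ _)); apply: lerD; by rewrite normrM ler_wpM2l.
by rewrite normrM ler_wpM2l.
Unshelve. all: by end_near. Qed.
End Rays.

(** * The radial part of the Dunkl equations *)

Section DunklRadial.
Context (R : realType).
Implicit Types (f : 'rV[R]_3 -> R) (x y : 'rV[R]_3).

(** Off the wall [x_i = x_j] the two quotients are opposite and the denominator cancels; on the wall
    the derivatives cancel and both sides vanish. *)
Lemma dunkl_quotientE (i j : 'I_3) f x :
  x 0 i * dunkl_quotient i j f x + x 0 j * dunkl_quotient j i f x =
  f x - f (xcol i j x).
Proof.
rewrite /dunkl_quotient (eq_sym (x 0 j)); case: eqVneq => [xij|xij].
  have -> : xcol i j x = x.
    apply/rowP => a; rewrite mxE; case: tpermP => [->|->|//]; by rewrite xij.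
  rewrite xij; move: (x 0 j) (partial i f x) (partial j f x) (f x) => a b c d.
  ring.
rewrite (_ : xcol j i x = xcol i j x); last by rewrite /xcol tpermC.
have h1 : x 0 i - x 0 j != 0 by rewrite subr_eq0.
have h2 : x 0 j - x 0 i != 0 by rewrite subr_eq0 eq_sym.
by field; rewrite h1 h2.
Qed.

Lemma dunkl_radial (k : R) f x y :
  (forall i, dunkl_operator k i f x = y 0 i * f x) ->
  \sum_i x 0 i * partial i f x = (\sum_i x 0 i * y 0 i) * f x
    - k * (3 * f x - (f (xcol 0 1 x) + f (xcol 0 2 x) + f (xcol 1 2 x))).
Proof.
move=> ode; rewrite !sum_ord3.
have := ode 0; have := ode 1; have := ode 2.
have sum0 (g : 'I_3 -> R) : \sum_(j < 3 | j != 0) g j = g 1 + g 2.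
  by rewrite big_mkcond sum_ord3/= add0r.
have sum1 (g : 'I_3 -> R) : \sum_(j < 3 | j != 1) g j = g 0 + g 2.
  by rewrite big_mkcond sum_ord3/= addr0.
have sum2 (g : 'I_3 -> R) : \sum_(j < 3 | j != 2) g j = g 0 + g 1.
  by rewrite big_mkcond sum_ord3/= addr0.
rewrite /dunkl_operator sum0 sum1 sum2.
have q01 := dunkl_quotientE 0 1 f x.
have q02 := dunkl_quotientE 0 2 f x.
have q12 := dunkl_quotientE 1 2 f x.
move=> /(canRL (addrK _)) -> /(canRL (addrK _)) -> /(canRL (addrK _)) ->.
transitivity ((x 0 0 * y 0 0 + x 0 1 * y 0 1 + x 0 2 * y 0 2) * f x - k * (
  (x 0 0 * dunkl_quotient 0 1 f x + x 0 1 * dunkl_quotient 1 0 f x) +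
  (x 0 0 * dunkl_quotient 0 2 f x + x 0 2 * dunkl_quotient 2 0 f x) +
  (x 0 1 * dunkl_quotient 1 2 f x + x 0 2 * dunkl_quotient 2 1 f x))).
  ring.
rewrite q01 q02 q12; ring.
Qed.

(* The orbit of [m] under permutations of the coordinates, indexed so that
   every transposition exchanges the two families [s = true] (the even
   permutations) and [s = false]. *)
Definition orbit_pt (m : 'rV[R]_3) (s : bool) (i : 'I_3) : 'rV[R]_3 :=
  \row_j m 0 (if s then j - i - 1 else i - 1 - j).

(** Modulo 3 the three transpositions are [j -> c - j] with [c = 1, 2, 0]. Composition with
    [j -> j - i - 1] or [j -> i - 1 - j] gives the map of the other family with index [c - i]. *)
Lemma xcol_orbit_pt m s i :
  [/\ xcol 0 1 (orbit_pt m s i) = orbit_pt m (~~ s) (1 - i),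
      xcol 0 2 (orbit_pt m s i) = orbit_pt m (~~ s) (2 - i) &
      xcol 1 2 (orbit_pt m s i) = orbit_pt m (~~ s) (- i)].
Proof.
by case: s; move: i; apply: ord3_cases; split; apply/rowP; apply: ord3_cases;
  rewrite !mxE permE /=; congr (m 0 _); apply: val_inj.
Qed.

Lemma sum_reindex_ord3 (g : 'I_3 -> R) i : g (1 - i) + g (2 - i) + g (- i) = \sum_j g j.
Proof.
rewrite sum_ord3; move: i; apply: ord3_cases.
- have -> : 1 - 0 = 1 :> 'I_3 by apply: val_inj.
  have -> : 2 - 0 = 2 :> 'I_3 by apply: val_inj.
  have -> : - 0 = 0 :> 'I_3 by apply: val_inj.
  ring.
- have -> : 1 - 1 = 0 :> 'I_3 by apply: val_inj.
  have -> : 2 - 1 = 1 :> 'I_3 by apply: val_inj.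
  have -> : - 1 = 2 :> 'I_3 by apply: val_inj.
  ring.
- have -> : 1 - 2 = 2 :> 'I_3 by apply: val_inj.
  have -> : 2 - 2 = 0 :> 'I_3 by apply: val_inj.
  have -> : - 2 = 1 :> 'I_3 by apply: val_inj.
  ring.
Qed.

End DunklRadial.

(** * The explicit solution *)

Section ExplicitSolution.
Context (R : realType) (k l1 l2 l3 : R).
Hypothesis k0 : 0 < k.
Hypothesis l12 : l2 < l1.
Hypothesis l23 : l3 < l2.
Hypothesis l0 : l1 + l2 + l3 = 0.
Variables p q : R.

Definition croot (i : 'I_3) : R :=
  match val i with 0%N => l1 | 1%N => l2 | _ => l3 end.
Definition cgap (i : 'I_3) : R :=
  match val i with 0%N => l2 - l3 | 1%N => l3 - l1 | _ => l1 - l2 end.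
Definition cprod (i : 'I_3) : R :=
  match val i with 0%N => l2 * l3 | 1%N => l3 * l1 | _ => l1 * l2 end.
Definition vdm : R := (l1 - l2) * (l1 - l3) * (l2 - l3).

Let l3E : l3 = - (l1 + l2).
Proof. by apply/eqP; rewrite -addr_eq0 addrC l0. Qed.

Let D := Dint k l1 l2 l3 (besselJ k) p q.
Let P i := Pint k l1 l2 l3 (besselJ k) p q (croot i).
Let Q i := Qint k l1 l2 l3 (derive1 (besselJ k)) p q (croot i) (cprod i).
Let dP i := dPint k l1 l2 l3 (besselJ k) (derive1 (besselJ k)) p q (croot i).
Let dQ i := dQint k l1 l2 l3 (derive1 (besselJ k)) (derive1 (derive1 (besselJ k)))
  p q (croot i) (cprod i).

(** For [s = true] and [i = 2] this is the integral of the theorem along the ray. The others permute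
    the roots in the polynomial factors. An odd permutation reverses the gap; removing the overall
    sign restores it and reverses the sign of [Q] instead, and all six values at 0 agree. *)
Definition sol (s : bool) (i : 'I_3) (t : R) : R :=
  3 * cgap i * P i t - (if s then 1 else - 1) * 6 * Q i t.
Definition dsol (s : bool) (i : 'I_3) (t : R) : R :=
  3 * cgap i * dP i t - (if s then 1 else - 1) * 6 * dQ i t.
(** The scalar product of an orbit point with [l]; see [orbit_pt_expnt]. *)
Definition expnt (s : bool) (i : 'I_3) : R :=
  (if s then 1 else - 1) * p * cgap i / 2 - q * croot i.

Lemma is_derive_sol s i t : is_derive t (1 : R) (sol s i) (dsol s i t).
Proof.
have h1 := is_derive_Pint k0 l12 l23 (continuous_besselJ k0) (continuous_dbesselJ k0)
  (is_derive_besselJ k0) p q (croot i) t.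
have h2 := is_derive_Qint k0 l12 l23 (continuous_dbesselJ k0) (continuous_d2besselJ k0)
  (is_derive_dbesselJ k0) p q (croot i) (cprod i) t.
rewrite /sol /dsol /P /Q /dP /dQ.
notypeclasses refine (is_derive_eqr _ _); first by deriv.
by rewrite /=; ring.
Qed.

Let chiE i x : chi l1 l2 l3 x = (x - croot i) * (x ^+ 2 + croot i * x + cprod i).
Proof. by move: i; apply: ord3_cases; rewrite /chi /croot /cprod /= l3E; ring. Qed.

Let dchiE i x : dchi l1 l2 l3 x =
  x ^+ 2 + croot i * x + cprod i + (x - croot i) * (2 * x + croot i).
Proof. by move: i; apply: ord3_cases; rewrite /dchi /croot /cprod /= l3E; ring. Qed.

Let sumE i x y :
  bcoef l1 (l2 * l3) x y + bcoef l2 (l3 * l1) x y + bcoef l3 (l1 * l2) x y =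
  2 * (cprod i - croot i ^+ 2) ^+ 2 - 3 / 2 * (x + y) * (croot i * cprod i)
  - 2 * (cprod i - croot i ^+ 2) *
    (2 * (x * y) + (cprod i - croot i ^+ 2) - (x + y) ^+ 2 / 2)
  + 3 * (x * y) * (x * y + (cprod i - croot i ^+ 2)).
Proof.
by move: i; apply: ord3_cases; rewrite /bcoef /croot /cprod /= l3E; field.
Qed.

Let cgap_dchi i : cgap i * dchi l1 l2 l3 (croot i) = vdm.
Proof. by move: i; apply: ord3_cases; rewrite /dchi /croot /cgap /vdm /=; ring. Qed.

(** Both sides are the discriminant of [x^2 + c x + ab], whose roots are the two roots other than
    [c]. *)
Let cgap_sqr i : cgap i ^+ 2 = croot i ^+ 2 - 4 * cprod i.
Proof. by move: i; apply: ord3_cases; rewrite /cprod /croot /cgap /= l3E; ring. Qed.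

Let P_ode i t : t * dP i t = - (t * q * croot i * P i t + t * p * Q i t
  + 3 * k * P i t - k * dchi l1 l2 l3 (croot i) * D t).
Proof.
have := Pint_ode k0 l12 l23 (continuous_besselJ k0) (continuous_dbesselJ k0)
  (is_derive_besselJ k0) p q (chiE i) (dchiE i) t.
rewrite -/(P i) -/(Q i) -/(dP i) -/D.
move: (P i t) (Q i t) (dP i t) (D t) => a b c d h.
by apply/eqP; rewrite -subr_eq0; apply/eqP; rewrite -[RHS]h; ring.
Qed.

Let sumQ t : \sum_j Q j t = Qint k l1 l2 l3 (derive1 (besselJ k)) p q l1 (l2 * l3) t
 + Qint k l1 l2 l3 (derive1 (besselJ k)) p q l2 (l3 * l1) t
 + Qint k l1 l2 l3 (derive1 (besselJ k)) p q l3 (l1 * l2) t.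
Proof. by rewrite sum_ord3. Qed.

Let Q_ode i t : t * dQ i t = - (t * q * croot i * Q i t
  + t * p * cgap i ^+ 2 / 4 * P i t + 3 * k * Q i t + k * \sum_j Q j t).
Proof.
have := Qint_ode k0 l12 l23 (continuous_besselJ k0) (continuous_dbesselJ k0)
  (continuous_d2besselJ k0) (is_derive_dbesselJ k0) (besselJ_ode k0)
  p q (chiE i) (dchiE i) (sumE i) t.
rewrite -sumQ -cgap_sqr -/(P i) -/(Q i) -/(dQ i).
move: (P i t) (Q i t) (dQ i t) (\sum_j _) => a b c d h.
by apply/eqP; rewrite -subr_eq0; apply/eqP; rewrite -[RHS]h; ring.
Qed.

(** This integrates the identity [sum cgap_j (c_j - x) (c_j - y) = vdm]: the sums of [cgap_j] and of
    [cgap_j c_j] vanish, and that of [cgap_j c_j^2] is the Vandermonde product. *)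
Let sum_cgap_P t : \sum_j cgap j * P j t = vdm * D t.
Proof.
have iw1 := integrable_weight1 k0 l12 l23; have iw2 := integrable_weight2 k0 l12 l23.
have cJ := continuous_besselJ k0.
have cp (c : R) : continuous (fun z : R * R => (z.1 - z.2) * ((c - z.1) * (c - z.2)) *
   (besselJ k (t * (p * (z.1 - z.2) / 2)) * expR (t * (q * (z.1 + z.2))))) by cont.
have cz (a c : R) : continuous (fun z : R * R => a * ((z.1 - z.2) * ((c - z.1) * (c - z.2)) *
   (besselJ k (t * (p * (z.1 - z.2) / 2)) * expR (t * (q * (z.1 + z.2)))))) by cont.
have cd : continuous (fun z : R * R => (z.1 - z.2) *
   (besselJ k (t * (p * (z.1 - z.2) / 2)) * expR (t * (q * (z.1 + z.2))))) by cont.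
rewrite sum_ord3 /P /D /Pint /Dint -(dintZ iw1 iw2 _ cd).
rewrite -(dintZ iw1 iw2 _ (cp (croot 0))) -(dintZ iw1 iw2 _ (cp (croot 1))).
rewrite -(dintZ iw1 iw2 _ (cp (croot 2))).
rewrite -(dintD iw1 iw2 (cz _ _) (cz _ _)).
rewrite -(dintD iw1 iw2 (continuous_funD (cz _ _) (cz _ _)) (cz _ _)).
congr (dint _ _ _ _ _ _ _); apply/funext => x; apply/funext => y.
move: (besselJ _ _) (expR _) => j e; rewrite /cgap /croot /vdm /=; ring.
Qed.

(** The sum over the opposite family involves only [sum cgap_j P_j = vdm * D] and [sum Q_j]. Since
    [cgap_i chi'(c_i) = vdm] for every [i], these are the terms in [D] and in [sum Q_j] of the
    equations for [P_i] and [Q_i]. *)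
Lemma sol_ode s i t : t * dsol s i t =
  t * expnt s i * sol s i t - k * (3 * sol s i t - \sum_j sol (~~ s) j t).
Proof.
have -> : \sum_j sol (~~ s) j t = 3 * (\sum_j cgap j * P j t)
    + (if s then 1 else - 1) * 6 * \sum_j Q j t.
  rewrite !sum_ord3 /sol; case: s; rewrite /=; ring.
rewrite sum_cgap_P -(cgap_dchi i).
have -> : t * dsol s i t = 3 * cgap i * (t * dP i t)
   - (if s then 1 else - 1) * 6 * (t * dQ i t) by rewrite /dsol; ring.
rewrite P_ode Q_ode /sol /expnt.
move: (P i t) (Q i t) (D t) (\sum_j _) (cgap i) (croot i) (dchi _ _ _ _) => a b c d e f g.
by case: s; field.
Qed.

(** [Q] vanishes at 0 because the Bessel function has derivative 0 there. At [t = 0] the equation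
    for [P] reads [3 k P = k chi'(c) D], so [D 0] is the only integral to evaluate. *)
Lemma sol0 s i : sol s i 0 = vdm `^ (2 * k) * (Beta (2 * k) k * Beta k k).
Proof.
have V0 : 0 < vdm by rewrite /vdm !mulr_gt0 ?subr_gt0// (lt_trans l23).
have iw1 := integrable_weight1 k0 l12 l23; have iw2 := integrable_weight2 k0 l12 l23.
have -> : vdm `^ (2 * k) = vdm * vdm `^ (2 * k - 1).
  have nz : (1 + (2 * k - 1) == 0) ==> (vdm != 0) by rewrite (gt_eqF V0) implybT.
  have := powRD nz; rewrite (powRr1 (ltW V0)) => <-.
  by congr (_ `^ _); ring.
rewrite -mulrA -(wint_dixon_anderson k0 l12 l23).
have -> : wint l2 l1 (weight1 k l1 l2 l3)
   (fun x => wint l3 l2 (weight2 k l1 l2 l3) (fun y => x - y)) = D 0.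
  rewrite /D /Dint; apply: eq_wint => x _; apply: eq_wint => y _.
  by rewrite !mul0r besselJ0// expR0 !mulr1.
have Q0 : Q i 0 = 0.
  have c0 : continuous (fun _ : R * R => 0 : R) by exact: continuous_funcst.
  rewrite -[RHS](mul0r (dint l2 l1 l3 l2 (weight1 k l1 l2 l3) (weight2 k l1 l2 l3) (fun _ _ => 0))).
  rewrite -(dintZ iw1 iw2 0 c0) /Q /Qint.
  congr (dint _ _ _ _ _ _ _); apply/funext => x; apply/funext => y.
  by rewrite !mul0r dbesselJ0// mul0r mulr0.
have := P_ode i 0; rewrite /sol Q0 -(cgap_dchi i).
move: (P i 0) (D 0) => a b; rewrite !(mul0r, mulr0, add0r, subr0) => /esym/eqP.
rewrite oppr_eq0 subr_eq0 => /eqP h.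
have kk : k != 0 by rewrite gt_eqF.
apply: (mulfI kk); transitivity (cgap i * (3 * k * a)); first by ring.
by rewrite h; ring.
Qed.

End ExplicitSolution.

(** * Identification with the Dunkl kernel *)

Section Orbit.
Context (R : realType).

Lemma dunkl_orbit_ode (k : R) (f : 'rV[R]_3 -> R) (y m : 'rV[R]_3) s i (t : R) :
  (forall i x, dunkl_operator k i f x = y 0 i * f x) ->
  t * \sum_j orbit_pt m s i 0 j * partial j f (t *: orbit_pt m s i) =
  t * (\sum_j orbit_pt m s i 0 j * y 0 j) * f (t *: orbit_pt m s i)
  - k * (3 * f (t *: orbit_pt m s i) - \sum_j f (t *: orbit_pt m (~~ s) j)).
Proof.
move=> ode; have := dunkl_radial (fun j => ode j (t *: orbit_pt m s i)).
have [e1 e2 e3] := xcol_orbit_pt m s i.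
have xZ a b : xcol a b (t *: orbit_pt m s i) = t *: xcol a b (orbit_pt m s i).
  by apply/rowP => j; rewrite !mxE.
rewrite !xZ e1 e2 e3 (sum_reindex_ord3 (fun j => f (t *: orbit_pt m (~~ s) j)) i).
have sZ (g : 'I_3 -> R) : \sum_j (t *: orbit_pt m s i) 0 j * g j =
    t * \sum_j orbit_pt m s i 0 j * g j.
  by rewrite mulr_sumr; apply: eq_bigr => j _; rewrite mxE mulrA.
by rewrite !sZ.
Qed.

(** The indexing of the orbit places the entry [m 0 2] in coordinate [i] for both values of [s],
    which matches the root [croot i] singled out in [sol s i]. *)
Lemma orbit_pt_expnt (l m : 'rV[R]_3) s i : l 0 0 + l 0 1 + l 0 2 = 0 ->
  \sum_j orbit_pt m s i 0 j * l 0 j =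
  expnt (l 0 0) (l 0 1) (l 0 2) (m 0 0 - m 0 1) ((m 0 0 + m 0 1 - 2 * m 0 2) / 2) s i.
Proof.
move=> l0; have l2E : l 0 2 = - (l 0 0 + l 0 1).
  by apply/eqP; rewrite -addr_eq0 addrC l0.
rewrite sum_ord3 !mxE /expnt; case: s; move: i; apply: ord3_cases;
  rewrite /cgap /croot /=.
- transitivity (m 0 2 * l 0 0 + m 0 0 * l 0 1 + m 0 1 * l 0 2).
    by congr (m 0 _ * _ + m 0 _ * _ + m 0 _ * _); apply: val_inj.
  by rewrite l2E; field.
- transitivity (m 0 1 * l 0 0 + m 0 2 * l 0 1 + m 0 0 * l 0 2).
    by congr (m 0 _ * _ + m 0 _ * _ + m 0 _ * _); apply: val_inj.
  by rewrite l2E; field.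
- transitivity (m 0 0 * l 0 0 + m 0 1 * l 0 1 + m 0 2 * l 0 2).
    by congr (m 0 _ * _ + m 0 _ * _ + m 0 _ * _); apply: val_inj.
  by rewrite l2E; field.
- transitivity (m 0 2 * l 0 0 + m 0 1 * l 0 1 + m 0 0 * l 0 2).
    by congr (m 0 _ * _ + m 0 _ * _ + m 0 _ * _); apply: val_inj.
  by rewrite l2E; field.
- transitivity (m 0 0 * l 0 0 + m 0 2 * l 0 1 + m 0 1 * l 0 2).
    by congr (m 0 _ * _ + m 0 _ * _ + m 0 _ * _); apply: val_inj.
  by rewrite l2E; field.
- transitivity (m 0 1 * l 0 0 + m 0 0 * l 0 1 + m 0 2 * l 0 2).
    by congr (m 0 _ * _ + m 0 _ * _ + m 0 _ * _); apply: val_inj.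
  by rewrite l2E; field.
Qed.

Lemma Beta_triple (k : R) : 0 < k ->
  Beta (2 * k) k * Beta k k = Gamma k ^+ 3 / Gamma (3 * k).
Proof.
move=> k0; have k20 : 0 < 2 * k by rewrite mulr_gt0.
have G3 : Gamma (3 * k) != 0 by rewrite gt_eqF// Gamma_gt0// mulr_gt0.
have G2 : Gamma (2 * k) != 0 by rewrite gt_eqF// Gamma_gt0.
have h1 := Gamma_mul k0 k0; have h2 := Gamma_mul k20 k0.
have e1 : k + k = 2 * k by ring.
have e2 : 2 * k + k = 3 * k by ring.
rewrite e1 in h1; rewrite e2 in h2.
move: h1 h2 G2 G3.
move: (Gamma k) (Gamma (2 * k)) (Gamma (3 * k)) (Beta (2 * k) k) (Beta k k) => a b c u v h1 h2 b0 c0.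
apply: (mulfI b0); apply: (mulfI c0); transitivity (c * u * (b * v)); first by ring.
by rewrite -h1 -h2; field.
Qed.

End Orbit.

Section Kernel.
Context (R : realType) (k : R) (E : 'rV[R]_3 -> 'rV[R]_3 -> R) (l m : 'rV[R]_3).
Hypothesis k0 : 0 < k.
Hypothesis Ek : is_dunkl_kernel k E.
Hypothesis l0 : l 0 0 + l 0 1 + l 0 2 = 0.
Hypothesis l23 : l 0 2 < l 0 1.
Hypothesis l12 : l 0 1 < l 0 0.

Let p := m 0 0 - m 0 1.
Let q := (m 0 0 + m 0 1 - 2 * m 0 2) / 2.

Lemma dunkl_kernel_sol : E m l = Gamma (3 * k) / (V l `^ (2 * k) * Gamma k ^+ 3) *
  sol k (l 0 0) (l 0 1) (l 0 2) p q true 2 1.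
Proof.
have [Es Eode E0] := Ek l.
have V0 : 0 < V l by rewrite /V !mulr_gt0 ?subr_gt0// (lt_trans l23).
have VE : vdm (l 0 0) (l 0 1) (l 0 2) = V l by [].
set C := Gamma (3 * k) / _.
(* The factor [C] makes all six solutions equal to 1 at [t = 0], the value of the kernel at the
   origin. *)
have C1 : C * (V l `^ (2 * k) * (Beta (2 * k) k * Beta k k)) = 1.
  have G1 : Gamma k != 0 by rewrite gt_eqF// Gamma_gt0.
  have G3 : Gamma (3 * k) != 0 by rewrite gt_eqF// Gamma_gt0// mulr_gt0.
  have VV : V l `^ (2 * k) != 0 by rewrite gt_eqF// powR_gt0.
  rewrite (Beta_triple k0) /C; move: (Gamma k) (Gamma (3 * k)) (V l `^ _) G1 G3 VV => a b c G1 G3 VV.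
  by field; rewrite ?G1 ?G3 ?VV; repeat split.
pose F s i (t : R) := E (t *: orbit_pt m s i) l.
pose dF s i (t : R) := \sum_j orbit_pt m s i 0 j * partial j (E ^~ l) (t *: orbit_pt m s i).
pose S := sol k (l 0 0) (l 0 1) (l 0 2) p q.
pose dS := dsol k (l 0 0) (l 0 1) (l 0 2) p q.
have FD s i (t : R) : is_derive t (1 : R) (F s i) (dF s i t).
  apply: (@is_derive_ray _ (E ^~ l)).
    by move=> j z; have [_] := Es [::]; apply.
  by move=> j; have [] := Es [:: j].
have SD s i (t : R) := is_derive_sol k0 l12 l23 p q s i t.
(* Modulo 3, [j - 2 - 1 = j]: this index is the identity permutation. *)
have mE : 1 *: orbit_pt m true 2 = m.
  rewrite scale1r; apply/rowP => j; rewrite mxE.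
  by move: j; apply: ord3_cases; congr (m 0 _); apply: val_inj.
have HD s i (t : R) : is_derive t (1 : R) (fun t => F s i t - C * S s i t)
    (dF s i t - C * dS s i t).
  have h1 := FD s i t; have h2 := SD s i t; rewrite /S /dS.
  notypeclasses refine (is_derive_eqr _ _); first by deriv.
  by rewrite /=; ring.
have Hode s i (t : R) : 0 < t -> t * (dF s i t - C * dS s i t) =
    t * expnt (l 0 0) (l 0 1) (l 0 2) p q s i * (F s i t - C * S s i t)
    - k * (3 * (F s i t - C * S s i t) - \sum_j (F (~~ s) j t - C * S (~~ s) j t)).
  move=> t0; have h2 := sol_ode k0 l12 l23 l0 p q s i t.
  have h1 := dunkl_orbit_ode m s i t Eode.
  rewrite (orbit_pt_expnt m s i l0) -/p -/q in h1.
  rewrite mulrBr h1 mulrCA h2 -/S.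
  have -> : \sum_j (F (~~ s) j t - C * S (~~ s) j t) =
    \sum_j F (~~ s) j t - C * \sum_j S (~~ s) j t by rewrite sumrB mulr_sumr.
  rewrite -/(F s i t); move: (F s i t) (S s i t) (expnt _ _ _ _ _ _ _) => a b c.
  move: (\sum_j S _ _ _) (\sum_j F _ _ _) => d e.
  ring.
have H0 s i : F s i 0 - C * S s i 0 = 0.
  by rewrite /S /F (sol0 k0 l12 l23 l0) scale0r E0 VE C1 subrr.
rewrite -[in LHS]mE; apply/eqP; rewrite -subr_eq0; apply/eqP.
exact: (radial_system_eq0 (ltW k0) HD Hode H0 true 2).
Qed.

End Kernel.

Section IntegralForm.
Context (R : realType) (k : R) (l : 'rV[R]_3).
Hypothesis k0 : 0 < k.
Hypothesis l23 : l 0 2 < l 0 1.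
Hypothesis l12 : l 0 1 < l 0 0.

(** A power of a product splits only over non-negative factors; this is where the interlacing of [x]
    and [y] with the roots enters. *)
Lemma W_weights (x y : R) : l 0 1 <= x <= l 0 0 -> l 0 2 <= y <= l 0 1 ->
  W k x y l = weight1 k (l 0 0) (l 0 1) (l 0 2) x * weight2 k (l 0 0) (l 0 1) (l 0 2) y.
Proof.
move=> /andP[x1 x0] /andP[y2 y1].
have x2 : l 0 2 <= x by rewrite (le_trans (ltW l23)).
have y0 : y <= l 0 0 by rewrite (le_trans y1)// ltW.
rewrite /W /weight1 /weight2 -powRM.
- by congr (_ `^ _); rewrite /chi; ring.
- have -> : - chi (l 0 0) (l 0 1) (l 0 2) x = (l 0 0 - x) * (x - l 0 1) * (x - l 0 2).
    by rewrite /chi; ring.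
  by rewrite !mulr_ge0// subr_ge0.
- have -> : chi (l 0 0) (l 0 1) (l 0 2) y = (l 0 0 - y) * (l 0 1 - y) * (y - l 0 2).
    by rewrite /chi; ring.
  by rewrite !mulr_ge0// subr_ge0.
Qed.

Lemma sol_integral (m : 'rV[R]_3) :
  sol k (l 0 0) (l 0 1) (l 0 2) (m 0 0 - m 0 1) ((m 0 0 + m 0 1 - 2 * m 0 2) / 2) true 2 1 =
  \int[lebesgue_measure]_(nu1 in `[l 0 1, l 0 0])
  \int[lebesgue_measure]_(nu2 in `[l 0 2, l 0 1])
      ((3 * (l 0 0 - l 0 1) * (nu1 - nu2)
          * besselJ k ((m 0 0 - m 0 1) * (nu1 - nu2) / 2)
        - 6 * (nu1 * nu2 + l 0 2 / 2 * (nu1 + nu2) + l 0 0 * l 0 1)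
          * derive1 (besselJ k) ((m 0 0 - m 0 1) * (nu1 - nu2) / 2))
       * ((l 0 2 - nu1) * (l 0 2 - nu2))
       * expR ((m 0 0 + m 0 1 - 2 * m 0 2) * (nu1 + nu2) / 2)
       * W k nu1 nu2 l).
Proof.
have iw1 := integrable_weight1 k0 l12 l23; have iw2 := integrable_weight2 k0 l12 l23.
have cJ := continuous_besselJ k0; have cdJ := continuous_dbesselJ k0.
rewrite /sol /Pint /Qint; set p := m 0 0 - m 0 1; set q := _ / 2.
set fP := (X in dint _ _ _ _ _ _ X); set fQ := (X in _ - _ * dint _ _ _ _ _ _ X).
have cP : continuous (fun z : R * R => fP z.1 z.2) by rewrite /fP; cont.
have cQ : continuous (fun z : R * R => fQ z.1 z.2) by rewrite /fQ /bcoef; cont.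
pose a : R := 3 * cgap (l 0 0) (l 0 1) (l 0 2) 2.
have cP' : continuous (fun z : R * R => a * fP z.1 z.2) by rewrite /fP; cont.
have cQ' : continuous (fun z : R * R => - (1 * 6) * fQ z.1 z.2) by rewrite /fQ /bcoef; cont.
rewrite -mulNr -/a -(dintZ iw1 iw2 a cP) -(dintZ iw1 iw2 _ cQ).
rewrite -(dintD iw1 iw2 cP' cQ') /dint wintE.
apply: eq_Rintegral => x /set_mem; rewrite /= in_itv/= => hx.
have cx : {within `[l 0 2, l 0 1], continuous (fun y => a * fP x y + - (1 * 6) * fQ x y)}.
  apply: continuous_subspaceT.
  exact: (@continuous_section _ _ _ (fun x y => a * fP x y + - (1 * 6) * fQ x y) x
    (continuous_funD cP' cQ')).
(* The outer weight is constant for the inner integral and is moved inside, where it joins [weight2]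
   to form [W]. *)
rewrite mulrC -(wintZ _ iw2 cx) wintE.
apply: eq_Rintegral => y /set_mem; rewrite /= in_itv/= => hy.
rewrite (W_weights hx hy) /fP /fQ /bcoef /a /cgap /croot /cprod /p /q /= !mul1r.
have -> : (m 0 0 + m 0 1 - 2 * m 0 2) / 2 * (x + y) = (m 0 0 + m 0 1 - 2 * m 0 2) * (x + y) / 2.
  by ring.
move: (besselJ _ _) (derive1 _ _) (expR _) (weight1 _ _ _ _ _) (weight2 _ _ _ _ _) => j dj e v w.
by field.
Qed.

End IntegralForm.

Theorem theorem1 (R : realType) (k : R) (E : 'rV[R]_3 -> 'rV[R]_3 -> R)
    (l m : 'rV[R]_3) :
  0 < k ->
  is_dunkl_kernel k E ->
  l 0 0 + l 0 1 + l 0 2 = 0 ->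
  l 0 2 < l 0 1 ->
  l 0 1 < l 0 0 ->
  E m l =
    Gamma (3 * k) / (V l `^ (2 * k) * Gamma k ^+ 3) *
    \int[lebesgue_measure]_(nu1 in `[l 0 1, l 0 0])
    \int[lebesgue_measure]_(nu2 in `[l 0 2, l 0 1])
      ((3 * (l 0 0 - l 0 1) * (nu1 - nu2)
          * besselJ k ((m 0 0 - m 0 1) * (nu1 - nu2) / 2)
        - 6 * (nu1 * nu2 + l 0 2 / 2 * (nu1 + nu2) + l 0 0 * l 0 1)
          * derive1 (besselJ k) ((m 0 0 - m 0 1) * (nu1 - nu2) / 2))
       * ((l 0 2 - nu1) * (l 0 2 - nu2))
       * expR ((m 0 0 + m 0 1 - 2 * m 0 2) * (nu1 + nu2) / 2)
       * W k nu1 nu2 l).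
Proof.
move=> k0 Ek l0 l21 l10.
by rewrite (dunkl_kernel_sol m k0 Ek l0 l21 l10) (sol_integral k0 l21 l10).
Qed.
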